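(* Let $\nu>0$, let $k_0\ge 1$ be an integer, and let $u^0\in H^{k_0}(\mathbb T^2)$ be real-valued with mean zero. For $\tau>0$ define the iterates $$u^{n+1}=S_L(\tau)S_N(\tau)u^n,\qquad n\ge 0.$$ Then there exists a constant $\tau_*>0$ depending only on $\|u^0\|_{H^1}$ and $\nu$ such that if $0<\tau<\tau_*$, then $$\sup_{n\ge 0}\|u^n\|_{H^{k_0}(\mathbb T^2)}\le A_1<\infty,$$ where $A_1>0$ depends only on $(\|u^0\|_{H^{k_0}},\nu,k_0)$ (in particular, not on $\tau$ or $n$).
   Context: $\mathbb T^2=[-\pi,\pi]^2=\mathbb R^2/2\pi\mathbb Z^2$ is the $2\pi$-periodic torus and $H^s(\mathbb T^2)$ is the usual $L^2$-based Sobolev space. For $\tau>0$, $S_L(\tau)=e^{-\tau\nu\Delta^2}$ is the exact solution operator of $\partial_t u=-\nu\Delta^2u$, i.e. the Fourier multiplier with symbol $e^{-\tau\nu|k|^4}$, $k\in\mathbb Z^2$. $S_N(\tau)$ is the nonlinear map $S_N(\tau)w=w+\tau\Delta(w^3-w)$ (in the sense of distributions). This is the operator-splitting scheme with time step $\tau$ for the Cahn-Hilliard equation $\partial_tu=\Delta(-\nu\Delta u+u^3-u)$. *)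

(* Defs.v *)
From HB Require Import structures.
From mathcomp Require Import all_boot all_order all_algebra.
From mathcomp Require Export complex.
From mathcomp Require Export all_classical all_reals all_analysis.
Set Implicit Arguments.
Unset Strict Implicit.
Unset Printing Implicit Defensive.
Import Order.TTheory GRing.Theory Num.Theory.
Import numFieldNormedType.Exports.
Local Open Scope classical_set_scope.
Local Open Scope ring_scope.
Local Open Scope complex_scope.

Section Torus.
Variable R : realType.

(* Functions on T^2 are 2 pi-periodic functions on R^2; integrals over T^2 are
   Lebesgue integrals over the fundamental cell [-pi, pi]^2. *)
Definition torus_cell : set (R * R) := `[- pi, pi] `*` `[- pi, pi].

Definition torus_integral (f : R * R -> R) : R :=
  \int[(@lebesgue_measure R \x @lebesgue_measure R)%E]_(x in torus_cell) f x.

Definition torus_periodic (u : R * R -> R) : Prop :=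
  forall x : R * R,
    u (x.1 + 2 * pi, x.2) = u x /\ u (x.1, x.2 + 2 * pi) = u x.

Definition torus_L2 (u : R * R -> R) : Prop :=
  measurable_fun torus_cell u /\
  (@lebesgue_measure R \x @lebesgue_measure R)%E.-integrable torus_cell
    (fun x => (u x ^+ 2)%:E).

Definition mean_zero (u : R * R -> R) : Prop := torus_integral u = 0.

Definition laplacian (phi : R * R -> R) (x : R * R) : R :=
  derive1n 2 (fun s => phi (s, x.2)) x.1 +
  derive1n 2 (fun s => phi (x.1, s)) x.2.

(* A real distribution on T^2 is given by its pairing phi |-> <T, phi> with
   real test functions; only the pairings with smooth periodic phi matter. *)
Definition distribution_on_torus := (R * R -> R) -> R.

Definition regular_distribution (u : R * R -> R) : distribution_on_torus :=
  fun phi => torus_integral (fun x => u x * phi x).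

Definition distribution_laplacian (T : distribution_on_torus) :
    distribution_on_torus :=
  fun phi => T (laplacian phi).

Definition wave_dot (k : int * int) (x : R * R) : R :=
  k.1%:~R * x.1 + k.2%:~R * x.2.

Definition wave_normsq (k : int * int) : R := k.1%:~R ^+ 2 + k.2%:~R ^+ 2.

(* (2 pi)^-1 <T, e^{-i k.x}>, the pairing being extended C-linearly. With this
   (unitary) normalisation, u = (2 pi)^-1 \sum_k u^(k) e^{i k.x} and
   \sum_k |u^(k)|^2 is the integral of u^2 over the torus. *)
Definition distribution_fourier (T : distribution_on_torus) (k : int * int) :
    R[i] :=
  ((2 * pi)^-1)%:C *
  (T (fun x => cos (wave_dot k x)) -i* T (fun x => sin (wave_dot k x))).

Definition fourier (u : R * R -> R) : int * int -> R[i] :=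
  distribution_fourier (regular_distribution u).

Definition sobolev_norm (s : nat) (u : R * R -> R) : \bar R :=
  sqrte (\esum_(k in [set: int * int])
    ((1 + wave_normsq k) ^+ s * Normc.normc (fourier u k) ^+ 2)%:E).

Definition sobolev (s : nat) (u : R * R -> R) : Prop :=
  [/\ torus_periodic u, torus_L2 u & (sobolev_norm s u < +oo)%E].

Definition freq_box (N : nat) : set (int * int) :=
  [set k | `|k.1| <= N%:Z /\ `|k.2| <= N%:Z].

(* exp (- tau nu Delta^2) T, as the function
   x |-> (2 pi)^-1 \sum_k exp (- tau nu |k|^4) T^(k) e^{i k.x}: for tau, nu > 0
   and T a distribution, this series converges absolutely to a smooth function,
   and it is real-valued because T is real and the symbol is even. *)
Definition S_L (nu tau : R) (T : distribution_on_torus) (x : R * R) : R :=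
  limn (fun N : nat =>
    complex.Re (((2 * pi)^-1)%:C *
      \sum_(k \in freq_box N)
        (expR (- (tau * nu * wave_normsq k ^+ 2)))%:C *
        distribution_fourier T k *
        (cos (wave_dot k x) +i* sin (wave_dot k x)))).

Definition S_N (tau : R) (w : R * R -> R) : distribution_on_torus :=
  fun phi => regular_distribution w phi +
    tau * distribution_laplacian
            (regular_distribution (fun x => w x ^+ 3 - w x)) phi.

Fixpoint iterate (nu tau : R) (u0 : R * R -> R) (n : nat) : R * R -> R :=
  if n is m.+1 then S_L nu tau (S_N tau (iterate nu tau u0 m)) else u0.

End Torus.

(* Main.v *)
(** Write [W k = 1 + |k|^2], [n = |k|^2], and let [H], [G] be the coefficients
    of an iterate [w = u^j] and of [w^3 - w] in the real orthonormal basis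
    [(cos k.x + sin k.x) / (2 pi)]. One step of the scheme replaces [H] by
    [d = exp (- tau nu n^2) (H - tau n G)].

    Uniform H^1 bound. The modified energy
    [E w = 1/2 sum m H^2 + integral (w^2 - 1)^2 / 4], with
    [m = (exp (tau nu n^2) - 1) / (tau n) >= nu n], is chosen so that [d] solves
    [m d = - G - (d - H) / (tau n)]. Testing with [d - H] gives
    [E u^(j+1) <= E u^j] as soon as
    [(3/2) max (|u^j|, |u^(j+1)|)^2 <= (tau n)^-1 + m / 2] for every [k]; with
    [lam^4 = tau nu] the right-hand side is at least [nu / lam^2], whereas the
    energy itself bounds the square of the sup norms by [C / lam], because
    [m >= nu lam n^(3/2)] and the sum of [W^(-3/2)] is finite. So the energy
    decays for small [tau]. The energy of [u^1] is bounded independently of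
    [tau] by the smoothing of the first step.

    Uniform H^s bound. The estimate [|w^3|_(H^s)^2 <= C |w|_(H^(s+1))^2 |w|_(H^1)^4]
    follows from Cauchy-Schwarz on the trilinear Fourier sum. Together with
    [(1 + tau nu n^2) d^2 <= H^2 + (tau / nu) G^2] and
    [W^(s+1) <= eps W^(s+2) + eps^(-s) W], it makes
    [sum (W^s + (nu tau / 8) W^(s+2)) H^2] contract up to a source of size
    [O(tau)], at a rate proportional to [tau]. *)
From mathcomp Require Import all_boot all_order all_algebra.
From mathcomp Require Import ring lra zify.
Require Import Defs.
From mathcomp Require Import measurable_realfun.
Set Implicit Arguments.
Unset Strict Implicit.
Unset Printing Implicit Defensive.
Import Order.TTheory GRing.Theory Num.Theory.
Import numFieldNormedType.Exports.
Local Open Scope classical_set_scope.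
Local Open Scope ring_scope.

(** * Integration over the torus *)

Section TorusIntegral.
Variable R : realType.
Implicit Types (f g u v w : R * R -> R).

Local Notation mu := (@lebesgue_measure R \x @lebesgue_measure R)%E.
Local Notation cell := (@torus_cell R).

(** The datum may be merely in H^1, so [u ^+ 3] is not known to be integrable at the outset. The
    embedding of H^1 into L^4 is therefore part of the proof: the trilinear sum bounds the L^4 norm
    of partial sums, and duality with a truncation of [u] carries the bound over to [u]. This
    transfer, and the energy inequality, which mixes frequency sums with a spatial integral, rest on
    Parseval's identity, hence on the completeness of the basis.

    In the trilinear sum the obstacle is dimension two: the sum of [1 / W] diverges logarithmically.
    The resonance condition leaves only two of the three frequencies free, and this gives just
    enough room to use the convergent sum of [W^(-3/2)] instead.

    The first step stands apart because [m] grows like [exp (tau nu n^2)]: the energy of [u^0] may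
    be infinite, so a bound on it has to be created by the exponential. In H^s the cubic term costs
    one derivative. At the first step the exponential restores it; later it is paid from the H^(s+2)
    part of the functional, which the dissipation of the preceding step has left behind. *)

Lemma sqr_le_mul_of_quad (p q m : R) :
  (forall x y, 0 <= x ^+ 2 * p + 2 * x * y * m + y ^+ 2 * q) -> m ^+ 2 <= p * q.
Proof.
move=> quad.
have p0 : 0 <= p by have := quad 1 0; lra.
have q0 : 0 <= q by have := quad 0 1; lra.
have [q_eq|q_neq] := eqVneq q 0.
  have := quad m (- (p + 1)); rewrite q_eq mulr0 => h.
  have : m ^+ 2 * (p + 2) <= 0 by lra.
  by rewrite pmulr_lle0//; lra.
have q_gt0 : 0 < q by rewrite lt_def q_neq.
have := quad q (- m).
have -> : q ^+ 2 * p + 2 * q * - m * m + (- m) ^+ 2 * q = q * (p * q - m ^+ 2).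
  by ring.
by rewrite pmulr_rge0// subr_ge0.
Qed.

Definition torus_integrable f := mu.-integrable cell (EFin \o f).

Lemma measurable_torus_cell : measurable cell.
Proof. by apply: measurableX; exact: measurable_itv. Qed.

Lemma torus_cell_measure : mu cell = ((2 * pi) ^+ 2)%:E.
Proof.
pose J : set R := [set` `[- pi, pi]].
transitivity (@lebesgue_measure R J * @lebesgue_measure R J)%E.
  by apply: product_measure1E; exact: measurable_itv.
rewrite /J !lebesgue_measure_itv /= !lte_fin.
have p0 : (0 : R) < pi := pi_gt0 R.
have -> : - pi < pi :> R by lra.
by rewrite -EFinB -EFinM; congr EFin; ring.
Qed.

Lemma torus_integrable_cst c : torus_integrable (fun=> c).
Proof.
apply: measurable_bounded_integrable.
- exact: measurable_torus_cell.
- have : (mu cell < +oo)%E by rewrite torus_cell_measure ltry.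
  exact.
- exact: measurable_cst.
- exact: bounded_cst.
Qed.

Lemma torus_integral_cst (c : R) : torus_integral (fun=> c) = c * (2 * pi) ^+ 2.
Proof.
rewrite /torus_integral Rintegral_cst; last exact: measurable_torus_cell.
by have -> : fine (mu cell) = (2 * pi) ^+ 2 by rewrite torus_cell_measure.
Qed.

Lemma torus_integrable_measurable f :
  torus_integrable f -> measurable_fun cell f.
Proof. by move=> /measurable_int/measurable_EFinP. Qed.

Lemma torus_integrable_le f g : measurable_fun cell f ->
  (forall x, cell x -> `|f x| <= g x) -> torus_integrable g ->
  torus_integrable f.
Proof.
move=> mf fg ig.
apply: (@le_integrable _ _ R mu _ measurable_torus_cell (EFin \o f) (EFin \o g)) => //.
  exact/measurable_EFinP.
move=> x xD /=; rewrite lee_fin; apply: le_trans (ler_norm _).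
exact: fg.
Qed.

Lemma torus_integrable_bounded f c : measurable_fun cell f ->
  (forall x, cell x -> `|f x| <= c) -> torus_integrable f.
Proof. by move=> mf fc; apply: torus_integrable_le fc (torus_integrable_cst c). Qed.

Lemma torus_integrableD f g : torus_integrable f -> torus_integrable g ->
  torus_integrable (fun x => f x + g x).
Proof. by move=> fi gi; apply: integrableD fi gi; exact: measurable_torus_cell. Qed.

Lemma torus_integrableB f g : torus_integrable f -> torus_integrable g ->
  torus_integrable (fun x => f x - g x).
Proof. by move=> fi gi; apply: integrableB fi gi; exact: measurable_torus_cell. Qed.

Lemma torus_integrableZ c f : torus_integrable f ->
  torus_integrable (fun x => c * f x).
Proof. by move=> fi; apply: (integrableZl _ c fi); exact: measurable_torus_cell. Qed.

Lemma torus_integrable_norm f : torus_integrable f ->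
  torus_integrable (fun x => `|f x|).
Proof. by move=> fi; apply: integrable_norm fi; exact: measurable_torus_cell. Qed.

Lemma torus_integralD f g : torus_integrable f -> torus_integrable g ->
  torus_integral (fun x => f x + g x) = torus_integral f + torus_integral g.
Proof. by apply: RintegralD; exact: measurable_torus_cell. Qed.

Lemma torus_integralB f g : torus_integrable f -> torus_integrable g ->
  torus_integral (fun x => f x - g x) = torus_integral f - torus_integral g.
Proof. by apply: RintegralB; exact: measurable_torus_cell. Qed.

Lemma torus_integralZ (c : R) f : torus_integrable f ->
  torus_integral (fun x => c * f x) = c * torus_integral f.
Proof. by apply: RintegralZl; exact: measurable_torus_cell. Qed.

Lemma torus_integral_ge0 f : (forall x, cell x -> 0 <= f x) ->
  0 <= torus_integral f.
Proof. by move=> f0; exact: (@Rintegral_ge0 _ _ R mu). Qed.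

Lemma le_torus_integral f g : torus_integrable f -> torus_integrable g ->
  (forall x, cell x -> f x <= g x) -> torus_integral f <= torus_integral g.
Proof. by apply: le_Rintegral; exact: measurable_torus_cell. Qed.

Lemma eq_torus_integral f g : (forall x, cell x -> f x = g x) ->
  torus_integral f = torus_integral g.
Proof. by move=> fg; apply: eq_Rintegral => x /set_mem/fg. Qed.

Lemma le_norm_torus_integral f : torus_integrable f ->
  `|torus_integral f| <= torus_integral (fun x => `|f x|).
Proof. by apply: le_normr_Rintegral; exact: measurable_torus_cell. Qed.

Lemma torus_integrable_sum (J : Type) (r : seq J) (F : J -> R * R -> R) :
  (forall j, torus_integrable (F j)) ->
  torus_integrable (fun x => \sum_(j <- r) F j x).
Proof.
move=> Fi; elim: r => [|a r IH].
  by under eq_fun do rewrite big_nil; exact: torus_integrable_cst.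
by under eq_fun do rewrite big_cons; exact: torus_integrableD.
Qed.

Lemma torus_integral_sum (J : Type) (r : seq J) (F : J -> R * R -> R) :
  (forall j, torus_integrable (F j)) ->
  torus_integral (fun x => \sum_(j <- r) F j x) =
  \sum_(j <- r) torus_integral (F j).
Proof.
move=> Fi; elim: r => [|a r IH].
  by under eq_fun do rewrite big_nil; rewrite torus_integral_cst mul0r big_nil.
under eq_fun do rewrite big_cons.
by rewrite torus_integralD ?big_cons ?IH//; exact: torus_integrable_sum.
Qed.

Lemma torus_integral_dominated (F : nat -> R * R -> R) f g (N : set (R * R)) :
  (forall n, measurable_fun cell (F n)) -> measurable_fun cell f ->
  torus_integrable g ->
  (forall n x, cell x -> `|F n x| <= g x) ->
  mu.-negligible N ->
  (forall x, cell x -> ~ N x -> F ^~ x @ \oo --> f x) ->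
  (fun n => torus_integral (F n)) @ \oo --> torus_integral f.
Proof.
move=> mF mf ig Fg N0 Ff.
have mEF n : measurable_fun cell (EFin \o F n) by exact/measurable_EFinP.
have mEf : measurable_fun cell (EFin \o f) by exact/measurable_EFinP.
have cvE : {ae mu, forall x, cell x ->
    (fun n => (EFin \o F n) x) @ \oo --> (EFin \o f) x}.
  apply: negligibleS N0 => x /= nF; apply: contrapT => Nx; apply: nF => Dx.
  by apply: cvg_EFin (Ff x Dx Nx); exact: nearW.
have domE : {ae mu, forall x n, cell x ->
    (`|(EFin \o F n) x| <= (EFin \o g) x)%E}.
  by apply: aeW => x n Dx /=; rewrite lee_fin; exact: Fg.
have [fi _ cv] := @dominated_convergence _ _ R mu _ measurable_torus_cell
  _ _ _ mEF mEf cvE ig domE.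
have fin : (\int[mu]_(x in cell) (EFin \o f) x)%E \is a fin_num.
  by apply: integrable_fin_num fi; exact: measurable_torus_cell.
by move: cv; rewrite -(fineK fin) => /fine_cvg.
Qed.

Lemma torus_integrable_mul_bounded u v (c : R) : torus_integrable u ->
  measurable_fun cell v -> (forall x, `|v x| <= c) ->
  torus_integrable (fun x => u x * v x).
Proof.
move=> iu mv vc; apply: (torus_integrable_le _ _
  (torus_integrableZ c (torus_integrable_norm iu))).
  by apply: measurable_funM => //; exact: torus_integrable_measurable iu.
by move=> x _; rewrite normrM mulrC ler_wpM2r.
Qed.

Lemma torus_L2_integrable u : torus_L2 u -> torus_integrable u.
Proof.
move=> [mu_ iu]; apply: (torus_integrable_le mu_ _
  (torus_integrableD (torus_integrable_cst 1) iu)) => x _.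
rewrite -(real_normK (num_real (u x))).
by have := sqr_ge0 (`|u x| - 1); have := normr_ge0 (u x); nra.
Qed.

Lemma torus_L2_integrable_mul u v : torus_L2 u -> torus_L2 v ->
  torus_integrable (fun x => u x * v x).
Proof.
move=> [mu_ iu] [mv iv].
apply: (@torus_integrable_le _ (fun x => u x ^+ 2 + v x ^+ 2)).
- exact: measurable_funM.
- move=> x _; rewrite ler_norml; apply/andP; split; nra.
- exact: torus_integrableD.
Qed.

Lemma torus_L2_bounded u c : measurable_fun cell u ->
  (forall x, cell x -> `|u x| <= c) -> torus_L2 u.
Proof.
move=> mu_ uc; split => //.
apply: (@torus_integrable_bounded _ (c ^+ 2)).
  exact: measurable_funX.
move=> x Dx; rewrite normrX lerXn2r// ?nnegrE ?uc//.
exact: le_trans (uc x Dx).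
Qed.

Lemma torus_L2D u v : torus_L2 u -> torus_L2 v -> torus_L2 (fun x => u x + v x).
Proof.
move=> L2u L2v; have [mu_ iu] := L2u; have [mv iv] := L2v.
split; first exact: measurable_funD.
apply: (@torus_integrable_le _ (fun x => 2 * (u x ^+ 2 + v x ^+ 2))).
- by apply: measurable_funX; exact: measurable_funD.
- move=> x _; rewrite ger0_norm ?sqr_ge0//.
  by have := sqr_ge0 (u x - v x); nra.
- by apply: torus_integrableZ; exact: torus_integrableD.
Qed.

Lemma torus_L2Z c u : torus_L2 u -> torus_L2 (fun x => c * u x).
Proof.
move=> [mu_ iu]; split; first exact: measurable_funM.
apply: (@torus_integrable_le _ (fun x => c ^+ 2 * u x ^+ 2)).
- by apply: measurable_funX; exact: measurable_funM.
- by move=> x _; rewrite ger0_norm ?sqr_ge0// exprMn.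
- exact: torus_integrableZ.
Qed.

Lemma torus_L2B u v : torus_L2 u -> torus_L2 v -> torus_L2 (fun x => u x - v x).
Proof.
move=> L2u L2v; have := torus_L2D L2u (torus_L2Z (-1) L2v).
by under eq_fun do rewrite mulN1r.
Qed.

Lemma torus_L2_sum (J : Type) (r : seq J) (F : J -> R * R -> R) :
  (forall j, torus_L2 (F j)) -> torus_L2 (fun x => \sum_(j <- r) F j x).
Proof.
move=> Fi; elim: r => [|a r IH].
  under eq_fun do rewrite big_nil.
  by apply: (@torus_L2_bounded _ 0) => [|x _]; rewrite ?normr0.
by under eq_fun do rewrite big_cons; exact: torus_L2D.
Qed.

Lemma torus_CauchySchwarz u v : torus_L2 u -> torus_L2 v ->
  torus_integral (fun x => u x * v x) ^+ 2 <=
  torus_integral (fun x => u x ^+ 2) * torus_integral (fun x => v x ^+ 2).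
Proof.
move=> Lu Lv; have [_ iu] := Lu; have [_ iv] := Lv.
set a := torus_integral (fun x => u x ^+ 2).
set b := torus_integral (fun x => v x ^+ 2).
set c := torus_integral (fun x => u x * v x).
apply: sqr_le_mul_of_quad => s t.
have iuv := torus_L2_integrable_mul Lu Lv.
  have -> : s ^+ 2 * a + 2 * s * t * c + t ^+ 2 * b =
      torus_integral (fun x => (s * u x + t * v x) ^+ 2).
    rewrite /a /b /c -!torus_integralZ// -!torus_integralD//;
      do ?[exact: torus_integrableZ|apply: torus_integrableD].
    by apply: eq_torus_integral => x _; ring.
  by apply: torus_integral_ge0 => x _; exact: sqr_ge0.
Qed.

End TorusIntegral.

(** * Periods, means and orthogonality of plane waves *)

Section Waves.
Variable R : realType.
Implicit Types (f g u v w : R * R -> R) (k : int * int) (c : R).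

Local Notation leb := (@lebesgue_measure R).
Local Notation mu := (@lebesgue_measure R \x @lebesgue_measure R)%E.
Local Notation cell := (@torus_cell R).

Lemma sinD2pi_int (m : int) (x : R) : sin (x + m%:~R * (2 * pi)) = sin x.
Proof.
have P (n : nat) y : sin (y + n%:R * (2 * pi)) = sin y :> R.
  rewrite -[RHS](periodicn (@sinD2pi R) n) [n%:R * _]mulrC mulr_natr.
  by rewrite [2 * pi]mulrC mulr_natr.
by case: m => n; rewrite ?NegzE ?mulrNz ?mulNr; [exact: P | rewrite -[LHS](P n.+1) subrK].
Qed.

Lemma cosD2pi_int (m : int) (x : R) : cos (x + m%:~R * (2 * pi)) = cos x.
Proof. by rewrite -!sinDpihalf addrAC sinD2pi_int. Qed.

Lemma integral_cos_period (m : int) c : m != 0 ->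
  (\int[leb]_(t in [set` `[- pi, pi]%R]) (cos (m%:~R * t + c))%:E = 0)%E.
Proof.
move=> m0; have m0' : m%:~R != 0 :> R by rewrite intr_eq0.
have dF (t : R) : is_derive t (1 : R) (fun t => (m%:~R)^-1 * sin (m%:~R * t + c))
    (cos (m%:~R * t + c)).
  apply: is_derive_eq; rewrite /GRing.scale /= !(mulr1, mulr0, addr0, add0r).
  by rewrite mulrC -mulrA mulfV ?mulr1.
have cF : continuous (fun t : R => (m%:~R)^-1 * sin (m%:~R * t + c)).
  move=> t; apply/differentiable_continuous/derivable1_diffP.
  exact: ex_derive.
rewrite (@continuous_FTC2 _ _ (fun t => (m%:~R)^-1 * sin (m%:~R * t + c))).
- rewrite -EFinB -mulrBr.
  have -> : m%:~R * pi + c = (m%:~R * - pi + c) + m%:~R * (2 * pi) by ring.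
  by rewrite sinD2pi_int subrr mulr0.
- by have := pi_gt0 R; lra.
- apply: continuous_subspaceT => t; apply/differentiable_continuous/derivable1_diffP.
  exact: ex_derive.
- split.
  + by move=> t _; exact: ex_derive.
  + by apply: cvg_at_right_filter; apply: cF.
  + by apply: cvg_at_left_filter; apply: cF.
- by move=> t _; rewrite derive1E; apply: derive_val.
Qed.

Lemma measurable_wave_dot k : measurable_fun setT (@wave_dot R k).
Proof.
by apply: measurable_funD; apply: measurable_funM.
Qed.

Lemma measurable_cos_wave k c :
  measurable_fun setT (fun x : R * R => cos (wave_dot k x + c)).
Proof.
apply: measurableT_comp; last exact: measurable_funD (measurable_wave_dot k) _.
by apply: continuous_measurable_fun; exact: continuous_cos.
Qed.

(** Fubini in either order. The alternative is needed because a wave with [k.2 = 0] is constant in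
    the second variable and cancels only when integrated in the first one. *)
Lemma torus_integral_eq0_iterated f : torus_integrable f ->
  (forall x, (\int[leb]_(t in [set` `[- pi, pi]%R]) (f (x, t))%:E = 0)%E) \/
  (forall y, (\int[leb]_(t in [set` `[- pi, pi]%R]) (f (t, y))%:E = 0)%E) ->
  torus_integral f = 0.
Proof.
move=> fi f0; rewrite /torus_integral /Rintegral integral_mkcond.
have gi : mu.-integrable setT ((EFin \o f) \_ cell).
  have [+ _] := @integrable_mkcond _ _ R mu cell (EFin \o f) (@measurable_torus_cell R).
  exact.
case: f0 => f0.
  rewrite -(@integral12_prod_meas1 _ _ _ _ R leb leb _ gi) /=.
  rewrite [X in fine X](_ : _ = 0%E)//.
  rewrite (eq_integral (fun=> 0%E)) ?integral0// => x _; rewrite /fubini_F.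
  case: (boolP (x \in `[- pi, pi]%R)) => xI; last first.
    rewrite (eq_integral (fun=> 0%E)) ?integral0// => y _.
    rewrite patchE; case: ifPn => // /set_mem[/= xI' _].
    by rewrite xI' in xI.
  rewrite -[RHS](f0 x) [RHS]integral_mkcond; apply: eq_integral => y _.
  rewrite !patchE /=; congr (if _ then _ else _).
  by apply/idP/idP => /set_mem h; apply/mem_set => //; case: h.
rewrite -(@integral21_prod_meas1 _ _ _ _ R leb leb _ gi) /=.
rewrite [X in fine X](_ : _ = 0%E)//.
rewrite (eq_integral (fun=> 0%E)) ?integral0// => y _; rewrite /fubini_G.
case: (boolP (y \in `[- pi, pi]%R)) => yI; last first.
  rewrite (eq_integral (fun=> 0%E)) ?integral0// => x _.
  rewrite patchE; case: ifPn => // /set_mem[/= _ yI'].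
  by rewrite yI' in yI.
rewrite -[RHS](f0 y) [RHS]integral_mkcond; apply: eq_integral => x _.
rewrite !patchE /=; congr (if _ then _ else _).
by apply/idP/idP => /set_mem h; apply/mem_set => //; case: h.
Qed.

Lemma torus_integrable_cos_wave k c :
  torus_integrable (fun x => cos (wave_dot k x + c)).
Proof.
apply: (@torus_integrable_bounded _ _ 1) => [|x _]; last exact: cos_max.
by apply: measurable_funTS; exact: measurable_cos_wave.
Qed.

Lemma torus_integral_cos_wave k c :
  torus_integral (fun x => cos (wave_dot k x + c)) =
  if k == 0 then cos c * (2 * pi) ^+ 2 else 0.
Proof.
case: k => k1 k2; have [->|] := eqVneq (k1, k2) 0.
  rewrite -torus_integral_cst; apply: eq_torus_integral => x _.
  by rewrite /wave_dot /= !mul0r !add0r.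
have -> : ((k1, k2) != 0) = (k1 != 0) || (k2 != 0).
  by rewrite -negb_and -xpair_eqE.
move=> knz; apply: torus_integral_eq0_iterated.
  exact: torus_integrable_cos_wave.
have [k2_0|k2nz] := eqVneq k2 0; [right => y|left => x].
  rewrite -[RHS](@integral_cos_period k1 (k2%:~R * y + c)).
    by apply: eq_integral => t _; rewrite /wave_dot /= addrA.
  by move: knz; rewrite k2_0 eqxx orbF.
rewrite -[RHS](@integral_cos_period k2 (k1%:~R * x + c))//.
apply: eq_integral => t _; congr (EFin (cos _)).
by rewrite /wave_dot /=; ring.
Qed.

End Waves.

(** * Frequency boxes and Sobolev weights *)

Section LatticeSums.
Variable R : realType.
Implicit Types (k a b c : int * int) (s t : seq (int * int)) (g : int * int -> R).

Definition int_range (N : nat) : seq int :=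
  [seq i%:Z - N%:Z | i <- iota 0 N.*2.+1].

Definition box (N : nat) : seq (int * int) :=
  [seq (i, j) | i <- int_range N, j <- int_range N].

Lemma mem_int_range N (m : int) : (m \in int_range N) = (`|m| <= N%:Z).
Proof.
apply/mapP/idP => [[i + ->]|mN].
  by rewrite mem_iota; lia.
by exists (absz (m + N%:Z)); rewrite ?mem_iota; lia.
Qed.

Lemma mem_box N k : (k \in box N) = (`|k.1| <= N%:Z) && (`|k.2| <= N%:Z).
Proof.
apply/allpairsP/andP => [[[i j] /= [iN jN ->]]|[k1 k2]].
  by rewrite -!mem_int_range.
by exists k; rewrite !mem_int_range; case: k k1 k2.
Qed.

Lemma uniq_int_range N : uniq (int_range N).
Proof. by rewrite map_inj_uniq ?iota_uniq// => i j; lia. Qed.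

Lemma uniq_box N : uniq (box N).
Proof.
by apply: allpairs_uniq; rewrite ?uniq_int_range// => -[i j] [i' j'] _ _ [-> ->].
Qed.

Lemma box_subset N M : (N <= M)%N -> {subset box N <= box M}.
Proof. by move=> NM k; rewrite !mem_box; lia. Qed.

Lemma subset_box s : exists N, {subset s <= box N}.
Proof.
elim: s => [|k s [N sN]]; first by exists 0%N.
exists (maxn N (absz k.1 + absz k.2)%N) => j; rewrite inE => /orP[/eqP ->|/sN].
  by rewrite mem_box; lia.
by rewrite !mem_box; lia.
Qed.

Lemma box_opp N : perm_eq [seq - k | k <- box N] (box N).
Proof.
apply: uniq_perm; rewrite ?uniq_box//.
  by rewrite map_inj_uniq ?uniq_box//; exact: oppr_inj.
move=> k; apply/mapP/idP => [[j jN ->]|kN].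
  by move: jN; rewrite !mem_box /= !normrN.
by exists (- k); rewrite ?opprK//; move: kN; rewrite !mem_box /= !normrN.
Qed.

Lemma sum_box_opp N g : \sum_(k <- box N) g (- k) = \sum_(k <- box N) g k.
Proof. by rewrite -[RHS](perm_big _ (box_opp N)) big_map. Qed.

Lemma le_sum_subset s t g : uniq s -> uniq t -> {subset s <= t} ->
  (forall k, 0 <= g k) -> \sum_(k <- s) g k <= \sum_(k <- t) g k.
Proof.
move=> us ut st g0.
have st_perm : perm_eq s [seq k <- t | k \in s].
  apply: uniq_perm; rewrite ?filter_uniq// => k; rewrite mem_filter.
  by case: (boolP (k \in s)) => //= /st ->.
rewrite (perm_big _ st_perm) big_filter big_mkcond; apply: ler_sum => k _.
by case: ifP.
Qed.

Lemma le_sum_box N M g : (N <= M)%N -> (forall k, 0 <= g k) ->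
  \sum_(k <- box N) g k <= \sum_(k <- box M) g k.
Proof.
by move=> NM; apply: le_sum_subset; [exact: uniq_box..|exact: box_subset].
Qed.

Definition sobolev_weight k : R := 1 + @wave_normsq R k.
Local Notation W := sobolev_weight.

Lemma wave_normsq_ge0 k : 0 <= @wave_normsq R k.
Proof. by rewrite addr_ge0 ?sqr_ge0. Qed.

Lemma sobolev_weight_ge1 k : 1 <= W k.
Proof. by rewrite lerDl wave_normsq_ge0. Qed.

Lemma sobolev_weight_gt0 k : 0 < W k.
Proof. exact: lt_le_trans (sobolev_weight_ge1 k). Qed.

Lemma wave_normsqN k : @wave_normsq R (- k) = @wave_normsq R k.
Proof. by rewrite /wave_normsq /= !mulrNz !sqrrN. Qed.

Lemma wave_normsq_ge1 k : k != 0 -> 1 <= @wave_normsq R k.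
Proof.
case: k => i j; rewrite -[0]/(0, 0) xpair_eqE negb_and /wave_normsq /= => ij.
rewrite -!rmorphXn -rmorphD ler1z !expr2 /=.
by case/orP: ij => h; nia.
Qed.

Lemma sobolev_weight_le2 k : k != 0 -> W k <= 2 * @wave_normsq R k.
Proof. by move=> /wave_normsq_ge1; rewrite /W; lra. Qed.

(** Half-integer powers of [W] are handled as integer powers of this function: the lattice sum of
    its square diverges, that of its cube converges. *)
Definition inv_weight k : R := (Num.sqrt (W k))^-1.
Local Notation r := inv_weight.

Lemma inv_weight_gt0 k : 0 < r k.
Proof. by rewrite invr_gt0 sqrtr_gt0 sobolev_weight_gt0. Qed.

Lemma inv_weight_ge0 k : 0 <= r k.
Proof. exact: ltW (inv_weight_gt0 k). Qed.

Lemma inv_weight_sqr k : r k ^+ 2 = (W k)^-1.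
Proof. by rewrite exprVn sqr_sqrtr// ltW ?sobolev_weight_gt0. Qed.

Lemma inv_weight_le1 k : r k <= 1.
Proof.
rewrite invf_le1 ?sqrtr_gt0 ?sobolev_weight_gt0//.
by rewrite -sqrtr1 ler_wsqrtr ?sobolev_weight_ge1.
Qed.

(** The arithmetic-geometric mean inequality gives [(s1 s2)^2 <= (s1^4 + s2^4) / 2 <= W k]. With
    [s_i = (1 + k_i^2)^(1/4)] the weight is dominated by a tensor product, and lattice sums factor
    into one-dimensional ones. *)
Lemma inv_weight_le k (s1 s2 : R) : 0 < s1 -> 0 < s2 ->
  s1 ^+ 4 <= 1 + k.1%:~R ^+ 2 -> s2 ^+ 4 <= 1 + k.2%:~R ^+ 2 ->
  r k <= (s1 * s2)^-1.
Proof.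
move=> s10 s20 h1 h2; rewrite lef_pV2 ?posrE ?mulr_gt0 ?sqrtr_gt0 ?sobolev_weight_gt0//.
rewrite -(ger0_norm (ltW (mulr_gt0 s10 s20))) -sqrtr_sqr ler_wsqrtr//.
have a : (s1 * s2) ^+ 2 <= (s1 ^+ 4 + s2 ^+ 4) / 2.
  have := sqr_ge0 (s1 ^+ 2 - s2 ^+ 2); rewrite exprMn.
  rewrite (_ : (_ - _) ^+ 2 = s1 ^+ 4 + s2 ^+ 4 - 2 * (s1 ^+ 2 * s2 ^+ 2)); last by ring.
  by lra.
rewrite /W /wave_normsq; have := sqr_ge0 (k.1%:~R : R); have := sqr_ge0 (k.2%:~R : R).
lra.
Qed.

(* [2 / sqrt m - 2 / sqrt (m + 1)] dominates [(m + 1)^(-3/2)]. *)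
Lemma sum_inv_three_half N :
  \sum_(0 <= i < N.+1) (Num.sqrt (i.+1%:R : R))^-1 ^+ 3 <=
  3 - 2 / Num.sqrt (N.+1%:R).
Proof.
elim: N => [|N IH]; first by rewrite big_nat1 sqrtr1; lra.
rewrite big_nat_recr//=; apply: le_trans (lerD IH (lexx _)) _.
set s := Num.sqrt N.+1%:R; set t := Num.sqrt N.+2%:R.
have s0 : 0 < s by rewrite sqrtr_gt0.
have t0 : 0 < t by rewrite sqrtr_gt0.
have st : t ^+ 2 = s ^+ 2 + 1 by rewrite !sqr_sqrtr// -natr1.
have : s <= 2 * t ^+ 2 * (t - s).
  have st_le : s <= t by rewrite ler_wsqrtr// ler_nat.
  rewrite -(ler_pM2r (addr_gt0 t0 s0)).
  have -> : 2 * t ^+ 2 * (t - s) * (t + s) = 2 * t ^+ 2 * (t ^+ 2 - s ^+ 2) by ring.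
  rewrite [in X in _ <= _ * X]st addrAC subrr add0r mulr1 expr2.
  by nra.
rewrite -(ler_pM2r (_ : 0 < s^-1 * t^-1 ^+ 3)); last first.
  by rewrite mulr_gt0 ?exprn_gt0 ?invr_gt0.
have -> : s * (s^-1 * t^-1 ^+ 3) = t^-1 ^+ 3 by field; rewrite !gt_eqF.
have -> : 2 * t ^+ 2 * (t - s) * (s^-1 * t^-1 ^+ 3) = 2 / s - 2 / t.
  by field; rewrite !gt_eqF.
by lra.
Qed.

Lemma sum_int_range N (p : int -> R) : (forall m, p (- m) = p m) ->
  \sum_(m <- int_range N) p m = p 0 + 2 * \sum_(0 <= i < N) p i.+1.
Proof.
move=> pN.
have /(perm_big _) -> : perm_eq (int_range N)
    (0 :: [seq i.+1%:Z | i <- iota 0 N] ++ [seq - i.+1%:Z | i <- iota 0 N]).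
  apply: uniq_perm; first exact: uniq_int_range.
    rewrite /= mem_cat cat_uniq !map_inj_uniq ?iota_uniq//=; try by move=> ? ?; lia.
    rewrite andbT negb_or -andbA; apply/and3P; split.
    - by apply/mapP => -[i _]; lia.
    - by apply/mapP => -[i _]; lia.
    - by apply/hasPn => m /mapP[i _ ->]; apply/mapP => -[j _]; lia.
  move=> m; rewrite mem_int_range inE mem_cat; apply/idP/idP => [mN|].
    have [m0|m0|->] := ltgtP m 0; last by [].
    - apply/orP; right; apply/orP; right; apply/mapP; exists (absz m).-1; last by lia.
      by rewrite mem_iota; lia.
    - apply/orP; right; apply/orP; left; apply/mapP; exists (absz m).-1; last by lia.
      by rewrite mem_iota; lia.
  by case/or3P => [/eqP ->|/mapP[j]|/mapP[j]]; rewrite ?normr0 ?mem_iota//; lia.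
rewrite big_cons big_cat !big_map /index_iota subn0 /=; congr (_ + _).
by under [X in _ + X]eq_bigr do rewrite pN; rewrite mulr_natl mulr2n.
Qed.

(** The bound is [7 ^+ 2], one factor per coordinate. In one dimension the term at 0 contributes 1
    and each half-line at most 3, by comparison with the sum of [i^(-3/2)]. *)
Lemma sum_inv_weight3 N : \sum_(k <- box N) r k ^+ 3 <= 49.
Proof.
pose p (m : int) : R := (Num.sqrt (Num.sqrt (1 + m%:~R ^+ 2)))^-1.
have w_gt0 (m : int) : 0 < 1 + m%:~R ^+ 2 :> R by rewrite ltr_wpDr ?sqr_ge0.
have p_gt0 m : 0 < p m by rewrite invr_gt0 !sqrtr_gt0.
have p0 : p 0 = 1 by rewrite /p expr0n addr0 !sqrtr1 invr1.
have p_le i : p i.+1%:Z <= (Num.sqrt (i.+1%:R : R))^-1.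
  rewrite lef_pV2 ?posrE ?sqrtr_gt0// ler_wsqrtr// -[leLHS]ger0_norm// -sqrtr_sqr.
  by rewrite ler_wsqrtr// lerDr.
have p4 m : (p m)^-1 ^+ 4 = 1 + m%:~R ^+ 2.
  by rewrite invrK (exprM _ 2 2) !sqr_sqrtr ?sqrtr_ge0// ltW.
have pN m : p (- m) = p m by rewrite /p mulrNz sqrrN.
clearbody p.
have sp : \sum_(m <- int_range N) p m ^+ 3 <= 7.
  rewrite sum_int_range => [|m]; last by rewrite pN.
  rewrite p0 expr1n; case: N => [|N]; first by rewrite big_geq//; lra.
  have : \sum_(0 <= i < N.+1) p i.+1 ^+ 3 <= 3.
    apply: (@le_trans _ _ (\sum_(0 <= i < N.+1) (Num.sqrt (i.+1%:R : R))^-1 ^+ 3)).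
      by apply: ler_sum => i _; rewrite lerXn2r// nnegrE ?invr_ge0 ?sqrtr_ge0 ?ltW.
    apply: le_trans (sum_inv_three_half N) _.
    by rewrite lerBlDr lerDl divr_ge0// sqrtr_ge0.
  by lra.
apply: (@le_trans _ _ (\sum_(k <- box N) p k.1 ^+ 3 * p k.2 ^+ 3)).
  apply: ler_sum => k _; rewrite -exprMn lerXn2r// ?nnegrE ?inv_weight_ge0//.
    by rewrite mulr_ge0// ltW.
  have := @inv_weight_le k (p k.1)^-1 (p k.2)^-1.
  by rewrite !invr_gt0 !p_gt0 !p4 invfM !invrK; exact.
rewrite big_allpairs_dep /=.
under eq_bigr do rewrite -mulr_sumr.
rewrite -mulr_suml.
have s0 : 0 <= \sum_(m <- int_range N) p m ^+ 3.
  by apply: sumr_ge0 => m _; rewrite exprn_ge0// ltW.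
by nra.
Qed.

End LatticeSums.

(** * Resonant trilinear sums *)

Section Resonance.
Variable R : realType.
Implicit Types (k a b c : int * int) (s : seq (int * int)).

Local Notation W := (@sobolev_weight R).
Local Notation r := (@inv_weight R).

Lemma sum_CauchySchwarz (J : Type) (t : seq J) (w f g : J -> R) :
  (forall i, 0 <= w i) ->
  (\sum_(i <- t) w i * (f i * g i)) ^+ 2 <=
  (\sum_(i <- t) w i * f i ^+ 2) * (\sum_(i <- t) w i * g i ^+ 2).
Proof.
move=> w0; apply: sqr_le_mul_of_quad => x y.
have -> : x ^+ 2 * (\sum_(i <- t) w i * f i ^+ 2) +
    2 * x * y * (\sum_(i <- t) w i * (f i * g i)) +
    y ^+ 2 * (\sum_(i <- t) w i * g i ^+ 2) =
    \sum_(i <- t) w i * (x * f i + y * g i) ^+ 2.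
  rewrite !mulr_sumr -!big_split /=; apply: eq_bigr => i _; ring.
by apply: sumr_ge0 => i _; rewrite mulr_ge0 ?sqr_ge0.
Qed.

Definition flip (b : bool) k := if b then - k else k.

(** All eight sign patterns are counted because a real wave of frequency [a] contains both
    [exp (i a.x)] and [exp (- i a.x)]. A product of three waves can meet the wave [k] only if this
    number is nonzero. *)
Definition resonance a b c k : R :=
  \sum_(s : bool * bool * bool)
    (k == flip s.1.1 a + flip s.1.2 b + flip s.2 c)%:R.

Lemma resonance_ge0 a b c k : 0 <= resonance a b c k.
Proof. by apply: sumr_ge0 => s _; rewrite ler0n. Qed.

Lemma sum_indicator_le1 s (P : pred (int * int)) j : uniq s ->
  (forall k, P k -> k = j) -> \sum_(k <- s) (P k)%:R <= 1 :> R.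
Proof.
move=> us Pj; rewrite (@le_trans _ _ (\sum_(k <- s) (k == j)%:R))//.
  apply: ler_sum => k _; case: (boolP (P k)) => [/Pj ->|_]; rewrite ?eqxx//.
rewrite -natr_sum lern1.
have -> : (\sum_(k <- s) (k == j) = count_mem j s)%N.
  by rewrite -sum1_count [RHS]big_mkcond; apply: eq_bigr => k _ /=; case: eqP.
by rewrite count_uniq_mem// leq_b1.
Qed.

(** For each of the eight sign patterns, the resonance condition determines the remaining frequency
    once the others are fixed. The next four bounds differ only in which frequency is summed. *)
Let sum_resonance_le8 s (F : int * int -> bool * bool * bool -> bool) :
  uniq s -> (forall x, exists j, forall k, F k x -> k = j) ->
  \sum_(k <- s) \sum_x (F k x)%:R <= 8 :> R.
Proof.
move=> us Fj; rewrite exchange_big /=.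
apply: (@le_trans _ _ (\sum_(x : bool * bool * bool) 1)).
  by apply: ler_sum => x _; have [j /sum_indicator_le1] := Fj x; exact.
by rewrite sumr_const card_prod card_prod !card_bool.
Qed.

Lemma flipK (e : bool) : involutive (flip e).
Proof. by case: e => k //=; rewrite opprK. Qed.

Lemma sum_resonance_out s a b c : uniq s ->
  \sum_(k <- s) resonance a b c k <= 8.
Proof.
move=> us; apply: sum_resonance_le8 => // x.
by eexists => k /eqP ->.
Qed.

Lemma sum_resonance1 s b c k : uniq s -> \sum_(a <- s) resonance a b c k <= 8.
Proof.
move=> us; apply: sum_resonance_le8 => // x.
exists (flip x.1.1 (k - flip x.2 c - flip x.1.2 b)) => a /eqP ->.
by rewrite !addrK flipK.
Qed.

Lemma sum_resonance2 s a c k : uniq s -> \sum_(b <- s) resonance a b c k <= 8.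
Proof.
move=> us; apply: sum_resonance_le8 => // x.
exists (flip x.1.2 (k - flip x.2 c - flip x.1.1 a)) => b /eqP ->.
by rewrite addrK [_ + flip _ b]addrC addrK flipK.
Qed.

Lemma sum_resonance3 s a b k : uniq s -> \sum_(c <- s) resonance a b c k <= 8.
Proof.
move=> us; apply: sum_resonance_le8 => // x.
exists (flip x.2 (k - (flip x.1.1 a + flip x.1.2 b))) => c /eqP ->.
by rewrite [_ + flip _ c]addrC addrK flipK.
Qed.

(** Since [x y z <= x^3 + y^3 + z^3], applied to the pairwise products of [r a], [r b], [r c], the
    squared weight is at most a sum of three terms such as [(r a r b)^3], each free of one
    frequency. Summing that frequency costs 8 by resonance, the other two cost 49 each, whence
    [24 = 3 . 8]. *)
Lemma sum_resonance_weights N k :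
  \sum_(a <- box N) \sum_(b <- box N) \sum_(c <- box N)
    resonance a b c k * (r a * r b * r c) ^+ 2 <= 24 * 49 ^+ 2.
Proof.
pose S3 := \sum_(a <- box N) r a ^+ 3.
have r3_ge0 a : 0 <= r a ^+ 3 by rewrite exprn_ge0 ?inv_weight_ge0.
have S3_ge0 : 0 <= S3 by apply: sumr_ge0 => a _.
have S3_le : S3 <= 49 := sum_inv_weight3 R N.
have pair3 (F : int * int -> int * int -> R) : (forall a b, F a b <= 8) ->
    \sum_(a <- box N) \sum_(b <- box N) F a b * (r a ^+ 3 * r b ^+ 3) <= 8 * 49 ^+ 2.
  move=> F8; apply: (@le_trans _ _ (8 * S3 ^+ 2)); last first.
    by rewrite ler_pM2l// lerXn2r// nnegrE; lra.
  rewrite expr2 /S3 mulr_suml mulr_sumr; apply: ler_sum => a _.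
  rewrite !mulr_sumr; apply: ler_sum => b _.
  by rewrite ler_wpM2r ?F8// mulr_ge0.
have pqs (x y z : R) : 0 <= x -> 0 <= y -> 0 <= z ->
    x * y * z <= x ^+ 3 + y ^+ 3 + z ^+ 3.
  move=> x0 y0 z0; have xyz0 : 0 <= x * y * z by rewrite !mulr_ge0.
  have : 0 <= (x + y + z) * ((x - y) ^+ 2 + (y - z) ^+ 2 + (z - x) ^+ 2).
    by rewrite mulr_ge0 ?addr_ge0 ?sqr_ge0.
  by lra.
have cyc (a b c : int * int) : (r a * r b * r c) ^+ 2 <=
    r a ^+ 3 * r b ^+ 3 + r b ^+ 3 * r c ^+ 3 + r a ^+ 3 * r c ^+ 3.
  have := @pqs (r a * r b) (r b * r c) (r a * r c).
  rewrite !exprMn !mulr_ge0 ?inv_weight_ge0//.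
  rewrite (_ : r a * r b * (r b * r c) * (r a * r c) = r a ^+ 2 * r b ^+ 2 * r c ^+ 2).
    exact.
  by ring.
apply: (@le_trans _ _ (
  \sum_(a <- box N) \sum_(b <- box N)
    (\sum_(c <- box N) resonance a b c k) * (r a ^+ 3 * r b ^+ 3) +
  \sum_(b <- box N) \sum_(c <- box N)
    (\sum_(a <- box N) resonance a b c k) * (r b ^+ 3 * r c ^+ 3) +
  \sum_(a <- box N) \sum_(c <- box N)
    (\sum_(b <- box N) resonance a b c k) * (r a ^+ 3 * r c ^+ 3))); last first.
  rewrite (_ : 24 * 49 ^+ 2 = 8 * 49 ^+ 2 + 8 * 49 ^+ 2 + 8 * 49 ^+ 2 :> R); last by lra.
  by apply: lerD; [apply: lerD|]; apply: pair3 => a b;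
    [exact: sum_resonance3 (uniq_box N)|exact: sum_resonance1 (uniq_box N)
    |exact: sum_resonance2 (uniq_box N)].
under [X in _ <= X + _ + _]eq_bigr do under eq_bigr do rewrite mulr_suml.
rewrite [X in _ <= _ + X + _](_ : _ = \sum_(a <- box N) \sum_(b <- box N)
    \sum_(c <- box N) resonance a b c k * (r b ^+ 3 * r c ^+ 3)); last first.
  under eq_bigr do under eq_bigr do rewrite mulr_suml.
  under eq_bigr do rewrite exchange_big /=.
  by rewrite exchange_big.
rewrite [X in _ <= _ + X](_ : _ = \sum_(a <- box N) \sum_(b <- box N)
    \sum_(c <- box N) resonance a b c k * (r a ^+ 3 * r c ^+ 3)); last first.
  under eq_bigr do under eq_bigr do rewrite mulr_suml.
  by under eq_bigr do rewrite exchange_big /=.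
rewrite -!big_split; apply: ler_sum => a _; rewrite -!big_split.
apply: ler_sum => b _; rewrite -!big_split; apply: ler_sum => c _ /=.
by rewrite -!mulrDr ler_wpM2l// resonance_ge0.
Qed.

(** On a resonance [W k <= 3 (W a + W b + W c)], so [W k] is at most 9 times the largest of the
    three weights. Raising the largest weight to the power [n], and not the sum, gives the factor
    [9 ^+ n]. *)
Lemma sobolev_weight_resonance n a b c k :
  resonance a b c k * W k ^+ n <=
  resonance a b c k * (9 ^+ n * (W a ^+ n + W b ^+ n + W c ^+ n)).
Proof.
have W_ge0 j : 0 <= W j := ltW (sobolev_weight_gt0 R j).
rewrite /resonance !mulr_suml; apply: ler_sum => x _.
case: eqP => [->|_]; last by rewrite !mul0r.
rewrite !mul1r; set j := _ + _.
have Wflip e i : W (flip e i) = W i.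
  by case: e => //=; rewrite /sobolev_weight wave_normsqN.
have Wj : W j <= 3 * (W a + W b + W c).
  rewrite -(Wflip x.1.1 a) -(Wflip x.1.2 b) -(Wflip x.2 c) /j.
  case: (flip _ a) (flip _ b) (flip _ c) => [a1 a2] [b1 b2] [c1 c2].
  rewrite /sobolev_weight /wave_normsq /= !intrD.
  have sq3 (y1 y2 y3 : R) : (y1 + y2 + y3) ^+ 2 <= 3 * (y1 ^+ 2 + y2 ^+ 2 + y3 ^+ 2).
    by have := sqr_ge0 (y1 - y2); have := sqr_ge0 (y2 - y3);
       have := sqr_ge0 (y1 - y3); nra.
  by have := sq3 a1%:~R b1%:~R c1%:~R; have := sq3 a2%:~R b2%:~R c2%:~R; lra.
have three i : W a <= W i -> W b <= W i -> W c <= W i -> W j <= 9 * W i by lra.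
have Wn_ge0 i : 0 <= W i ^+ n by rewrite exprn_ge0.
have conc i : W j <= 9 * W i -> W i ^+ n <= W a ^+ n + W b ^+ n + W c ^+ n ->
    W j ^+ n <= 9 ^+ n * (W a ^+ n + W b ^+ n + W c ^+ n).
  move=> h1 h2; apply: (@le_trans _ _ ((9 * W i) ^+ n)).
    by rewrite lerXn2r// nnegrE// mulr_ge0.
  by rewrite exprMn ler_wpM2l// exprn_ge0.
have := Wn_ge0 a; have := Wn_ge0 b; have := Wn_ge0 c => c0 b0 a0.
have [ab|/ltW ba] := leP (W a) (W b).
  have [bc|/ltW cb] := leP (W b) (W c).
    by apply: (conc c); [apply: three => //; exact: le_trans bc|lra].
  by apply: (conc b); [exact: three|lra].
have [ac|/ltW ca] := leP (W a) (W c).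
  by apply: (conc c); [apply: three => //; exact: le_trans ac|lra].
by apply: (conc a); [exact: three|lra].
Qed.

Let triples s := [seq (x, c) | x <- [seq (a, b) | a <- s, b <- s], c <- s].

Let sum_triples s (F : int * int -> int * int -> int * int -> R) :
  \sum_(x <- triples s) F x.1.1 x.1.2 x.2 =
  \sum_(a <- s) \sum_(b <- s) \sum_(c <- s) F a b c.
Proof. by rewrite big_allpairs big_allpairs. Qed.

(** The factor [24 * 49 ^+ 2] comes from the weights in Cauchy-Schwarz, 8 from summing the output
    frequency, [9 ^+ n] from distributing [W k ^+ n], and 3 from the three frequencies that may
    receive it. *)
Definition trilinear_const (n : nat) : R := 24 * 49 ^+ 2 * (8 * 9 ^+ n * 3).

Lemma trilinear_const_gt0 n : 0 < trilinear_const n.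
Proof. by rewrite !mulr_gt0// exprn_gt0. Qed.

(* Cauchy-Schwarz against the weights [r a * r b * r c], whose squares are
   summable along every resonance uniformly in [k]. *)
Lemma trilinear_sum n N M (h : int * int -> R) :
  \sum_(k <- box M) W k ^+ n *
    (\sum_(a <- box N) \sum_(b <- box N) \sum_(c <- box N)
      resonance a b c k * (`|h a| * `|h b| * `|h c|)) ^+ 2 <=
  trilinear_const n * (\sum_(a <- box N) W a ^+ n.+1 * h a ^+ 2) *
    (\sum_(a <- box N) W a * h a ^+ 2) ^+ 2.
Proof.
set X := \sum_(a <- box N) W a ^+ n.+1 * h a ^+ 2.
set Y := \sum_(a <- box N) W a * h a ^+ 2.
have W_gt0 j : 0 < W j := sobolev_weight_gt0 R j.
have W_ge0 j : 0 <= W j := ltW (W_gt0 j).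
pose q a := W a * h a ^+ 2.
have q0 a : 0 <= q a by rewrite mulr_ge0 ?sqr_ge0.
have qqq a b c : 0 <= q a * q b * q c := mulr_ge0 (mulr_ge0 (q0 a) (q0 b)) (q0 c).
have cs k : (\sum_(a <- box N) \sum_(b <- box N) \sum_(c <- box N)
      resonance a b c k * (`|h a| * `|h b| * `|h c|)) ^+ 2 <=
    24 * 49 ^+ 2 * \sum_(a <- box N) \sum_(b <- box N) \sum_(c <- box N)
      resonance a b c k * (q a * q b * q c).
  rewrite -sum_triples.
  have -> : \sum_(x <- triples (box N)) resonance x.1.1 x.1.2 x.2 k *
      (`|h x.1.1| * `|h x.1.2| * `|h x.2|) =
      \sum_(x <- triples (box N)) resonance x.1.1 x.1.2 x.2 k *
      ((r x.1.1 * r x.1.2 * r x.2) *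
       ((`|h x.1.1| / r x.1.1) * (`|h x.1.2| / r x.1.2) * (`|h x.2| / r x.2))).
    apply: eq_bigr => x _; congr (_ * _); field.
    by rewrite !gt_eqF ?inv_weight_gt0.
  apply: le_trans (sum_CauchySchwarz _ _ _ _) _ => [x|].
    exact: resonance_ge0.
  rewrite (sum_triples (box N) (fun a b c => resonance a b c k * (r a * r b * r c) ^+ 2)).
  have -> : \sum_(x <- triples (box N)) resonance x.1.1 x.1.2 x.2 k *
      (`|h x.1.1| / r x.1.1 * (`|h x.1.2| / r x.1.2) * (`|h x.2| / r x.2)) ^+ 2 =
      \sum_(a <- box N) \sum_(b <- box N) \sum_(c <- box N)
      resonance a b c k * (q a * q b * q c).
    rewrite -sum_triples; apply: eq_bigr => x _; congr (_ * _).
    have qE a : (`|h a| / r a) ^+ 2 = q a.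
      by rewrite exprMn exprVn inv_weight_sqr invrK real_normK ?num_real// mulrC.
    by rewrite -!qE -!exprMn.
  apply: ler_wpM2r (sum_resonance_weights N k).
  apply: sumr_ge0 => a _; apply: sumr_ge0 => b _; apply: sumr_ge0 => c _.
  by rewrite mulr_ge0 ?resonance_ge0.
rewrite /trilinear_const.
apply: (@le_trans _ _ (24 * 49 ^+ 2 * \sum_(a <- box N) \sum_(b <- box N)
    \sum_(c <- box N) (8 * 9 ^+ n) * ((W a ^+ n + W b ^+ n + W c ^+ n) * (q a * q b * q c)))).
  apply: (@le_trans _ _ (\sum_(k <- box M) 24 * 49 ^+ 2 *
      (\sum_(a <- box N) \sum_(b <- box N) \sum_(c <- box N)
        (resonance a b c k * W k ^+ n) * (q a * q b * q c)))).
    apply: ler_sum => k _; apply: le_trans (ler_wpM2l _ (cs k)) _.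
      by rewrite exprn_ge0.
    rewrite mulrCA ler_wpM2l// mulr_sumr le_eqVlt; apply/orP; left; apply/eqP.
    apply: eq_bigr => a _; rewrite mulr_sumr; apply: eq_bigr => b _.
    by rewrite mulr_sumr; apply: eq_bigr => c _; ring.
  rewrite -mulr_sumr ler_wpM2l// exchange_big /=; apply: ler_sum => a _.
  rewrite exchange_big /=; apply: ler_sum => b _.
  rewrite exchange_big /=; apply: ler_sum => c _.
  rewrite -mulr_suml [leRHS]mulrA ler_wpM2r//.
  apply: (@le_trans _ _ (\sum_(k <- box M) resonance a b c k *
     (9 ^+ n * (W a ^+ n + W b ^+ n + W c ^+ n)))).
    by apply: ler_sum => k _; exact: sobolev_weight_resonance.
  rewrite -mulr_suml -mulrA ler_wpM2r ?sum_resonance_out ?uniq_box//.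
  by rewrite mulr_ge0 ?addr_ge0 ?exprn_ge0.
rewrite (_ : 24 * 49 ^+ 2 * (8 * 9 ^+ n * 3) * X * Y ^+ 2 =
  24 * 49 ^+ 2 * (8 * 9 ^+ n * (3 * X * Y ^+ 2))); last by ring.
rewrite ler_wpM2l// le_eqVlt; apply/orP; left; apply/eqP.
have Xq : \sum_(a <- box N) W a ^+ n * q a = X.
  by rewrite /X; apply: eq_bigr => a _; rewrite /q (exprS (W a) n); ring.
have Yq : \sum_(a <- box N) q a = Y by [].
transitivity (8 * 9 ^+ n * ((\sum_(a <- box N) \sum_(b <- box N) \sum_(c <- box N)
     (W a ^+ n * q a) * (q b * q c)) +
   (\sum_(a <- box N) \sum_(b <- box N) \sum_(c <- box N)
     q a * ((W b ^+ n * q b) * q c)) +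
   (\sum_(a <- box N) \sum_(b <- box N) \sum_(c <- box N)
     q a * (q b * (W c ^+ n * q c))))).
  rewrite -!big_split mulr_sumr; apply: eq_bigr => a _.
  rewrite -!big_split mulr_sumr; apply: eq_bigr => b _.
  rewrite -!big_split mulr_sumr; apply: eq_bigr => c _ /=.
  by ring.
have sum3 (F G H : int * int -> R) :
    \sum_(a <- box N) \sum_(b <- box N) \sum_(c <- box N) F a * (G b * H c) =
    (\sum_(a <- box N) F a) * ((\sum_(b <- box N) G b) * (\sum_(c <- box N) H c)).
  rewrite mulr_suml; apply: eq_bigr => a _; rewrite mulr_suml mulr_sumr.
  by apply: eq_bigr => b _; rewrite !mulr_sumr.
by rewrite !sum3 Xq Yq; ring.
Qed.

End Resonance.

(** * The Hartley basis and its completeness *)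

Section Hartley.
Variable R : realType.
Implicit Types (u v : R * R -> R) (a b c k l : int * int).

Local Notation cell := (@torus_cell R).

(* The real functions [hartley k] form an orthonormal basis which diagonalises
   every Fourier multiplier with an even real symbol. *)
Definition hartley k (x : R * R) : R :=
  (2 * pi)^-1 * (cos (wave_dot k x) + sin (wave_dot k x)).

Definition hartley_coef u k : R := torus_integral (fun x => u x * hartley k x).

(** The phase makes one family of cosines cover the sines as well, at [t = - (pi / 2)], so that a
    single product formula suffices. *)
Let cw k (t : R) (x : R * R) : R := cos (wave_dot k x + t).

Lemma wave_dotD k l (x : R * R) : wave_dot (k + l) x = wave_dot k x + wave_dot l x.
Proof. by rewrite /wave_dot /= !intrD; ring. Qed.

Lemma wave_dotN k (x : R * R) : wave_dot (- k) x = - wave_dot k x.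
Proof. by rewrite /wave_dot /= !mulrNz; ring. Qed.

Let cwM k l (s t : R) x :
  cw k s x * cw l t x = 2^-1 * (cw (k - l) (s - t) x + cw (k + l) (s + t) x).
Proof.
have key (y z : R) : cos y * cos z = 2^-1 * (cos (y - z) + cos (y + z)).
  by rewrite cosB cosD; field.
rewrite /cw key !wave_dotD wave_dotN.
by congr (2^-1 * (cos _ + cos _)); ring.
Qed.

Let hartley_cw k x : hartley k x = (2 * pi)^-1 * (cw k 0 x + cw k (- (pi / 2)) x).
Proof. by rewrite /cw addr0 cosBpihalf. Qed.

(** With [cas = cos + sin], this is the identity [cas y cas z = cos (y - z) + sin (y + z)]. *)
Let hartleyM k l x :
  hartley k x * hartley l x =
  ((2 * pi)^-1) ^+ 2 * (cw (k - l) 0 x + cw (k + l) (- (pi / 2)) x).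
Proof.
rewrite /hartley /cw addr0 cosBpihalf !wave_dotD wave_dotN.
by rewrite cosB sinD; ring.
Qed.

Lemma measurable_hartley k : measurable_fun cell (hartley k).
Proof.
rewrite (funext (hartley_cw k)); apply: measurable_funTS.
by apply: measurable_funM => //; apply: measurable_funD; exact: measurable_cos_wave.
Qed.

Lemma hartley_bounded k x : `|hartley k x| <= 2^-1.
Proof.
have pi2 : 2 <= pi :> R := pi_ge2 R.
rewrite normrM ger0_norm ?invr_ge0 ?mulr_ge0 ?pi_ge0//.
apply: (@le_trans _ _ ((2 * pi)^-1 * 2)).
  rewrite ler_wpM2l ?invr_ge0 ?mulr_ge0 ?pi_ge0//.
  apply: le_trans (ler_normD _ _) _.
  by have := cos_max (wave_dot k x); have := sin_max (wave_dot k x); lra.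
rewrite invfM mulrAC mulVf ?mul1r// lef_pV2 ?posrE//.
by lra.
Qed.

Lemma hartley_L2 k : torus_L2 (hartley k).
Proof.
apply: (@torus_L2_bounded _ _ 2^-1); first exact: measurable_hartley.
by move=> x _; exact: hartley_bounded.
Qed.

Lemma hartley_orthonormal k l :
  torus_integral (fun x => hartley k x * hartley l x) = (k == l)%:R.
Proof.
under eq_fun do rewrite hartleyM.
have icw j t := @torus_integrable_cos_wave R j t.
rewrite torus_integralZ; last by apply: torus_integrableD; exact: icw.
rewrite torus_integralD; [|exact: icw..].
(* The sum-frequency term has mean zero even when [k + l = 0], thanks to its phase [- (pi / 2)];
   only [k = l] survives. *)
rewrite !torus_integral_cos_wave cosN cos_pihalf mul0r if_same addr0 cos0 mul1r.
rewrite subr_eq0; case: (k == l); last by rewrite mulr0.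
by rewrite -exprMn mulVf ?expr1n// mulf_neq0 ?gt_eqF ?pi_gt0.
Qed.

Lemma resonance_ge1 a b c k (x : bool * bool * bool) :
  k = flip x.1.1 a + flip x.1.2 b + flip x.2 c -> 1 <= resonance R a b c k.
Proof.
move=> kx; rewrite /resonance (bigD1 x)//= -kx eqxx lerDl.
by apply: sumr_ge0 => y _.
Qed.

(** The product expands into eight cosines whose frequencies are, up to sign, the differences
    between [k] and the signed sums of [a], [b], [c]. Without a resonance none of these frequencies
    is 0 and the integral vanishes. With one, the crude bound [2^(-4) (2 pi)^2 = pi^2 / 4 <= 4] is
    enough. *)
Lemma hartley_quadrilinear a b c k :
  `|torus_integral (fun x => hartley a x * hartley b x * (hartley c x * hartley k x))|
  <= 4 * resonance R a b c k.
Proof.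
have [/existsP[x /eqP /resonance_ge1 res]|nres] :=
  boolP [exists x : bool * bool * bool, k == flip x.1.1 a + flip x.1.2 b + flip x.2 c].
  apply: (@le_trans _ _ 4); last by lra.
  have mH j := @measurable_hartley j.
  have prod_le y : `|hartley a y * hartley b y * (hartley c y * hartley k y)| <= 1 / 16.
    have Hle j := @hartley_bounded j y.
    rewrite normrM (normrM (hartley a y)) (normrM (hartley c y)).
    rewrite (_ : 1 / 16 = 2^-1 * 2^-1 * (2^-1 * 2^-1)); last by field.
    apply: ler_pM; [exact: mulr_ge0|exact: mulr_ge0|apply: ler_pM|apply: ler_pM] => //;
      exact: Hle.
  apply: le_trans (le_norm_torus_integral _) _.
    apply: (@torus_integrable_bounded _ _ (1 / 16)) => [|y _]; last exact: prod_le.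
    by apply: measurable_funM; apply: measurable_funM; exact: mH.
  apply: (@le_trans _ _ (torus_integral (fun=> (1 / 16 : R)))).
    apply: le_torus_integral => [||y _]; last exact: prod_le.
      apply: torus_integrable_norm.
      apply: (@torus_integrable_bounded _ _ (1 / 16)) => [|y _]; last exact: prod_le.
      by apply: measurable_funM; apply: measurable_funM; exact: mH.
    exact: torus_integrable_cst.
  rewrite torus_integral_cst.
  have p4 : pi <= 4 :> R by have := pihalf_lt2 R; lra.
  by have := pi_ge0 R; nra.
have nk x : k != flip x.1.1 a + flip x.1.2 b + flip x.2 c.
  by apply: contra nres => kx; apply/existsP; exists x.
pose res0 (x : bool * bool * bool) := k - (flip x.1.1 a + flip x.1.2 b + flip x.2 c).
have res0_neq x : res0 x != 0 by rewrite subr_eq0 nk.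
have j1 : (a - b) - (c - k) = res0 (true, false, false) by rewrite /res0 /=; ring.
have j2 : (a - b) + (c - k) = - res0 (false, true, false) by rewrite /res0 /=; ring.
have j3 : (a - b) - (c + k) = - res0 (false, true, true) by rewrite /res0 /=; ring.
have j4 : (a - b) + (c + k) = res0 (true, false, true) by rewrite /res0 /=; ring.
have j5 : (a + b) - (c - k) = res0 (true, true, false) by rewrite /res0 /=; ring.
have j6 : (a + b) + (c - k) = - res0 (false, false, false) by rewrite /res0 /=; ring.
have j7 : (a + b) - (c + k) = - res0 (false, false, true) by rewrite /res0 /=; ring.
have j8 : (a + b) + (c + k) = res0 (true, true, true) by rewrite /res0 /=; ring.
pose js : seq ((int * int) * R) := [::
  (res0 (true, false, false), 0); (- res0 (false, true, false), 0);
  (- res0 (false, true, true), pi / 2); (res0 (true, false, true), - (pi / 2));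
  (res0 (true, true, false), - (pi / 2)); (- res0 (false, false, false), - (pi / 2));
  (- res0 (false, false, true), 0); (res0 (true, true, true), - pi)].
have -> : torus_integral (fun x => hartley a x * hartley b x * (hartley c x * hartley k x)) =
    torus_integral (fun x => ((2 * pi)^-1 ^+ 4 / 2) * \sum_(j <- js) cw j.1 j.2 x).
  apply: eq_torus_integral => x _; rewrite !hartleyM !big_cons big_nil.
  rewrite (_ : _ * _ * (_ * _) = (2 * pi)^-1 ^+ 4 *
    (cw (a - b) 0 x * cw (c - k) 0 x + cw (a - b) 0 x * cw (c + k) (- (pi / 2)) x +
     cw (a + b) (- (pi / 2)) x * cw (c - k) 0 x +
     cw (a + b) (- (pi / 2)) x * cw (c + k) (- (pi / 2)) x)); last by ring.
  rewrite !cwM j1 j2 j3 j4 j5 j6 j7 j8 /=.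
  rewrite !(subr0, addr0, add0r, sub0r, opprK, addNr).
  rewrite (_ : - (pi / 2) + - (pi / 2) = - pi); last first.
    by field.
  by move: (2 * pi)^-1 => q; field.
rewrite torus_integralZ; last by apply: torus_integrable_sum => j; exact: torus_integrable_cos_wave.
rewrite torus_integral_sum; last by move=> j; exact: torus_integrable_cos_wave.
rewrite big_seq big1 ?mulr0 ?normr0 ?mulr_ge0 ?resonance_ge0// => j jjs.
rewrite torus_integral_cos_wave; case: eqP => // j0.
have : all (fun j => j.1 != 0) js by rewrite /= !oppr_eq0 !res0_neq.
by move=> /allP/(_ j jjs); rewrite j0 eqxx.
Qed.

Lemma torus_integrable_mul_wave u k : torus_integrable u ->
  torus_integrable (fun x => u x * cos (wave_dot k x)) /\
  torus_integrable (fun x => u x * sin (wave_dot k x)).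
Proof.
move=> iu; have iw t : torus_integrable (fun x => u x * cw k t x).
  apply: (torus_integrable_mul_bounded iu _ (fun x => cos_max _)).
  by apply: measurable_funTS; exact: measurable_cos_wave.
split; first by have := iw 0; rewrite /cw; under eq_fun do rewrite addr0.
by have := iw (- (pi / 2)); rewrite /cw; under eq_fun do rewrite cosBpihalf.
Qed.

Lemma hartley_coefE u k : torus_integrable u ->
  hartley_coef u k = (2 * pi)^-1 *
    (torus_integral (fun x => u x * cos (wave_dot k x)) +
     torus_integral (fun x => u x * sin (wave_dot k x))).
Proof.
move=> /(torus_integrable_mul_wave k)[iuc ius].
rewrite -torus_integralD// -torus_integralZ; last exact: torus_integrableD.
by apply: eq_torus_integral => x _; rewrite /hartley; ring.
Qed.

(** For real [u] with cosine and sine integrals [C] and [S], the coefficients at [k] and [- k] are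
    multiples of [C + S] and [C - S], and [(C + S)^2 + (C - S)^2 = 2 (C^2 + S^2)]. *)
Lemma normc_fourier u k : torus_integrable u ->
  Normc.normc (fourier u k) ^+ 2 =
  (hartley_coef u k ^+ 2 + hartley_coef u (- k) ^+ 2) / 2.
Proof.
move=> iu; rewrite !hartley_coefE//.
have [iuc ius] := torus_integrable_mul_wave k iu.
have -> : torus_integral (fun x => u x * cos (wave_dot (- k) x)) =
    torus_integral (fun x => u x * cos (wave_dot k x)).
  by apply: eq_torus_integral => x _; rewrite wave_dotN cosN.
have -> : torus_integral (fun x => u x * sin (wave_dot (- k) x)) =
    - torus_integral (fun x => u x * sin (wave_dot k x)).
  rewrite -[RHS]mulN1r -torus_integralZ//.
  by apply: eq_torus_integral => x _; rewrite wave_dotN sinN; ring.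
rewrite /fourier /distribution_fourier /regular_distribution /Normc.normc /=.
rewrite sqr_sqrtr ?addr_ge0 ?sqr_ge0//.
by move: (2 * pi)^-1 => q; field.
Qed.

End Hartley.

Section HartleyExpansion.
Variable R : realType.
Implicit Types (u v g h : R * R -> R) (k l : int * int).

Local Notation cell := (@torus_cell R).
Local Notation H := (@hartley_coef R).

Lemma integrable_mul_hartley u k : torus_L2 u ->
  torus_integrable (fun x => u x * hartley k x).
Proof. by move=> Lu; apply: torus_L2_integrable_mul => //; exact: hartley_L2. Qed.

Lemma hartley_coefD u v k : torus_L2 u -> torus_L2 v ->
  H (fun x => u x + v x) k = H u k + H v k.
Proof.
move=> Lu Lv; rewrite /hartley_coef -torus_integralD; [|exact: integrable_mul_hartley..].
by apply: eq_torus_integral => x _; rewrite mulrDl.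
Qed.

Lemma hartley_coefZ (c : R) u k : torus_L2 u -> H (fun x => c * u x) k = c * H u k.
Proof.
move=> Lu; rewrite /hartley_coef -torus_integralZ; last exact: integrable_mul_hartley.
by apply: eq_torus_integral => x _; rewrite mulrA.
Qed.

Lemma hartley_coefB u v k : torus_L2 u -> torus_L2 v ->
  H (fun x => u x - v x) k = H u k - H v k.
Proof.
move=> Lu Lv; rewrite /hartley_coef -torus_integralB; [|exact: integrable_mul_hartley..].
by apply: eq_torus_integral => x _; rewrite mulrBl.
Qed.

Definition hartley_sum (c : int * int -> R) (N : nat) (x : R * R) : R :=
  \sum_(k <- box N) c k * hartley k x.

Lemma hartley_sum_L2 c N : torus_L2 (hartley_sum c N).
Proof. by apply: torus_L2_sum => k; apply: torus_L2Z; exact: hartley_L2. Qed.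

Lemma torus_integral_mul_hartley_sum u c N : torus_L2 u ->
  torus_integral (fun x => u x * hartley_sum c N x) = \sum_(k <- box N) c k * H u k.
Proof.
move=> Lu; have iu k := @torus_integrableZ R (c k) _ (integrable_mul_hartley k Lu).
under [RHS]eq_bigr => k _ do
  rewrite -(torus_integralZ (c k) (integrable_mul_hartley k Lu)).
rewrite -torus_integral_sum//; apply: eq_torus_integral => x _.
by rewrite /hartley_sum mulr_sumr; apply: eq_bigr => k _; ring.
Qed.

Lemma hartley_coef_hartley k l : H (hartley k) l = (k == l)%:R.
Proof. exact: hartley_orthonormal. Qed.

Lemma sum_box_pick (c : int * int -> R) N k :
  \sum_(l <- box N) c l * (l == k)%:R = if k \in box N then c k else 0.
Proof.
case: ifPn => kN.
  rewrite (bigD1_seq k) ?uniq_box//= eqxx mulr1 big1 ?addr0// => l /negPf ->.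
  by rewrite mulr0.
rewrite big_seq big1// => l lN; case: eqP => [lk|_]; last by rewrite mulr0.
by rewrite -lk lN in kN.
Qed.

Lemma hartley_coef_sum c N k :
  H (hartley_sum c N) k = if k \in box N then c k else 0.
Proof.
rewrite /hartley_coef -sum_box_pick.
under eq_torus_integral do rewrite mulrC.
rewrite torus_integral_mul_hartley_sum; last exact: hartley_L2.
by apply: eq_bigr => l _; rewrite hartley_coef_hartley eq_sym.
Qed.

Lemma torus_integral_hartley_residual u N : torus_L2 u ->
  torus_integral (fun x => (u x - hartley_sum (H u) N x) ^+ 2) =
  torus_integral (fun x => u x ^+ 2) - \sum_(k <- box N) H u k ^+ 2.
Proof.
move=> Lu; have Lp := hartley_sum_L2 (H u) N.
have [_ iu] := Lu; have [_ ip] := Lp; have iup := torus_L2_integrable_mul Lu Lp.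
have -> : torus_integral (fun x => (u x - hartley_sum (H u) N x) ^+ 2) =
    torus_integral (fun x => u x ^+ 2 - 2 * (u x * hartley_sum (H u) N x) +
      hartley_sum (H u) N x * hartley_sum (H u) N x).
  by apply: eq_torus_integral => x _; ring.
rewrite torus_integralD; [|by apply: torus_integrableB => //; exact: torus_integrableZ
  |exact: torus_L2_integrable_mul].
rewrite torus_integralB//; last exact: torus_integrableZ.
rewrite torus_integralZ// !torus_integral_mul_hartley_sum//.
have -> : \sum_(k <- box N) H u k * H (hartley_sum (H u) N) k =
    \sum_(k <- box N) H u k ^+ 2.
  by rewrite big_seq [RHS]big_seq; apply: eq_bigr => k kN; rewrite hartley_coef_sum kN.
have -> : \sum_(k <- box N) H u k * H u k = \sum_(k <- box N) H u k ^+ 2 by [].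
by ring.
Qed.

Let res u N := torus_integral (fun x => (u x - hartley_sum (H u) N x) ^+ 2).

Let res_ge0 u N : 0 <= res u N.
Proof. by apply: torus_integral_ge0 => x _; exact: sqr_ge0. Qed.

Let res_le u N M : torus_L2 u -> (N <= M)%N -> res u M <= res u N.
Proof.
move=> Lu NM; rewrite /res !torus_integral_hartley_residual// lerD2l lerN2.
by apply: le_sum_box => // k; exact: sqr_ge0.
Qed.

Lemma hartley_sumD c d N x :
  hartley_sum (fun k => c k + d k) N x = hartley_sum c N x + hartley_sum d N x.
Proof. by rewrite -big_split; apply: eq_bigr => k _; rewrite mulrDl. Qed.

Lemma torus_integral_sqrD_le u v : torus_L2 u -> torus_L2 v ->
  torus_integral (fun x => (u x + v x) ^+ 2) <=
  2 * torus_integral (fun x => u x ^+ 2) + 2 * torus_integral (fun x => v x ^+ 2).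
Proof.
move=> Lu Lv; have [_ iu] := Lu; have [_ iv] := Lv.
have [_ iuv] := torus_L2D Lu Lv.
rewrite -!torus_integralZ// -torus_integralD; [|exact: torus_integrableZ..].
apply: le_torus_integral => // [|x _].
  by apply: torus_integrableD; exact: torus_integrableZ.
by have := sqr_ge0 (u x - v x); nra.
Qed.

Let resD u v N : torus_L2 u -> torus_L2 v ->
  res (fun x => u x + v x) N <= 2 * res u N + 2 * res v N.
Proof.
move=> Lu Lv; rewrite /res.
have -> : torus_integral (fun x => (u x + v x - hartley_sum (H (fun x => u x + v x)) N x) ^+ 2)
   = torus_integral (fun x => ((u x - hartley_sum (H u) N x) +
       (v x - hartley_sum (H v) N x)) ^+ 2).
  apply: eq_torus_integral => x _; congr (_ ^+ 2).
  rewrite (_ : H (fun x => u x + v x) = fun k => H u k + H v k).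
    by rewrite hartley_sumD; ring.
  by apply/funext => k; exact: hartley_coefD.
by apply: torus_integral_sqrD_le; apply: torus_L2B => //; exact: hartley_sum_L2.
Qed.

(** One good [N] per [e] is enough, because the residual does not increase with [N]. *)
Definition hartley_complete u := torus_L2 u /\
  forall e : R, 0 < e -> exists N, res u N < e.

Lemma hartley_completeD u v : hartley_complete u -> hartley_complete v ->
  hartley_complete (fun x => u x + v x).
Proof.
move=> [Lu uc] [Lv vc]; split=> [|e e0]; first exact: torus_L2D.
have e4 : 0 < e / 4 by rewrite divr_gt0.
have [N uN] := uc _ e4; have [M vM] := vc _ e4; exists (maxn N M).
apply: le_lt_trans (resD _ Lu Lv) _.
move: uN vM (res_le Lu (leq_maxl N M)) (res_le Lv (leq_maxr N M)).
by move: (res u _) (res v _) (res u _) (res v _) => a b c d; lra.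
Qed.

Lemma hartley_completeZ (c : R) u : hartley_complete u ->
  hartley_complete (fun x => c * u x).
Proof.
move=> [Lu uc]; split=> [|e e0]; first exact: torus_L2Z.
have c1 : 0 < c ^+ 2 + 1 by rewrite ltr_wpDl ?sqr_ge0.
have [N uN] := uc (e / (c ^+ 2 + 1)) (divr_gt0 e0 c1); exists N.
have resE : res (fun x => c * u x) N = c ^+ 2 * res u N.
  have Lr := torus_L2B Lu (hartley_sum_L2 (H u) N); have [_ ir] := Lr.
  rewrite /res -torus_integralZ//; apply: eq_torus_integral => x _.
  rewrite -exprMn mulrBr; congr ((_ - _) ^+ 2); rewrite /hartley_sum mulr_sumr.
  by apply: eq_bigr => k _; rewrite hartley_coefZ// -mulrA.
rewrite resE; move: uN; rewrite ltr_pdivlMr// => uN.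
apply: le_lt_trans uN; rewrite mulrDr mulr1 [res u N * _]mulrC lerDl.
exact: res_ge0.
Qed.

Lemma hartley_completeB u v : hartley_complete u -> hartley_complete v ->
  hartley_complete (fun x => u x - v x).
Proof.
move=> uc vc; have := hartley_completeD uc (hartley_completeZ (-1) vc).
by under eq_fun do rewrite mulN1r.
Qed.

Lemma hartley_complete_closed u : torus_L2 u ->
  (forall e : R, 0 < e -> exists2 v, hartley_complete v &
    torus_integral (fun x => (u x - v x) ^+ 2) < e) ->
  hartley_complete u.
Proof.
move=> Lu appr; split=> // e e0; have e4 : 0 < e / 4 by rewrite divr_gt0.
have [v [Lv vc] uv] := appr _ e4; have [N vN] := vc _ e4; exists N.
have Luv := torus_L2B Lu Lv.
have -> : u = fun x => (u x - v x) + v x by apply/funext => x; rewrite subrK.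
apply: le_lt_trans (resD _ Luv Lv) _.
have : res (fun x => u x - v x) N <= torus_integral (fun x => (u x - v x) ^+ 2).
  rewrite /res torus_integral_hartley_residual// gerBl.
  by apply: sumr_ge0 => k _; exact: sqr_ge0.
move: vN uv; rewrite -/(res v N).
move: (res (fun x => u x - v x) N) (torus_integral _) (res v N) => a b d.
by lra.
Qed.

(** Dominated convergence turns uniformly bounded pointwise limits into L^2 limits. The null set [E]
    will hold the lines on which approximations of an indicator fail. *)
Lemma hartley_complete_limit u (F : nat -> R * R -> R) (c : R) (E : set (R * R)) :
  measurable_fun cell u -> (forall n, hartley_complete (F n)) ->
  (forall x, cell x -> `|u x| <= c) ->
  (forall n x, cell x -> `|F n x| <= c) ->
  (@lebesgue_measure R \x @lebesgue_measure R)%E.-negligible E ->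
  (forall x, cell x -> ~ E x -> F ^~ x @ \oo --> u x) ->
  hartley_complete u.
Proof.
move=> mu_ Fc uc Fb E0 Fu; have Lu := torus_L2_bounded mu_ uc.
apply: hartley_complete_closed => // e e0.
have mF n : measurable_fun cell (F n) by case: (Fc n) => -[].
have : (fun n => torus_integral (fun x => (u x - F n x) ^+ 2)) @ \oo -->
    torus_integral (fun=> (0 : R)).
  apply: (torus_integral_dominated (g := fun=> (2 * c) ^+ 2) (N := E)) => //.
  - by move=> n; apply: measurable_funX; exact: measurable_funB.
  - exact: torus_integrable_cst.
  - move=> n x Dx; rewrite normrX lerXn2r// ?nnegrE//.
      by have := uc x Dx; have := normr_ge0 (u x); lra.
    apply: le_trans (ler_normB _ _) _.
    by have := uc x Dx; have := Fb n x Dx; lra.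
  - move=> x Dx Ex; rewrite [X in _ --> X](_ : _ = (u x - u x) * (u x - u x)); last first.
      by rewrite subrr mul0r.
    have cB : (fun n => u x - F n x) @ \oo --> u x - u x.
      by apply: cvgB; [exact: cvg_cst|exact: Fu].
    by under eq_fun do rewrite expr2; exact: cvgM.
rewrite torus_integral_cst mul0r => /cvgrPdist_lt/(_ e e0)[n _ /(_ n (leqnn n))].
rewrite /= sub0r normrN => en; exists (F n) => //.
exact: le_lt_trans (ler_norm _) en.
Qed.

Lemma eq_hartley_complete u v : (forall x, cell x -> u x = v x) ->
  hartley_complete u -> hartley_complete v.
Proof.
move=> uv [Lu uc]; have uv' : {in cell, u =1 v} by move=> x /set_mem /uv.
have Lv : torus_L2 v.
  case: Lu => mu_ iu; split; first by apply: eq_measurable_fun mu_.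
  by apply: eq_integrable iu; [exact: measurable_torus_cell|move=> x /uv' /= ->].
split; first exact: Lv.
move=> e e0; have [N uN] := uc _ e0; exists N.
suff -> : res v N = res u N by exact: uN.
apply: eq_torus_integral => x Dx; rewrite uv//; congr ((_ - _) ^+ 2).
apply: eq_bigr => k _; congr (_ * _).
by apply: eq_torus_integral => y Dy; rewrite uv.
Qed.

Lemma hartley_complete_hartley k : hartley_complete (hartley k).
Proof.
split=> [|e e0]; first exact: hartley_L2.
have [N sN] := subset_box [:: k]; exists N.
rewrite /res (_ : torus_integral _ = 0)//.
rewrite -[RHS](mul0r ((2 * pi) ^+ 2)) -torus_integral_cst.
apply: eq_torus_integral => x _; rewrite /hartley_sum.
under eq_bigr do rewrite hartley_coef_hartley eq_sym mulrC.
by rewrite sum_box_pick sN ?mem_head// subrr expr0n.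
Qed.

(** The cosine and the sine of [wave_dot k x] are [pi] times the sum and the difference of
    [hartley k] and [hartley (- k)]; expanding [cos (wave_dot k x + t)] gives the two
    coefficients. *)
Lemma hartley_complete_cos_wave k (t : R) :
  hartley_complete (fun x => cos (wave_dot k x + t)).
Proof.
have := hartley_completeD
  (hartley_completeZ (pi * (cos t - sin t)) (hartley_complete_hartley k))
  (hartley_completeZ (pi * (cos t + sin t)) (hartley_complete_hartley (- k))).
apply: eq_hartley_complete => x _.
rewrite /hartley wave_dotN cosN sinN cosD.
have : pi != 0 :> R by rewrite gt_eqF ?pi_gt0.
by move: (pi : R) => p p0; field.
Qed.

End HartleyExpansion.

(** * Density of trigonometric polynomials: from rays to measurable sets *)

Section Density.
Variable R : realType.
Implicit Types (u v g h : R * R -> R).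

Local Notation leb := (@lebesgue_measure R).
Local Notation mu := (@lebesgue_measure R \x @lebesgue_measure R)%E.
Local Notation cell := (@torus_cell R).

Inductive trig_poly : (R * R -> R) -> Prop :=
| trig_cos k (t : R) : trig_poly (fun x => cos (wave_dot k x + t))
| trig_scale (c : R) g : trig_poly g -> trig_poly (fun x => c * g x)
| trig_add g h : trig_poly g -> trig_poly h -> trig_poly (fun x => g x + h x).

Lemma trig_cst (c : R) : trig_poly (fun=> c).
Proof.
rewrite (_ : (fun=> c) = fun x => c * cos (wave_dot 0 x + 0)).
  exact/trig_scale/trig_cos.
by apply/funext => x; rewrite /wave_dot /= !mul0r !addr0 cos0 mulr1.
Qed.

Lemma trig_mul g h : trig_poly g -> trig_poly h -> trig_poly (fun x => g x * h x).
Proof.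
elim=> {g} [k s|c g _ IH|g1 g2 _ IH1 _ IH2] ph; last 2 first.
- by under eq_fun do rewrite -mulrA; apply: trig_scale; exact: IH.
- by under eq_fun do rewrite mulrDl; apply: trig_add; [exact: IH1|exact: IH2].
elim: ph => {h} [l t|c h _ IH|h1 h2 _ IH1 _ IH2]; last 2 first.
- by under eq_fun do rewrite mulrCA; apply: trig_scale; exact: IH.
- by under eq_fun do rewrite mulrDr; apply: trig_add; [exact: IH1|exact: IH2].
rewrite (_ : (fun _ => _) = fun x => 2^-1 * (cos (wave_dot (k - l) x + (s - t)) +
    cos (wave_dot (k + l) x + (s + t)))).
  by apply: trig_scale; apply: trig_add; exact: trig_cos.
apply/funext => x; rewrite !wave_dotD wave_dotN.
rewrite (_ : _ - _ + (s - t) = (wave_dot k x + s) - (wave_dot l x + t)); last by ring.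
rewrite (_ : _ + _ + (s + t) = (wave_dot k x + s) + (wave_dot l x + t)); last by ring.
move: (_ + s) (_ + t) => y z; rewrite cosB cosD; by field.
Qed.

Lemma trig_exp n g : trig_poly g -> trig_poly (fun x => g x ^+ n).
Proof.
move=> pg; elim: n => [|n IH].
  by under eq_fun do rewrite expr0; exact: trig_cst.
by under eq_fun do rewrite exprS; exact: trig_mul.
Qed.

Lemma trig_hartley_complete g : trig_poly g -> hartley_complete g.
Proof.
elim=> {g} [k t|c g _ IH|g h _ IHg _ IHh].
- exact: hartley_complete_cos_wave.
- exact: hartley_completeZ.
- exact: hartley_completeD.
Qed.

Lemma Bernoulli_le (y : R) n : -1 <= y -> 1 + n%:R * y <= (1 + y) ^+ n.
Proof.
move=> y1; elim: n => [|n IH]; first by rewrite mul0r addr0 expr0.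
have y0 : 0 <= 1 + y by lra.
rewrite exprS; apply: le_trans (ler_wpM2l y0 IH).
by have := ler0n R n; rewrite -natr1; have := sqr_ge0 y; nra.
Qed.

(* Kuhn's polynomials: on [0, 1] they converge boundedly to the indicator
   function of [y < 1/2] away from [1/2]. *)
Definition kuhn n (y : R) : R := (1 - y ^+ n) ^+ (2 ^ n).

Lemma kuhn_ge0 n y : 0 <= y <= 1 -> 0 <= kuhn n y <= 1.
Proof.
move=> /andP[y0 y1]; have yn0 : 0 <= y ^+ n by rewrite exprn_ge0.
have yn1 : y ^+ n <= 1 by rewrite exprn_ile1.
by rewrite exprn_ge0 ?exprn_ile1//; lra.
Qed.

Lemma kuhn_cvg1 y : 0 <= y < 1 / 2 -> kuhn ^~ y @ \oo --> (1 : R).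
Proof.
move=> /andP[y0 y1].
have yy n : 0 <= y ^+ n <= 1 by rewrite exprn_ge0//= exprn_ile1//; lra.
apply: (squeeze_cvgr (f := fun n => 1 - (2 * y) ^+ n) (h := fun=> 1)).
- apply: nearW => n; apply/andP; split; last first.
    have h : 0 <= y <= 1 by lra.
    by case/andP: (kuhn_ge0 n h).
  have := @Bernoulli_le (- y ^+ n) (2 ^ n).
  rewrite natrX exprMn mulrN; apply.
  by have /andP[] := yy n; lra.
- rewrite -[X in _ --> X]subr0; apply: cvgB; first exact: cvg_cst.
  by apply: cvg_expr; rewrite ger0_norm; lra.
- exact: cvg_cst.
Qed.

(** Multiplying by [(1 + y^n)^(2^n)] gives [(1 - y^(2n))^(2^n) <= 1], while Bernoulli bounds that
    factor below by [(2 y)^n], which tends to infinity. *)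
Lemma kuhn_cvg0 y : 1 / 2 < y <= 1 -> kuhn ^~ y @ \oo --> (0 : R).
Proof.
move=> /andP[y0 y1].
have y2 : 0 < 2 * y by lra.
apply: (squeeze_cvgr (f := fun=> 0) (h := fun n => (2 * y)^-1 ^+ n)).
- apply: nearW => n; have yn : 0 <= y ^+ n <= 1.
    by rewrite exprn_ge0 ?exprn_ile1//; lra.
  have h : 0 <= y <= 1 by lra.
  apply/andP; split; first by case/andP: (kuhn_ge0 n h).
  rewrite exprVn -[leRHS]mul1r ler_pdivlMr ?exprn_gt0//.
  have [yn0 yn1] := andP yn.
  have B := @Bernoulli_le (y ^+ n) (2 ^ n).
  have B' : (2 * y) ^+ n <= (1 + y ^+ n) ^+ (2 ^ n).
    rewrite exprMn -natrX; apply: le_trans (B _); last by lra.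
    by lra.
  apply: (@le_trans _ _ (kuhn n y * (1 + y ^+ n) ^+ (2 ^ n))).
    by rewrite ler_wpM2l//; case/andP: (kuhn_ge0 n h).
  rewrite /kuhn -exprMn exprn_ile1//.
    by rewrite mulr_ge0; lra.
  by nra.
- exact: cvg_cst.
- by apply: cvg_expr; rewrite ger0_norm ?invr_ge0 ?ltW// invf_lt1//; lra.
Qed.

Lemma ray_approximation (a : R) : exists F : nat -> R -> R,
  [/\ forall n, trig_poly (fun x => F n x.1), forall n, trig_poly (fun x => F n x.2),
      forall n t, 0 <= F n t <= 1 &
      forall t, - pi < t < pi -> t != a -> F ^~ t @ \oo --> ((a < t)%R%:R : R)].
Proof.
have [an|an] := ltP a (- pi).
  exists (fun _ _ => 1); split=> [n|n|n t|t /andP[t1 _] _]; try exact: trig_cst.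
    by rewrite ler01 lexx.
  by rewrite (lt_trans an t1); exact: cvg_cst.
have [ap|ap] := ltP pi a.
  exists (fun _ _ => 0); split=> [n|n|n t|t /andP[_ t1] _]; try exact: trig_cst.
    by rewrite ler01 lexx.
  by rewrite ltNge (ltW (lt_trans t1 ap)); exact: cvg_cst.
(* A trigonometric polynomial with values in [0, 1] that is below 1/2 exactly to the right of [a]:
   the difference of sines equals [2 sin ((t - a) / 2) cos (t / 2)]. On the open period the cosine
   is positive and the sine has the sign of [t - a]. Neither half-angle factor is periodic, but
   their product is. *)
pose s t := (1 - (sin (t - a / 2) - sin (a / 2)) / 2) / 2.
have s01 t : 0 <= s t <= 1.
  rewrite /s; have := sin_le1 (t - a / 2); have := sin_geN1 (t - a / 2).
  by have := sin_le1 (a / 2); have := sin_geN1 (a / 2); lra.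
have trig_s k (y : R * R -> R) : y = wave_dot k -> trig_poly (fun x => s (y x)).
  move=> ->; rewrite (_ : (fun x => _) = fun x => (1 + sin (a / 2) / 2) / 2 +
      (- 1 / 4) * cos (wave_dot k x + (- (a / 2) - pi / 2))).
    by apply: trig_add; [exact: trig_cst|apply: trig_scale; exact: trig_cos].
  by apply/funext => x; rewrite addrA cosBpihalf /s; field.
have trig_F k (y : R * R -> R) n : y = wave_dot k ->
    trig_poly (fun x => kuhn n (s (y x))).
  move=> yk; apply: trig_exp; rewrite (_ : (fun x => _) = fun x => 1 + (- 1) * s (y x) ^+ n).
    apply: trig_add; first exact: trig_cst.
    by apply: trig_scale; apply: trig_exp; exact: trig_s yk.
  by apply/funext => x; rewrite mulN1r.
exists (fun n t => kuhn n (s t)); split=> [n|n|n t|t /andP[t1 t2] ta].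
- by apply: (trig_F (1, 0)); apply/funext => x; rewrite /wave_dot /= mul0r addr0 mul1r.
- by apply: (trig_F (0, 1)); apply/funext => x; rewrite /wave_dot /= mul0r add0r mul1r.
- exact: kuhn_ge0.
have sE : s t = (1 - sin ((t - a) / 2) * cos (t / 2)) / 2.
  rewrite /s; have -> : t - a / 2 = (t - a) / 2 + t / 2 by field.
  have -> : a / 2 = t / 2 - (t - a) / 2 by field.
  by rewrite sinD sinB; field.
have ct : 0 < cos (t / 2) by apply: cos_gt0_pihalf; lra.
have [at_|ta'] := ltP a t.
  apply: kuhn_cvg1; rewrite (andP (s01 t)).1 /= sE.
  have : 0 < sin ((t - a) / 2) by apply: sin_gt0_pi; lra.
  by move=> h; have := mulr_gt0 h ct; lra.
apply: kuhn_cvg0; rewrite (andP (s01 t)).2 andbT sE.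
have ta2 : t < a by rewrite lt_neqAle ta.
have : 0 < sin ((a - t) / 2) by apply: sin_gt0_pi; lra.
rewrite (_ : (a - t) / 2 = - ((t - a) / 2)) ?sinN; last by field.
by move=> h; have := mulr_gt0 h ct; lra.
Qed.

Lemma negligible_vertical_lines (s : seq R) :
  mu.-negligible [set x | x.1 \in s \/ x.2 \in s].
Proof.
elim: s => [|a s IH].
  by apply: negligibleS (negligible_set0 mu) => x [].
have null1 : mu.-negligible ([set a] `*` setT).
  exists ([set a] `*` setT); split => //; first exact: measurableX.
  transitivity (leb [set a] * leb setT)%E; last by rewrite lebesgue_measure_set1 mul0e.
  exact: product_measure1E.
have null2 : mu.-negligible (setT `*` [set a]).
  exists (setT `*` [set a]); split => //; first exact: measurableX.
  transitivity (leb setT * leb [set a])%E; last by rewrite lebesgue_measure_set1 mule0.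
  exact: product_measure1E.
apply: negligibleS (negligibleU (negligibleU null1 null2) IH) => x /=.
by rewrite !inE => -[|] /orP[/eqP ->|xs]; [left; left|right; left|left; right|right; right].
Qed.

Lemma quarter_plane_complete (a b : R) :
  hartley_complete (fun x => ((a < x.1) && (b < x.2))%:R).
Proof.
have [F [F1 _ F01 Fc]] := ray_approximation a.
have [G [_ G2 G01 Gc]] := ray_approximation b.
apply: (@hartley_complete_limit R _ (fun n x => F n x.1 * G n x.2) 1
  [set x | x.1 \in [:: a; b; pi; - pi] \/ x.2 \in [:: a; b; pi; - pi]]).
- apply: measurable_funTS.
  rewrite (_ : (fun x => _) = \1_(`]a, +oo[%classic `*` `]b, +oo[%classic)).
    by apply: measurable_indic; apply: measurableX; exact: measurable_itv.
  by apply/funext => x; rewrite indicE in_setX !mem_setE !in_itv /= !andbT.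
- by move=> n; apply: trig_hartley_complete; apply: trig_mul.
- by move=> x _; case: (_ && _); rewrite ?normr1 ?normr0 ?ler01.
- move=> n x _; have /andP[F0 F1'] := F01 n x.1; have /andP[G0 G1'] := G01 n x.2.
  by rewrite ger0_norm ?mulr_ge0// mulr_ile1.
- exact: negligible_vertical_lines.
move=> x [/=]; rewrite !in_itv /= => /andP[x1 x1'] /andP[x2 x2'].
move=> nE.
have n1 : x.1 \notin [:: a; b; pi; - pi] by apply/negP => h; apply: nE; left.
have n2 : x.2 \notin [:: a; b; pi; - pi] by apply/negP => h; apply: nE; right.
move: n1 n2; rewrite !inE !negb_or => /and4P[x1a _ x1p x1n] /and4P[_ x2b x2p x2n].
rewrite -mulnb natrM; apply: cvgM.
  by apply: Fc => //; rewrite !lt_neqAle x1 x1' x1p eq_sym x1n.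
by apply: Gc => //; rewrite !lt_neqAle x2 x2' x2p eq_sym x2n.
Qed.

Let compl (A : set (R * R)) := hartley_complete (\1_A : R * R -> R).

(* Dynkin's argument along a measurable map [p], relative to a fixed set [Q]. *)
Lemma dynkin_complete d (X : measurableType d) (G : set (set X)) (p : R * R -> X)
    (Q : set (R * R)) :
  measurable_fun setT p -> measurable Q ->
  @measurable _ X = <<s G >> -> setI_closed G ->
  compl Q -> (forall A, G A -> compl (p @^-1` A `&` Q)) ->
  forall A, measurable A -> compl (p @^-1` A `&` Q).
Proof.
move=> mp mQ XG GI cQ GQ A mA; have {mA} : <<s G >> A by rewrite -XG.
apply: (dynkin_induction (P := fun A => compl (p @^-1` A `&` Q)) XG GI _ GQ).
- by rewrite preimage_setT setTI.
- move=> S mS cS; have := hartley_completeB cQ cS.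
  apply: eq_hartley_complete => x _; rewrite !indicE !in_setI.
  rewrite (_ : (x \in p @^-1` (~` S)) = ~~ (x \in p @^-1` S)).
    case: (x \in p @^-1` S); case: (x \in Q) => /=; lra.
  by rewrite -in_setC.
move=> F mF tF cF.
pose S n (x : R * R) : R := \sum_(k < n) \1_(p @^-1` F k `&` Q) x.
have cS n : hartley_complete (S n).
  elim: n => [|n IH].
    apply: (eq_hartley_complete _ (hartley_completeZ 0 cQ)) => x _.
    by rewrite /S big_ord0 mul0r.
  apply: (eq_hartley_complete _ (hartley_completeD IH (cF n))) => x _.
  by rewrite /S big_ord_recr.
have S_in n x j : (p @^-1` F j `&` Q) x -> S n x = (j < n)%:R.
  move=> [pj Qx]; rewrite /S (eq_bigr (fun k : 'I_n => ((k : nat) == j)%:R)); last first.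
    move=> k _; rewrite indicE; case: eqP => [->|kj]; first by rewrite mem_set.
    rewrite memNset// => -[pk _].
    have /trivIsetP/(_ k j I I) := tF.
    by move/(_ (introN eqP kj)) => FF; have : (F k `&` F j) (p x) by []; rewrite FF.
  elim: (n) => [|m IHm]; first by rewrite big_ord0.
  rewrite big_ord_recr /= IHm ltnS [in RHS]leq_eqVlt [m == j]eq_sym.
  case: (ltngtP j m) => /= h; rewrite ?addr0 ?add0r //.
have S_out n x : ~ (p @^-1` (\bigcup_k F k) `&` Q) x -> S n x = 0.
  move=> nx; rewrite /S big1// => k _; rewrite indicE memNset// => -[pk Qx].
  by apply: nx; split => //; exists k.
apply: (@hartley_complete_limit R _ S 1 set0) => //.
- apply: measurable_funTS; apply: measurable_indic; apply: measurableI => //.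
  by rewrite -[X in measurable X]setTI; apply: mp => //; exact: bigcup_measurable.
- by move=> x _; rewrite indicE; case: (_ \in _); rewrite ?normr1 ?normr0 ?ler01.
- move=> n x _; have [[[j _ pj] Qx]|nx] := pselect ((p @^-1` (\bigcup_k F k) `&` Q) x).
    by rewrite (S_in n x j)//; case: (_ < _)%N; rewrite ?normr1 ?normr0 ?ler01.
  by rewrite S_out// normr0 ler01.
- exact: negligible_set0.
move=> x _ _; have [[[j _ pj] Qx]|nx] := pselect ((p @^-1` (\bigcup_k F k) `&` Q) x).
  rewrite indicE mem_set; last by split => //; exists j.
  apply: cvg_near_cst; exists j.+1 => // n /= jn.
  by rewrite (S_in n x j)// jn.
rewrite indicE memNset//.
by under eq_fun do rewrite S_out//; exact: cvg_cst.
Qed.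

(** Three Dynkin arguments: in the first coordinate against a fixed ray in the second, in the second
    coordinate against a fixed measurable strip, and finally on the product sigma-algebra, which is
    generated by the rectangles so obtained. *)
Lemma indicator_complete (A : set (R * R)) : measurable A -> compl A.
Proof.
pose ray (a : R) : set R := [set t | a < t].
have measR : @measurable _ R = <<s (@RGenOInfty.G R) >> := RGenOInfty.measurableE R.
have GI : setI_closed (@RGenOInfty.G R).
  move=> _ _ [a ->] [b ->]; exists (Num.max a b); rewrite !set_itvE.
  apply/seteqP; split => x /=; first by rewrite gt_max => -[-> ->].
  by rewrite gt_max => /andP[].
have mray a : measurable (`]a, +oo[%classic : set R) by exact: measurable_itv.
have cell_le (x : R * R) : cell x -> - pi - 1 < x.1 /\ - pi - 1 < x.2.
  by move=> [/=]; rewrite !in_itv /= => /andP[? _] /andP[? _]; split; lra.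
have qp a b : compl (fst @^-1` `]a, +oo[%classic `&` snd @^-1` `]b, +oo[%classic).
  rewrite !set_itvE; apply: eq_hartley_complete (quarter_plane_complete a b) => x _.
  rewrite indicE; congr (nat_of_bool _)%:R.
  by apply/idP/idP => [/andP[h1 h2]|/set_mem[h1 h2]]; [exact/mem_set|exact/andP].
(* The ray starting at [- pi - 1] covers the whole cell, so a half-plane is a quarter-plane as far
   as the cell can see. Dynkin's argument needs this for its ambient set. *)
have half2 b : compl (snd @^-1` `]b, +oo[%classic).
  apply: eq_hartley_complete (quarter_plane_complete (- pi - 1) b) => x /cell_le[x1 _].
  rewrite indicE x1 set_itvE; congr (nat_of_bool _)%:R.
  by apply/idP/idP => [h|/set_mem//]; exact/mem_set.
have mpre1 (B : set R) : measurable B -> measurable (fst @^-1` B : set (R * R)).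
  by move=> mB; rewrite -[X in measurable X]setTI; apply: measurable_fst.
have mpre2 (B : set R) : measurable B -> measurable (snd @^-1` B : set (R * R)).
  by move=> mB; rewrite -[X in measurable X]setTI; apply: measurable_snd.
have step1 (B : set R) b : measurable B ->
    compl (fst @^-1` B `&` snd @^-1` `]b, +oo[%classic).
  apply: (dynkin_complete (G := @RGenOInfty.G R)) => //.
  - exact: mpre2.
  - by move=> _ [a ->]; exact: qp.
have half1 (B : set R) : measurable B -> compl (fst @^-1` B).
  move=> mB; apply: eq_hartley_complete (step1 B (- pi - 1) mB) => x /cell_le[_ x2].
  rewrite !indicE in_setI [X in _ && X](_ : _ = true) ?andbT//.
  by rewrite set_itvE; exact/mem_set.
have step2 (B C : set R) : measurable B -> measurable C ->
    compl (snd @^-1` C `&` fst @^-1` B).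
  move=> mB; apply: (dynkin_complete (G := @RGenOInfty.G R)) => //.
  - exact: mpre1.
  - exact: half1.
  - by move=> _ [a ->]; rewrite setIC; exact: step1.
have setT_compl : compl setT.
  rewrite -(setIT setT) -{1}(preimage_setT snd) -(preimage_setT fst).
  by apply: step2; exact: measurableT.
pose G : set (set (R * R)) := [set B `*` C | B in measurable & C in measurable].
have prodG : @measurable _ (R * R)%type = <<s G >>.
  exact: measurable_prod_measurableType.
have prodGI : setI_closed G.
  move=> _ _ [B1 mB1 [C1 mC1 <-]] [B2 mB2 [C2 mC2 <-]].
  exists (B1 `&` B2); first exact: measurableI.
  by exists (C1 `&` C2); [exact: measurableI|rewrite setXI].
have cG B : G B -> compl (id @^-1` B `&` setT).
  move=> [C mC [D mD <-]]; rewrite setIT preimage_id.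
  rewrite (_ : C `*` D = snd @^-1` D `&` fst @^-1` C); last by rewrite setIC.
  exact: step2.
move=> mA; rewrite -(setIT A) -(preimage_id A).
exact: (dynkin_complete (@measurable_id _ _ setT) measurableT prodG prodGI setT_compl cG mA).
Qed.

End Density.

(** * Completeness in L^2 and Parseval's identity *)

Section Parseval.
Import HBSimple HBNNSimple.
Variable R : realType.
Implicit Types (u v g h : R * R -> R).

Local Notation mu := (@lebesgue_measure R \x @lebesgue_measure R)%E.
Local Notation cell := (@torus_cell R).

Lemma hartley_complete_sum (J : Type) (r : seq J) (F : J -> R * R -> R) :
  (forall j, hartley_complete (F j)) ->
  hartley_complete (fun x => \sum_(j <- r) F j x).
Proof.
move=> Fc; elim: r => [|a r IH].
  under eq_fun do rewrite big_nil.
  by apply: trig_hartley_complete; exact: trig_cst.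
under eq_fun do rewrite big_cons.
exact: (hartley_completeD (Fc a) IH).
Qed.

Let hartley_complete_ge0 u : torus_L2 u -> (forall x, cell x -> 0 <= u x) ->
  hartley_complete u.
Proof.
move=> Lu u0; have [mu_ iu] := Lu.
have mEu : measurable_fun cell (EFin \o u) by exact/measurable_EFinP.
have Eu0 x : cell x -> (0 <= (EFin \o u) x)%E by move=> Dx; rewrite lee_fin u0.
pose g n := nnsfun_approx (@measurable_torus_cell R) mEu n.
have gc n : hartley_complete (g n : R * R -> R).
  have -> : (g n : R * R -> R) = fun x =>
      \sum_(y <- finmap.enum_fset (fset_set (range (g n)))) y * \1_(g n @^-1` [set y]) x.
    by apply/funext => x; rewrite fimfunE fsbig_finite.
  apply: hartley_complete_sum => y; apply: hartley_completeZ.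
  exact: indicator_complete.
have g_le n x : cell x -> 0 <= g n x <= u x.
  move=> Dx; rewrite fun_ge0 -lee_fin /g nnsfun_approxE.
  exact: (le_approx n Eu0 Dx).
apply: hartley_complete_closed => // e e0.
have mg n : measurable_fun cell (g n : R * R -> R) by exact: measurable_funTS.
have : (fun n => torus_integral (fun x => (u x - g n x) ^+ 2)) @ \oo -->
    torus_integral (fun=> (0 : R)).
  apply: (torus_integral_dominated (g := fun x => u x ^+ 2) (N := set0)).
  - by move=> n; apply: measurable_funX; exact: measurable_funB.
  - exact: measurable_cst.
  - exact: iu.
  - move=> n x Dx; have /andP[gx0 gxu] := g_le n x Dx.
    rewrite ger0_norm ?sqr_ge0// lerXn2r ?nnegrE ?subr_ge0 ?u0//.
    by rewrite gerBl.
  - exact: negligible_set0.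
  - move=> x Dx _.
    have gu : (fun n => g n x) @ \oo --> u x.
      by have := cvg_nnsfun_approx (@measurable_torus_cell R) mEu Eu0 Dx => /fine_cvg.
    rewrite [X in _ --> X](_ : _ = (u x - u x) * (u x - u x)); last first.
      by rewrite subrr mul0r.
    have cB : (fun n => u x - g n x) @ \oo --> u x - u x.
      by apply: cvgB; [exact: cvg_cst|exact: gu].
    by under eq_fun do rewrite expr2; exact: cvgM.
rewrite torus_integral_cst mul0r => /cvgrPdist_lt/(_ e e0)[n _ /(_ n (leqnn n))].
rewrite /= sub0r normrN => en; exists (g n : R * R -> R); first exact: gc.
exact: le_lt_trans (ler_norm _) en.
Qed.

Lemma hartley_complete_L2 u : torus_L2 u -> hartley_complete u.
Proof.
move=> Lu; have [mu_ iu] := Lu.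
have part (w : R * R -> R) : measurable_fun cell w -> (forall x, 0 <= w x <= `|u x|) ->
    hartley_complete w.
  move=> mw wu; apply: hartley_complete_ge0; last by move=> x _; case/andP: (wu x).
  split=> //; apply: torus_integrable_le iu; first exact: measurable_funX.
  move=> x _; have /andP[w0 wx] := wu x; rewrite ger0_norm ?sqr_ge0//.
  by rewrite -(real_normK (num_real (u x))) lerXn2r// nnegrE.
have p1 : hartley_complete (fun x => Num.max (u x) 0).
  apply: part => [|x]; first by apply: measurable_maxr => //; exact: measurable_cst.
  by rewrite le_max lexx orbT ge_max ler_norm normr_ge0.
have p2 : hartley_complete (fun x => Num.max (- u x) 0).
  apply: part => [|x].
    apply: measurable_maxr; last exact: measurable_cst.
    exact: measurableT_comp mu_.
  by rewrite le_max lexx orbT ge_max -normrN ler_norm normr_ge0.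
apply: eq_hartley_complete (hartley_completeB p1 p2) => x _.
by case: (leP (u x) 0) => h; case: (leP (- u x) 0) => h'; lra.
Qed.

Lemma hartley_residual_cvg u : torus_L2 u ->
  (fun N => torus_integral (fun x => (u x - hartley_sum (hartley_coef u) N x) ^+ 2))
    @ \oo --> (0 : R).
Proof.
move=> Lu; have [_ uc] := hartley_complete_L2 Lu.
apply/cvgrPdist_lt => e e0; have [N uN] := uc _ e0; exists N => // M /= NM.
rewrite sub0r normrN ger0_norm; last by apply: torus_integral_ge0 => x _; exact: sqr_ge0.
apply: le_lt_trans uN; rewrite !torus_integral_hartley_residual// lerD2l lerN2.
by apply: le_sum_box => // k; exact: sqr_ge0.
Qed.

(** The box sum is the pairing of [v] with the partial sum of [u], so Cauchy-Schwarz reduces the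
    claim to the residual of [u] alone. *)
Lemma Parseval u v : torus_L2 u -> torus_L2 v ->
  (fun N => \sum_(k <- box N) hartley_coef u k * hartley_coef v k) @ \oo -->
  torus_integral (fun x => u x * v x).
Proof.
move=> Lu Lv; set V := torus_integral (fun x => v x ^+ 2).
have V0 : 0 <= V by apply: torus_integral_ge0 => x _; exact: sqr_ge0.
apply/cvgrPdist_lt => e e0.
(* Dividing by [V + 1] also covers [V = 0]. *)
have e2 : 0 < e ^+ 2 / (V + 1) by rewrite divr_gt0 ?exprn_gt0// ltr_wpDl.
have /cvgrPdist_lt/(_ _ e2)[N _ NP] := hartley_residual_cvg Lu.
exists N => // M /NP; rewrite sub0r normrN => resM.
have Lp := hartley_sum_L2 (hartley_coef u) M.
rewrite -torus_integral_mul_hartley_sum//.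
under [X in _ - X]eq_torus_integral do rewrite mulrC.
rewrite -torus_integralB; [|exact: torus_L2_integrable_mul..].
rewrite (_ : torus_integral _ = torus_integral
    (fun x => (u x - hartley_sum (hartley_coef u) M x) * v x)); last first.
  by apply: eq_torus_integral => x _; rewrite mulrBl.
have := torus_CauchySchwarz (torus_L2B Lu Lp) Lv; rewrite -/V.
move: resM; set a := torus_integral (fun x => (_ - _) ^+ 2).
set b := torus_integral _ => a_lt b_le.
rewrite ltr_pdivlMr in a_lt; last by rewrite ltr_wpDl.
have a_ge := normr_ge0 a.
rewrite -(@ltr_pXn2r _ 2) ?nnegrE ?normr_ge0 ?(ltW e0)// real_normK ?num_real//.
apply: le_lt_trans b_le _; apply: le_lt_trans a_lt.
apply: le_trans (ler_wpM2r V0 (ler_norm a)) _.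
by rewrite mulrDr mulr1 lerDl.
Qed.

End Parseval.

(** * The cubic nonlinearity on H^1 *)

Section SobolevH1.
Variable R : realType.
Implicit Types (u v g : R * R -> R) (c : int * int -> R) (k : int * int).

Local Notation mu := (@lebesgue_measure R \x @lebesgue_measure R)%E.
Local Notation cell := (@torus_cell R).
Local Notation H := (@hartley_coef R).
Local Notation W := (@sobolev_weight R).

Lemma hartley_sum_bounded c N x :
  `|hartley_sum c N x| <= \sum_(k <- box N) `|c k|.
Proof.
apply: le_trans (ler_norm_sum _ _ _) _; apply: ler_sum => k _.
rewrite normrM -[leRHS]mulr1; apply: ler_wpM2l => //.
by apply: le_trans (hartley_bounded k x) _; rewrite invf_le1// ler1n.
Qed.

Lemma measurable_hartley_sum c N : measurable_fun cell (hartley_sum c N).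
Proof. by case: (hartley_sum_L2 c N). Qed.

Lemma hartley_sum_exp_L2 c N n : torus_L2 (fun x => hartley_sum c N x ^+ n).
Proof.
apply: (@torus_L2_bounded _ _ ((\sum_(k <- box N) `|c k|) ^+ n)).
  by apply: measurable_funX; exact: measurable_hartley_sum.
move=> x _; rewrite normrX lerXn2r ?nnegrE ?normr_ge0 ?hartley_sum_bounded//.
by apply: sumr_ge0.
Qed.

Lemma cube_sum (J : Type) (r : seq J) (F : J -> R) (y : R) :
  (\sum_(a <- r) F a) ^+ 3 * y =
  \sum_(a <- r) \sum_(b <- r) \sum_(d <- r) F a * (F b * (F d * y)).
Proof.
have e2 a z : \sum_(b <- r) F a * (F b * z) = F a * ((\sum_(b <- r) F b) * z).
  by rewrite -mulr_sumr -mulr_suml.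
under [RHS]eq_bigr do under eq_bigr do rewrite -mulr_sumr e2.
under [RHS]eq_bigr do rewrite e2.
by rewrite -mulr_suml; ring.
Qed.

Lemma hartley_coef_cube_le c N k :
  `|H (fun x => hartley_sum c N x ^+ 3) k| <=
  4 * \sum_(a <- box N) \sum_(b <- box N) \sum_(d <- box N)
    resonance R a b d k * (`|c a| * `|c b| * `|c d|).
Proof.
pose Q a b d x := @hartley R a x * hartley b x * (hartley d x * hartley k x).
have iQ a b d : torus_integrable (Q a b d).
  have Hle j x := @hartley_bounded R j x; have mH j := @measurable_hartley R j.
  apply: (@torus_integrable_bounded _ _ (2^-1 * 2^-1 * (2^-1 * 2^-1))) => [|x _].
    by apply: measurable_funM; apply: measurable_funM; exact: mH.
  rewrite /Q normrM (normrM (hartley a x)) (normrM (hartley d x)).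
  by apply: ler_pM; [exact: mulr_ge0|exact: mulr_ge0|apply: ler_pM|apply: ler_pM] => //;
    exact: Hle.
have -> : H (fun x => hartley_sum c N x ^+ 3) k =
    torus_integral (fun x => \sum_(a <- box N) \sum_(b <- box N) \sum_(d <- box N)
      (c a * c b * c d) * Q a b d x).
  apply: eq_torus_integral => x _; rewrite /hartley_sum cube_sum.
  apply: eq_bigr => a _; apply: eq_bigr => b _; apply: eq_bigr => d _.
  by rewrite /Q; ring.
have iQ1 a b d : torus_integrable (fun x => (c a * c b * c d) * Q a b d x).
  exact: torus_integrableZ.
have iQ2 a b : torus_integrable (fun x => \sum_(d <- box N) (c a * c b * c d) * Q a b d x).
  by apply: torus_integrable_sum => d; exact: iQ1.
have iQ3 a : torus_integrable (fun x => \sum_(b <- box N) \sum_(d <- box N)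
    (c a * c b * c d) * Q a b d x).
  by apply: torus_integrable_sum => b; exact: iQ2.
rewrite torus_integral_sum// mulr_sumr.
apply: le_trans (ler_norm_sum _ _ _) _; apply: ler_sum => a _.
rewrite torus_integral_sum// mulr_sumr.
apply: le_trans (ler_norm_sum _ _ _) _; apply: ler_sum => b _.
rewrite torus_integral_sum// mulr_sumr.
apply: le_trans (ler_norm_sum _ _ _) _; apply: ler_sum => d _.
rewrite torus_integralZ// !normrM mulrA mulrC; apply: ler_wpM2r.
  by rewrite !mulr_ge0.
exact: hartley_quadrilinear.
Qed.

Lemma trilinear_hartley_sum n c N M :
  \sum_(k <- box M) W k ^+ n * H (fun x => hartley_sum c N x ^+ 3) k ^+ 2 <=
  16 * trilinear_const R n * (\sum_(a <- box N) W a ^+ n.+1 * c a ^+ 2) *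
    (\sum_(a <- box N) W a * c a ^+ 2) ^+ 2.
Proof.
rewrite -(mulrA 16) -(mulrA 16); apply: le_trans (ler_wpM2l _ (trilinear_sum n N M c)); last by [].
rewrite mulr_sumr; apply: ler_sum => k _; rewrite [leRHS]mulrCA.
apply: ler_wpM2l; first by rewrite exprn_ge0 ?ltW ?sobolev_weight_gt0.
set T := \sum_(a <- _) _; have := hartley_coef_cube_le c N k; rewrite -/T.
move: T (H _ k) => T h hT; have := normr_ge0 h => h0.
rewrite -real_normK ?num_real// (_ : 16 = 4 ^+ 2); last by ring.
by rewrite -exprMn lerXn2r// nnegrE; exact: le_trans hT.
Qed.

(** Cauchy-Schwarz gives the constant [4 sqrt T] with [T = trilinear_const R 0]; since [T >= 1], the
    square root may be dropped. *)
Definition L4_const : R := 4 * trilinear_const R 0.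

Lemma L4_const_ge1 : 1 <= L4_const.
Proof. by rewrite /L4_const /trilinear_const expr0; lra. Qed.

(** The integral of [p ^+ 4] is the pairing of [p ^+ 3] with [p]. Cauchy-Schwarz in frequency and
    the trilinear estimate without weight bound its square by a multiple of [Y . Y^3]. *)
Lemma L4_hartley_sum c N :
  torus_integral (fun x => hartley_sum c N x ^+ 4) <=
  L4_const * (\sum_(a <- box N) W a * c a ^+ 2) ^+ 2.
Proof.
set Y := \sum_(a <- _) _; set p := hartley_sum c N.
have -> : torus_integral (fun x => p x ^+ 4) =
    \sum_(k <- box N) c k * H (fun x => p x ^+ 3) k.
  rewrite -torus_integral_mul_hartley_sum; last exact: hartley_sum_exp_L2.
  by apply: eq_torus_integral => x _; rewrite -exprSr.
set I4 := \sum_(k <- box N) _.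
have Y0 : 0 <= Y.
  by apply: sumr_ge0 => k _; rewrite mulr_ge0 ?sqr_ge0 ?ltW ?sobolev_weight_gt0.
have c2Y : \sum_(k <- box N) c k ^+ 2 <= Y.
  apply: ler_sum => k _; rewrite -[leLHS]mul1r ler_wpM2r ?sqr_ge0//.
  exact: sobolev_weight_ge1.
have T0 : 0 < trilinear_const R 0 := trilinear_const_gt0 R 0.
have tri : \sum_(k <- box N) H (fun x => p x ^+ 3) k ^+ 2 <=
    16 * trilinear_const R 0 * Y * Y ^+ 2.
  have := trilinear_hartley_sum 0 c N N; rewrite -/p.
  under eq_bigr do rewrite expr0 mul1r.
  rewrite (_ : \sum_(a <- box N) W a ^+ 1 * c a ^+ 2 = Y)//.
have cs : I4 ^+ 2 <= Y * (16 * trilinear_const R 0 * Y * Y ^+ 2).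
  have := @sum_CauchySchwarz R _ (box N) (fun=> 1) c (H (fun x => p x ^+ 3)) (fun=> ler01).
  under eq_bigr do rewrite mul1r.
  under [X in _ <= X * _ -> _]eq_bigr do rewrite mul1r.
  under [X in _ <= _ * X -> _]eq_bigr do rewrite mul1r.
  move/le_trans; apply; apply: ler_pM => //; apply: sumr_ge0 => k _; exact: sqr_ge0.
have T1 : 1 <= trilinear_const R 0 by rewrite /trilinear_const expr0; lra.
rewrite leNgt; apply/negP => lt.
have LY0 : 0 <= L4_const * Y ^+ 2 by rewrite mulr_ge0 ?sqr_ge0// /L4_const; lra.
have : (L4_const * Y ^+ 2) ^+ 2 < I4 ^+ 2 by rewrite ltrXn2r//; lra.
rewrite ltNge; move/negP; apply; apply: le_trans cs _.
rewrite (_ : _ * _ = 16 * trilinear_const R 0 * Y ^+ 4); last by ring.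
rewrite (_ : _ ^+ 2 = 16 * trilinear_const R 0 * Y ^+ 4 * trilinear_const R 0); last first.
  by rewrite /L4_const; ring.
by rewrite ler_peMr// !mulr_ge0 ?exprn_ge0// ltW.
Qed.

(** [q] bounds the square of the H^1 norm. Finite boxes avoid any prior discussion of
    summability. *)
Definition h1_bounded u (q : R) :=
  torus_L2 u /\ forall N, \sum_(k <- box N) W k * H u k ^+ 2 <= q.

Lemma h1_bounded_ge0 u q : h1_bounded u q -> 0 <= q.
Proof.
move=> [_ /(_ 0%N)]; apply: le_trans; apply: sumr_ge0 => k _.
by rewrite mulr_ge0 ?sqr_ge0 ?ltW ?sobolev_weight_gt0.
Qed.

Lemma L4_hartley_partial_sum u q N : h1_bounded u q ->
  torus_integral (fun x => hartley_sum (H u) N x ^+ 4) <= L4_const * q ^+ 2.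
Proof.
move=> hu; have q0 := h1_bounded_ge0 hu; case: hu => Lu uq.
apply: le_trans (L4_hartley_sum _ _) _; apply: ler_wpM2l.
  exact: le_trans L4_const_ge1.
rewrite lerXn2r ?nnegrE//; apply: sumr_ge0 => k _.
by rewrite mulr_ge0 ?sqr_ge0 ?ltW ?sobolev_weight_gt0.
Qed.

Lemma torus_integrable_lim_ge0 (F : nat -> R * R -> R) u (C : R) :
  measurable_fun cell u ->
  (forall n, torus_integrable (F n)) -> (forall n x, 0 <= F n x) ->
  (forall x, {homo F ^~ x : n m / (n <= m)%N >-> n <= m}) ->
  (forall x, F ^~ x @ \oo --> u x) ->
  (forall n, torus_integral (F n) <= C) ->
  torus_integrable u /\ torus_integral u <= C.
Proof.
move=> mu_ Fi F0 Fm Fu FC.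
have mE : measurable_fun cell (EFin \o u) by exact/measurable_EFinP.
have u0 x : 0 <= u x.
  by apply: cvgr_to_ge (Fu x) _; apply: nearW => n; exact: F0.
have mF n : measurable_fun cell (EFin \o F n) by apply: measurable_int (Fi n).
have F0' n x : cell x -> (0 <= (EFin \o F n) x)%E by move=> _; rewrite lee_fin.
have Fm' x : cell x -> {homo (fun n => (EFin \o F n) x) : n m / (n <= m)%N >-> (n <= m)%E}.
  by move=> _ n m nm; rewrite lee_fin; exact: Fm.
have E : (\int[mu]_(x in cell) limn (fun n => (EFin \o F n) x) =
    \int[mu]_(x in cell) (EFin \o u) x)%E.
  apply: eq_integral => x _; apply/cvg_lim => //.
  by apply: cvg_EFin (Fu x); exact: nearW.
have := @cvg_monotone_convergence _ _ R mu _ (@measurable_torus_cell R)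
  (fun n => EFin \o F n) mF F0' Fm'.
rewrite E => cvI.
have int_le : (\int[mu]_(x in cell) (EFin \o u) x <= C%:E)%E.
  apply: (cvge_to_le cvI); apply: nearW => n.
  have fin : (\int[mu]_(x in cell) (EFin \o F n) x)%E \is a fin_num.
    by apply: integrable_fin_num (Fi n); exact: measurable_torus_cell.
  by rewrite -(fineK fin) lee_fin; exact: FC.
have int0 : (0 <= \int[mu]_(x in cell) (EFin \o u) x)%E.
  by apply: integral_ge0 => x _; rewrite lee_fin.
have iu : torus_integrable u.
  apply/integrableP; split => //.
  have EN : (\int[mu]_(x in cell) `|(EFin \o u) x| =
      \int[mu]_(x in cell) (EFin \o u) x)%E.
    by apply: eq_integral => x _ /=; rewrite ger0_norm.
  by have : (\int[mu]_(x in cell) `|(EFin \o u) x| < +oo)%E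
    by rewrite EN; exact: le_lt_trans int_le (ltry _).
split => //; rewrite -lee_fin /torus_integral /Rintegral fineK//.
by apply: integrable_fin_num iu; exact: measurable_torus_cell.
Qed.

Definition truncate (M t : R) : R := Num.max (- M) (Num.min t M).

Lemma truncate_bound M t : 0 <= M -> `|truncate M t| <= M.
Proof.
move=> M0; rewrite /truncate ler_norml le_max lexx /= ge_max.
by rewrite ge_min lexx orbT andbT; lra.
Qed.

(* Truncation moves [t] towards [0], hence [(t - m) * m ^+ 3 >= 0]. *)
Lemma truncate_cube M t : 0 <= M -> truncate M t ^+ 4 <= truncate M t ^+ 3 * t.
Proof.
move=> M0; rewrite /truncate; case: (leP t M) => h1.
  case: (leP (- M) t) => h2; first by rewrite -exprSr.
  rewrite exprSr; apply: ler_wnM2l; last exact: ltW.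
  by rewrite (_ : _ ^+ 3 = - (M ^+ 3)) ?oppr_le0 ?exprn_ge0//; ring.
case: (leP (- M) M) => h2; last by lra.
by rewrite exprSr ler_wpM2l ?exprn_ge0// ltW.
Qed.

(** Duality: with [m] the truncation and [p] a partial sum of [u], Young's inequality gives
    [4 m^3 p <= p^4 + 3 m^4]. As [m^3] is bounded, Parseval replaces [p] by [u] on the left after
    integration, and [m^3 u >= m^4]. The integral of [m^4] is finite, so three of its four copies
    cancel; without truncation this cancellation would be circular. *)
Lemma h1_truncate_L4 u q M : 0 <= M -> h1_bounded u q ->
  torus_integral (fun x => truncate M (u x) ^+ 4) <= L4_const * q ^+ 2.
Proof.
move=> M0 hu; have [Lu uq] := hu.
pose m x := truncate M (u x).
have mm : measurable_fun cell m.
  apply: measurable_maxr; first exact: measurable_cst.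
  by apply: measurable_minr; [case: Lu|exact: measurable_cst].
have m_le x : `|m x| <= M by exact: truncate_bound.
have Lm n : torus_L2 (fun x => m x ^+ n).
  apply: (@torus_L2_bounded _ _ (M ^+ n)); first exact: measurable_funX.
  by move=> x _; rewrite normrX lerXn2r// nnegrE.
have im n : torus_integrable (fun x => m x ^+ n).
  apply: (@torus_integrable_bounded _ _ (M ^+ n)); first exact: measurable_funX.
  by move=> x _; rewrite normrX lerXn2r// nnegrE.
have stepN N : 4 * (\sum_(k <- box N) H u k * H (fun x => m x ^+ 3) k) <=
    L4_const * q ^+ 2 + 3 * torus_integral (fun x => m x ^+ 4).
  rewrite -torus_integral_mul_hartley_sum//; set p := hartley_sum (H u) N.
  have ip : torus_integrable (fun x => p x ^+ 4).
    have [_] := hartley_sum_exp_L2 (H u) N 2.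
    by under eq_fun do rewrite -exprM.
  have imp : torus_integrable (fun x => m x ^+ 3 * p x).
    by apply: torus_L2_integrable_mul => //; exact: hartley_sum_L2.
  apply: (@le_trans _ _ (torus_integral (fun x => p x ^+ 4 + 3 * m x ^+ 4))).
    rewrite -torus_integralZ//; apply: le_torus_integral.
    - exact: torus_integrableZ.
    - by apply: torus_integrableD => //; exact: torus_integrableZ.
    - move=> x _; move: (p x) (m x) => a b.
      (* This product is [a^4 - 4 a b^3 + 3 b^4], which proves Young's inequality for odd powers of
         either sign. *)
      have : 0 <= (a - b) ^+ 2 * ((a + b) ^+ 2 + 2 * b ^+ 2).
        apply: mulr_ge0; first exact: sqr_ge0.
        by apply: addr_ge0; [exact: sqr_ge0|rewrite mulr_ge0 ?sqr_ge0].
      by lra.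
  rewrite torus_integralD//; last exact: torus_integrableZ.
  by rewrite torus_integralZ// lerD2r; exact: L4_hartley_partial_sum.
have lim4 : 4 * torus_integral (fun x => u x * m x ^+ 3) <=
    L4_const * q ^+ 2 + 3 * torus_integral (fun x => m x ^+ 4).
  rewrite mulrC -ler_pdivlMr//; apply: (cvgr_to_le (Parseval Lu (Lm 3))).
  by apply: nearW => N; rewrite ler_pdivlMr// mulrC; exact: stepN.
have : torus_integral (fun x => m x ^+ 4) <= torus_integral (fun x => u x * m x ^+ 3).
  apply: le_torus_integral => //; first exact: torus_L2_integrable_mul.
  by move=> x _; rewrite [leRHS]mulrC; exact: truncate_cube.
move: lim4; move: (L4_const * _) (torus_integral _) (torus_integral _) => a b c.
by lra.
Qed.

Lemma truncate_cvg t : (fun n => truncate n%:R t) @ \oo --> t.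
Proof.
apply: cvg_near_cst; near=> n.
have : `|t| <= n%:R by near: n; exact: nbhs_infty_ger.
rewrite ler_norml => /andP[h1 h2]; rewrite /truncate min_l// max_r//.
Unshelve. all: by end_near. Qed.

Lemma h1_L4 u q : h1_bounded u q ->
  torus_integrable (fun x => u x ^+ 4) /\
  torus_integral (fun x => u x ^+ 4) <= L4_const * q ^+ 2.
Proof.
move=> hu; have [[mu_ _] _] := hu.
apply: (@torus_integrable_lim_ge0 (fun n x => truncate n%:R (u x) ^+ 4)).
- exact: measurable_funX.
- move=> n; apply: (@torus_integrable_bounded _ _ (n%:R ^+ 4)).
    apply: measurable_funX; apply: measurable_maxr; first exact: measurable_cst.
    by apply: measurable_minr => //; exact: measurable_cst.
  by move=> x _; rewrite normrX lerXn2r ?nnegrE// truncate_bound.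
- by move=> n x; rewrite exprn_even_ge0.
- move=> x n m nm; rewrite (exprM _ 2 2) (exprM _ 2 2) lerXn2r ?nnegrE ?sqr_ge0//.
  rewrite -(real_normK (num_real (truncate n%:R _))) -(real_normK (num_real (truncate m%:R _))).
  rewrite lerXn2r ?nnegrE//.
  have : n%:R <= m%:R :> R by rewrite ler_nat.
  move: (ler0n R n) (ler0n R m); move: (n%:R : R) (m%:R : R) (u x) => a b t a0 b0 ab.
  rewrite /truncate; case: (leP t a) => h1; case: (leP t b) => h2; try lra.
  + case: (leP (- a) t) => h3; case: (leP (- b) t) => h4; try lra.
      by rewrite [leRHS]ltr0_norm; rewrite ?normrN ?ger0_norm; lra.
    by rewrite !normrN !ger0_norm.
  + case: (leP (- a) a) => h3; case: (leP (- b) t) => h4; try lra.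
    by rewrite !ger0_norm; lra.
  + case: (leP (- a) a) => h3; case: (leP (- b) b) => h4; try lra.
    by rewrite !ger0_norm; lra.
- move=> x; have T := @truncate_cvg (u x); rewrite (exprM _ 2 2) !expr2.
  by under eq_fun do rewrite (exprM _ 2 2) !expr2; do 2 apply: cvgM => //.
- by move=> n; exact: h1_truncate_L4.
Qed.

End SobolevH1.

(** * Frequency bounds for [u ^+ 3 - u] *)

Section Cubic.
Variable R : realType.
Implicit Types (u v : R * R -> R) (k : int * int).

Local Notation mu := (@lebesgue_measure R \x @lebesgue_measure R)%E.
Local Notation cell := (@torus_cell R).
Local Notation H := (@hartley_coef R).
Local Notation W := (@sobolev_weight R).

Lemma cvg_sqr_le (a b : nat -> R) (l C : R) : 0 <= C ->
  (forall N, (l - a N) ^+ 2 <= b N * C) -> b @ \oo --> (0 : R) ->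
  a @ \oo --> l.
Proof.
move=> C0 ab b0; apply/cvgrPdist_lt => e e0.
have C1 : 0 < C + 1 by rewrite ltr_wpDl.
have e2 : 0 < e ^+ 2 / (C + 1) by rewrite divr_gt0 ?exprn_gt0.
move/cvgrPdist_lt : b0 => /(_ _ e2)[N _ NP]; exists N => // M /NP.
rewrite sub0r normrN ltr_pdivlMr// => bM.
rewrite -(@ltr_pXn2r _ 2) ?nnegrE ?normr_ge0 ?(ltW e0)// real_normK ?num_real//.
apply: le_lt_trans (ab M) _; apply: le_lt_trans bM.
apply: le_trans (ler_wpM2r C0 (ler_norm _)) _.
by rewrite mulrDr mulr1 lerDl.
Qed.

Lemma h1_measurable u q : h1_bounded u q -> measurable_fun cell u.
Proof. by case=> -[]. Qed.

Lemma h1_cube_integrable u q : h1_bounded u q -> torus_integrable (fun x => u x ^+ 3).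
Proof.
move=> hu; have [i4 _] := h1_L4 hu.
apply: (torus_integrable_le _ _ (torus_integrableD (torus_integrable_cst 1) i4)).
  by apply: measurable_funX; exact: h1_measurable hu.
move=> x _; rewrite normrX (_ : u x ^+ 4 = `|u x| ^+ 4); last first.
  by rewrite -normrX ger0_norm ?exprn_even_ge0.
have := normr_ge0 (u x); move: `|u x| => t t0.
have [t1|/ltW t1] := leP t 1.
  have : t ^+ 3 <= 1 by rewrite exprn_ile1.
  by have := exprn_ge0 4 t0; lra.
have : 0 <= t ^+ 3 * (t - 1) by rewrite mulr_ge0 ?exprn_ge0// subr_ge0.
by lra.
Qed.

(** Factor [u^3 - p^3 = (u - p) (u^2 + u p + p^2)]. The second factor is bounded in L^2 by the L^4
    bounds on [u] and [p], uniformly in [N], and the first tends to 0 in L^2. *)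
Lemma hartley_coef_cube_cvg u q k : h1_bounded u q ->
  (fun N => H (fun x => hartley_sum (H u) N x ^+ 3) k) @ \oo -->
  H (fun x => u x ^+ 3) k.
Proof.
move=> hu; have [Lu _] := hu; have [i4 I4] := h1_L4 hu.
have C0 : 0 <= L4_const R * q ^+ 2.
  by rewrite mulr_ge0 ?sqr_ge0//; exact: le_trans (L4_const_ge1 R).
apply: (@cvg_sqr_le _ _ _ (4 * (L4_const R * q ^+ 2)) _ _ (hartley_residual_cvg Lu)) => [|N].
  by rewrite mulr_ge0.
set p := hartley_sum (H u) N.
have P4 : torus_integral (fun x => p x ^+ 4) <= L4_const R * q ^+ 2.
  exact: L4_hartley_partial_sum.
have Lp : torus_L2 p by exact: hartley_sum_L2.
have ip4 : torus_integrable (fun x => p x ^+ 4).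
  have [_] := hartley_sum_exp_L2 (H u) N 2.
  by under eq_fun do rewrite -exprM.
have ip3 : torus_integrable (fun x => p x ^+ 3).
  have := torus_L2_integrable_mul (hartley_sum_exp_L2 (H u) N 2) Lp.
  by under eq_fun do rewrite -exprSr.
have iu3 := h1_cube_integrable hu.
have mu_ := h1_measurable hu; have mp : measurable_fun cell p by case: Lp.
have mh := @measurable_hartley R k; have hb := @hartley_bounded R k.
pose z x := (u x ^+ 2 + u x * p x + p x ^+ 2) * hartley k x.
have mz : measurable_fun cell z.
  apply: measurable_funM mh; apply: measurable_funD; last exact: measurable_funX.
  by apply: measurable_funD; [exact: measurable_funX|exact: measurable_funM].
have z2 x : z x ^+ 2 <= 2 * (u x ^+ 4 + p x ^+ 4).
  rewrite /z exprMn; have : hartley k x ^+ 2 <= 2^-1 ^+ 2.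
    by rewrite -(real_normK (num_real (hartley k x))) lerXn2r ?nnegrE// hb.
  have := sqr_ge0 (hartley k x).
  move: (hartley k x ^+ 2) (u x) (p x) => h a b h0 h1.
  have s0 : (a ^+ 2 + a * b + b ^+ 2) ^+ 2 <= 8 * (a ^+ 4 + b ^+ 4).
    have := sqr_ge0 (a ^+ 2 - b ^+ 2); have := sqr_ge0 (a ^+ 2 - a * b).
    have := sqr_ge0 (b ^+ 2 - a * b); have := sqr_ge0 (a ^+ 2).
    by have := sqr_ge0 (b ^+ 2); lra.
  apply: (@le_trans _ _ (8 * (a ^+ 4 + b ^+ 4) * 2^-1 ^+ 2)); last first.
    by rewrite (_ : 2^-1 ^+ 2 = 1 / 4 :> R); [lra|field].
  by apply: ler_pM => //; exact: sqr_ge0.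
have i24 : torus_integrable (fun x => 2 * (u x ^+ 4 + p x ^+ 4)).
  by apply: torus_integrableZ; exact: torus_integrableD.
have Lz : torus_L2 z.
  split=> //; apply: (torus_integrable_le _ _ i24); first exact: measurable_funX.
  by move=> x _; rewrite ger0_norm ?sqr_ge0.
have Iz : torus_integral (fun x => z x ^+ 2) <= 4 * (L4_const R * q ^+ 2).
  apply: (@le_trans _ _ (torus_integral (fun x => 2 * (u x ^+ 4 + p x ^+ 4)))).
    by apply: le_torus_integral => //; case: Lz.
  rewrite torus_integralZ; last exact: torus_integrableD.
  rewrite torus_integralD//; move: I4 P4.
  by move: (torus_integral _) (torus_integral _) (L4_const R * _) => a b d; lra.
have -> : H (fun x => u x ^+ 3) k - H (fun x => p x ^+ 3) k =
    torus_integral (fun x => (u x - p x) * z x).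
  rewrite /hartley_coef -torus_integralB.
  - by apply: eq_torus_integral => x _; rewrite /z; ring.
  - exact: (torus_integrable_mul_bounded iu3 mh hb).
  - exact: (torus_integrable_mul_bounded ip3 mh hb).
apply: le_trans (torus_CauchySchwarz (torus_L2B Lu Lp) Lz) _.
apply: ler_wpM2l Iz; apply: torus_integral_ge0 => x _; exact: sqr_ge0.
Qed.

Lemma h1_trilinear n u q (X : R) M : h1_bounded u q ->
  (forall N, \sum_(k <- box N) W k ^+ n.+1 * H u k ^+ 2 <= X) ->
  \sum_(k <- box M) W k ^+ n * H (fun x => u x ^+ 3) k ^+ 2 <=
  16 * trilinear_const R n * X * q ^+ 2.
Proof.
move=> hu uX; have [_ uq] := hu; have q0 := h1_bounded_ge0 hu.
have W0 k j : 0 <= W k ^+ j by rewrite exprn_ge0 ?ltW ?sobolev_weight_gt0.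
have cv : (fun N => \sum_(k <- box M) W k ^+ n *
     H (fun x => hartley_sum (H u) N x ^+ 3) k ^+ 2) @ \oo -->
    \sum_(k <- box M) W k ^+ n * H (fun x => u x ^+ 3) k ^+ 2.
  apply: cvg_big => [|k _]; first exact: add_continuous.
  apply: cvgM; first exact: cvg_cst.
  have h := @hartley_coef_cube_cvg u q k hu.
  by rewrite expr2; under eq_fun do rewrite expr2; exact: cvgM.
apply: (cvgr_to_le cv); apply: nearW => N.
apply: le_trans (trilinear_hartley_sum _ _ _ _) _.
have T0 := ltW (trilinear_const_gt0 R n).
apply: ler_pM => //.
- by rewrite !mulr_ge0//; apply: sumr_ge0 => k _; rewrite mulr_ge0 ?sqr_ge0.
- exact: sqr_ge0.
- by apply: ler_wpM2l (uX N); rewrite mulr_ge0.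
- rewrite lerXn2r ?nnegrE//; apply: sumr_ge0 => k _.
  by rewrite mulr_ge0 ?sqr_ge0 ?ltW ?sobolev_weight_gt0.
Qed.

Definition nonlinear_coef u k := H (fun x => u x ^+ 3 - u x) k.

Lemma nonlinear_coefE u q k : h1_bounded u q ->
  nonlinear_coef u k = H (fun x => u x ^+ 3) k - H u k.
Proof.
move=> hu; have [Lu _] := hu.
rewrite /nonlinear_coef /hartley_coef -torus_integralB.
- by apply: eq_torus_integral => x _; rewrite mulrBl.
- exact: (torus_integrable_mul_bounded (h1_cube_integrable hu)
    (measurable_hartley k) (hartley_bounded k)).
- exact: integrable_mul_hartley.
Qed.

(** Splitting [(a - b)^2 <= 2 a^2 + 2 b^2] doubles the cubic constant 16 and adds 2 for the linear
    term, which is estimated with one weight to spare. *)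
Definition cubic_const n (q : R) : R := 32 * trilinear_const R n * q ^+ 2 + 2.

Lemma cubic_const_ge2 n q : 2 <= cubic_const n q.
Proof.
rewrite lerDr; apply: mulr_ge0 (sqr_ge0 _); apply: mulr_ge0 => //.
exact: ltW (trilinear_const_gt0 R n).
Qed.

Lemma nonlinear_coef_bound n u q (X : R) M : h1_bounded u q ->
  (forall N, \sum_(k <- box N) W k ^+ n.+1 * H u k ^+ 2 <= X) ->
  \sum_(k <- box M) W k ^+ n * nonlinear_coef u k ^+ 2 <= cubic_const n q * X.
Proof.
move=> hu uX; have W0 k j : 0 <= W k ^+ j by rewrite exprn_ge0 ?ltW ?sobolev_weight_gt0.
apply: (@le_trans _ _ (2 * (\sum_(k <- box M) W k ^+ n * H (fun x => u x ^+ 3) k ^+ 2) +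
    2 * (\sum_(k <- box M) W k ^+ n.+1 * H u k ^+ 2))).
  rewrite !mulr_sumr -big_split; apply: ler_sum => k _ /=.
  rewrite (nonlinear_coefE k hu); have w0 := W0 k n.
  have := sobolev_weight_ge1 R k; rewrite (exprS (W k) n).
  move: (H _ k) (H _ k) (W k) (W k ^+ n) w0 => b a y w w0 y1.
  have h1 : w * (a - b) ^+ 2 <= 2 * (w * a ^+ 2) + 2 * (w * b ^+ 2).
    rewrite -subr_ge0 (_ : _ - _ = w * (a + b) ^+ 2); last by ring.
    by rewrite mulr_ge0 ?sqr_ge0.
  have h2 : w * b ^+ 2 <= y * w * b ^+ 2.
    by rewrite ler_wpM2r ?sqr_ge0// ler_peMl.
  by lra.
have hB := uX M; have hA := h1_trilinear M hu uX.
apply: le_trans (lerD (ler_wpM2l (ler0n R 2) hA) (ler_wpM2l (ler0n R 2) hB)) _.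
rewrite le_eqVlt; apply/orP; left; apply/eqP; rewrite /cubic_const.
by move: (trilinear_const R n) => T; ring.
Qed.

End Cubic.

(** * One step of the scheme in frequency space *)

Section SplittingStep.
Variable R : realType.
Implicit Types (u v w : R * R -> R) (d : int * int -> R) (k : int * int).

Local Notation cell := (@torus_cell R).
Local Notation H := (@hartley_coef R).
Local Notation W := (@sobolev_weight R).

Lemma cvg_nonneg_box_sum (g : int * int -> R) (B : R) : (forall k, 0 <= g k) ->
  (forall N, \sum_(k <- box N) g k <= B) -> cvgn (fun N => \sum_(k <- box N) g k).
Proof.
move=> g0 gB; apply: nondecreasing_is_cvgn.
  by move=> N M NM; exact: le_sum_box.
by exists B => _ [N _ <-]; exact: gB.
Qed.

(** Absolute convergence along boxes reduces to monotone convergence: the series is the difference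
    of two series with nonnegative terms, [|d| + d h] and [|d|]. *)
Lemma hartley_series_cvg d (B : R) x : (forall N, \sum_(k <- box N) `|d k| <= B) ->
  cvgn (fun N => hartley_sum d N x).
Proof.
move=> dB.
have dh k : `|d k * hartley k x| <= `|d k|.
  rewrite normrM -[leRHS]mulr1; apply: ler_wpM2l => //.
  by apply: le_trans (hartley_bounded k x) _; rewrite invf_le1// ler1n.
have c1 : cvgn (fun N => \sum_(k <- box N) (`|d k| + d k * hartley k x)).
  apply: (@cvg_nonneg_box_sum _ (2 * B)) => [k|N].
    by have := dh k; rewrite ler_norml => /andP[h _]; lra.
  apply: (@le_trans _ _ (2 * \sum_(k <- box N) `|d k|)); last by rewrite ler_wpM2l.
  rewrite mulr_sumr; apply: ler_sum => k _.
  by have := dh k; rewrite ler_norml => /andP[_ h]; lra.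
have c2 : cvgn (fun N => \sum_(k <- box N) `|d k|).
  by apply: (@cvg_nonneg_box_sum _ B).
rewrite (_ : (fun N => hartley_sum d N x) =
  (fun N => \sum_(k <- box N) (`|d k| + d k * hartley k x)) -
  (fun N => \sum_(k <- box N) `|d k|)); first exact: is_cvgB c1 c2.
by apply/funext => N; rewrite !fctE big_split /= addrAC subrr add0r.
Qed.

Definition hartley_series d (x : R * R) : R := limn (fun N => hartley_sum d N x).

Section AbsolutelyConvergent.
Variables (d : int * int -> R) (B : R).
Hypothesis dB : forall N, \sum_(k <- box N) `|d k| <= B.

Lemma hartley_sum_cvg x : (fun N => hartley_sum d N x) @ \oo --> hartley_series d x.
Proof. exact: hartley_series_cvg dB. Qed.

Lemma hartley_series_bounded x : `|hartley_series d x| <= B.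
Proof.
apply: (cvgr_to_le (cvg_norm (@hartley_sum_cvg x))); apply: nearW => N.
exact: le_trans (hartley_sum_bounded d N x) (dB N).
Qed.

Lemma measurable_hartley_series : measurable_fun cell (hartley_series d).
Proof.
apply: (measurable_fun_cvg (h := fun N => hartley_sum d N)).
  by move=> N; exact: measurable_hartley_sum.
by move=> x _; exact: hartley_sum_cvg.
Qed.

Lemma hartley_series_L2 : torus_L2 (hartley_series d).
Proof.
by apply: (torus_L2_bounded measurable_hartley_series) => x _; exact: hartley_series_bounded.
Qed.

Lemma hartley_coef_series k : H (hartley_series d) k = d k.
Proof.
have cv : (fun N => H (hartley_sum d N) k) @ \oo --> H (hartley_series d) k.
  apply: (torus_integral_dominated (g := fun=> B * 2^-1) (N := set0)).
  - by move=> N; apply: measurable_funM; [exact: measurable_hartley_sum|exact: measurable_hartley].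
  - by apply: measurable_funM; [exact: measurable_hartley_series|exact: measurable_hartley].
  - exact: torus_integrable_cst.
  - move=> N x _; rewrite normrM; apply: ler_pM => //; last exact: hartley_bounded.
    exact: le_trans (hartley_sum_bounded d N x) (dB N).
  - exact: negligible_set0.
  - by move=> x _ _; apply: cvgM; [exact: hartley_sum_cvg|exact: cvg_cst].
have cvd : (fun N => H (hartley_sum d N) k) @ \oo --> d k.
  apply: cvg_near_cst; have [N kN] := subset_box [:: k]; exists N => // M /= NM.
  by rewrite hartley_coef_sum (box_subset NM)// kN// mem_head.
exact: (cvg_unique _ cv cvd).
Qed.

Lemma hartley_series_periodic : torus_periodic (hartley_series d).
Proof.
have per (x y : R * R) :
    (forall k, exists m : int, wave_dot k y = wave_dot k x + m%:~R * (2 * pi)) ->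
    hartley_series d y = hartley_series d x.
  move=> xy; congr (limn _); apply/funext => N; apply: eq_bigr => k _.
  by rewrite /hartley; have [m ->] := xy k; rewrite sinD2pi_int cosD2pi_int.
move=> [x1 x2]; split; apply: per => k.
  by exists k.1; rewrite /wave_dot /=; ring.
by exists k.2; rewrite /wave_dot /=; ring.
Qed.

End AbsolutelyConvergent.

Lemma derive2_cos (m c : R) :
  derive1n 2 (fun s => cos (m * s + c)) = fun s => - m ^+ 2 * cos (m * s + c).
Proof.
have d1 : derive1 (fun s => cos (m * s + c)) = fun s => - m * sin (m * s + c).
  apply/funext => s; rewrite derive1E.
  have h : is_derive s (1 : R) (fun s => cos (m * s + c)) (- m * sin (m * s + c)).
    apply: is_derive_eq; rewrite /GRing.scale /= !(mulr1, mulr0, addr0, add0r).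
    by ring.
  exact: derive_val.
rewrite derive1nS derive1n1 d1; apply/funext => s; rewrite derive1E.
have h : is_derive s (1 : R) (fun s => - m * sin (m * s + c)) (- m ^+ 2 * cos (m * s + c)).
  apply: is_derive_eq; rewrite /GRing.scale /= !(mulr1, mulr0, addr0, add0r).
  by ring.
exact: derive_val.
Qed.

Lemma laplacian_cos_wave k (t : R) :
  laplacian (fun x => cos (wave_dot k x + t)) =
  fun x => - @wave_normsq R k * cos (wave_dot k x + t).
Proof.
apply/funext => -[x1 x2].
transitivity (derive1n 2 (fun s => cos (wave_dot k (s, x2) + t)) x1 +
  derive1n 2 (fun s => cos (wave_dot k (x1, s) + t)) x2); first by [].
rewrite (_ : (fun s => cos (wave_dot k (s, x2) + t)) =
  fun s => cos (k.1%:~R * s + (k.2%:~R * x2 + t))); last first.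
  by apply/funext => s; rewrite /wave_dot /= addrA.
rewrite (_ : (fun s => cos (wave_dot k (x1, s) + t)) =
  fun s => cos (k.2%:~R * s + (k.1%:~R * x1 + t))); last first.
  by apply/funext => s; rewrite /wave_dot /=; congr cos; ring.
rewrite !derive2_cos /wave_normsq /wave_dot /= !addrA.
rewrite (addrC (k.2%:~R * x2) (k.1%:~R * x1)); ring.
Qed.

Let laplacian_cos k : laplacian (fun x => cos (wave_dot k x)) =
  fun x => - @wave_normsq R k * cos (wave_dot k x).
Proof.
have := laplacian_cos_wave k 0; under eq_fun do rewrite addr0.
by move=> ->; apply/funext => x; rewrite addr0.
Qed.

Let laplacian_sin k : laplacian (fun x => sin (wave_dot k x)) =
  fun x => - @wave_normsq R k * sin (wave_dot k x).
Proof.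
have := laplacian_cos_wave k (- (pi / 2)); under eq_fun do rewrite cosBpihalf.
by move=> ->; apply/funext => x; rewrite cosBpihalf.
Qed.

Definition step_coef (nu tau : R) w k : R :=
  expR (- (tau * nu * @wave_normsq R k ^+ 2)) *
  (H w k - tau * @wave_normsq R k * nonlinear_coef w k).

Lemma sum_box_odd (g : int * int -> R) N : (forall k, g (- k) = - g k) ->
  \sum_(k <- box N) g k = 0.
Proof.
move=> gN; have := sum_box_opp N g; under eq_bigr do rewrite gN.
by rewrite sumrN; move: (\sum_(k <- _) _) => a; lra.
Qed.

(** In terms of the cosine and sine pairings [Tc] (even in [k]) and [Ts] (odd in [k]), the real part
    of a Fourier summand is a multiple of [Tc cos + Ts sin]. The Hartley summand has the additional
    terms [Tc sin + Ts cos], which are odd and cancel over a symmetric box, because the multiplier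
    is even. *)
Lemma S_L_S_N nu tau w q : h1_bounded w q ->
  S_L nu tau (S_N tau w) = hartley_series (step_coef nu tau w).
Proof.
move=> hw; apply/funext => x; rewrite /S_L /hartley_series; congr (limn _).
apply/funext => N.
have -> : @freq_box N = [set` box N].
  apply/seteqP; split => k /=; first by rewrite mem_box => -[-> ->].
  by rewrite mem_box => /andP[].
rewrite -fsbig_seq ?uniq_box//.
have [Lw _] := hw; have iw := torus_L2_integrable Lw.
have iF : torus_integrable (fun x => w x ^+ 3 - w x).
  by apply: torus_integrableB => //; exact: h1_cube_integrable hw.
set Tc := fun k => S_N tau w (fun x => cos (wave_dot k x)).
set Ts := fun k => S_N tau w (fun x => sin (wave_dot k x)).
have TcE k : Tc k = torus_integral (fun x => w x * cos (wave_dot k x)) -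
    tau * @wave_normsq R k * torus_integral (fun x => (w x ^+ 3 - w x) * cos (wave_dot k x)).
  rewrite /Tc /S_N /distribution_laplacian laplacian_cos /regular_distribution.
  have [iFc _] := torus_integrable_mul_wave k iF.
  rewrite [X in tau * X](_ : _ = - @wave_normsq R k *
    torus_integral (fun x => (w x ^+ 3 - w x) * cos (wave_dot k x))); first by ring.
  by rewrite -torus_integralZ//; apply: eq_torus_integral => y _; ring.
have TsE k : Ts k = torus_integral (fun x => w x * sin (wave_dot k x)) -
    tau * @wave_normsq R k * torus_integral (fun x => (w x ^+ 3 - w x) * sin (wave_dot k x)).
  rewrite /Ts /S_N /distribution_laplacian laplacian_sin /regular_distribution.
  have [_ iFs] := torus_integrable_mul_wave k iF.
  rewrite [X in tau * X](_ : _ = - @wave_normsq R k *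
    torus_integral (fun x => (w x ^+ 3 - w x) * sin (wave_dot k x))); first by ring.
  by rewrite -torus_integralZ//; apply: eq_torus_integral => y _; ring.
have TcN k : Tc (- k) = Tc k.
  rewrite /Tc (_ : (fun x => cos (wave_dot (- k) x)) = fun x => cos (wave_dot k x))//.
  by apply/funext => y; rewrite wave_dotN cosN.
have TsN k : Ts (- k) = - Ts k.
  rewrite !TsE wave_normsqN.
  have sN (v : R * R -> R) : torus_integrable v ->
      torus_integral (fun x => v x * sin (wave_dot (- k) x)) =
      - torus_integral (fun x => v x * sin (wave_dot k x)).
    move=> iv; have [_ ivs] := torus_integrable_mul_wave k iv.
    rewrite -[RHS]mulN1r -torus_integralZ//; apply: eq_torus_integral => y _.
    by rewrite wave_dotN sinN; ring.
  by rewrite !sN//; ring.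
pose e k := expR (- (tau * nu * @wave_normsq R k ^+ 2)).
have eN k : e (- k) = e k by rewrite /e wave_normsqN.
transitivity (\sum_(k <- box N) ((2 * pi)^-1 ^+ 2 * e k *
    (Tc k * cos (wave_dot k x) + Ts k * sin (wave_dot k x)))).
  have ReD : {morph @complex.Re R : y z / y + z} by case=> ? ? [].
  have Re0 : @complex.Re R 0 = 0 by [].
  rewrite mulr_sumr (big_morph _ ReD Re0).
  apply: eq_bigr => k _; rewrite /distribution_fourier -/(Tc k) -/(Ts k) -/(e k) /=.
  by ring.
transitivity (\sum_(k <- box N) ((2 * pi)^-1 ^+ 2 * e k *
    (Tc k * cos (wave_dot k x) + Ts k * sin (wave_dot k x)) +
    (2 * pi)^-1 ^+ 2 * e k *
    (Tc k * sin (wave_dot k x) + Ts k * cos (wave_dot k x)))).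
  rewrite big_split /= [X in _ = _ + X]sum_box_odd ?addr0// => k.
  by rewrite eN TcN TsN wave_dotN sinN cosN; ring.
apply: eq_bigr => k _; rewrite /step_coef -/(e k) /nonlinear_coef !hartley_coefE//.
by rewrite TcE TsE /hartley; ring.
Qed.

End SplittingStep.

(** * Estimates at a single frequency *)

Section ScalarStep.
Variable R : realType.
Variables (nu tau : R).
Hypotheses (nu0 : 0 < nu) (tau0 : 0 < tau).
Implicit Types (a g n : R).

Lemma expR_ge_quadratic (y : R) : 0 <= y -> 1 + y + y ^+ 2 / 4 <= expR y.
Proof.
move=> y0; have -> : 1 + y + y ^+ 2 / 4 = (1 + y / 2) ^+ 2 by field.
have -> : expR y = expR (y / 2) ^+ 2.
  by rewrite expr2 -expRD; congr expR; field.
rewrite lerXn2r ?nnegrE ?expR_ge0 ?expR_ge1Dx//.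
by rewrite addr_ge0// divr_ge0.
Qed.

Definition damping n := tau * nu * n ^+ 2.
Local Notation y := damping.

Definition scalar_step n a g := expR (- y n) * (a - tau * n * g).

(* Density of the modified Dirichlet energy: it tends to [nu * n] as [tau -> 0]. *)
Definition energy_weight n := (expR (y n) - 1) / (tau * n).

Lemma damping_ge0 n : 0 <= y n.
Proof. by rewrite mulr_ge0 ?sqr_ge0// mulr_ge0// ltW. Qed.

Lemma energy_weight0 : energy_weight 0 = 0.
Proof. by rewrite /energy_weight mulr0 invr0 mulr0. Qed.

Lemma energy_weight_ge n : 0 <= n -> nu * n <= energy_weight n.
Proof.
rewrite le_eqVlt => /predU1P[<-|n0]; first by rewrite energy_weight0 mulr0.
rewrite ler_pdivlMr ?mulr_gt0// lerBrDl.
have -> : 1 + nu * n * (tau * n) = 1 + y n by rewrite /y; ring.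
exact: expR_ge1Dx.
Qed.

Lemma energy_weight_ge0 n : 0 <= n -> 0 <= energy_weight n.
Proof. by move=> n0; apply: le_trans (energy_weight_ge n0); rewrite mulr_ge0// ltW. Qed.

Let Z n := expR (- y n).

Let Z_gt0 n : 0 < Z n. Proof. exact: expR_gt0. Qed.

Let ZX n : Z n * expR (y n) = 1. Proof. by rewrite /Z expRN mulVf// gt_eqF ?expR_gt0. Qed.

Let Z_damp n : (1 + y n) * Z n <= 1.
Proof.
by rewrite -[leRHS](ZX n) mulrC ler_wpM2l ?(ltW (Z_gt0 n)) ?expR_ge1Dx.
Qed.

Let Z_le1 n : Z n <= 1.
Proof. by have := Z_damp n; have := mulr_ge0 (damping_ge0 n) (ltW (Z_gt0 n)); lra. Qed.

Let yZ n : y n * Z n <= 1.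
Proof. by have := Z_damp n; have := ltW (Z_gt0 n); lra. Qed.

Let y2Z n : y n ^+ 2 * Z n <= 4.
Proof.
have : (1 + y n + y n ^+ 2 / 4) * Z n <= 1.
  rewrite -[leRHS](ZX n) mulrC ler_wpM2l ?(ltW (Z_gt0 n))//.
  by apply: expR_ge_quadratic; exact: damping_ge0.
have := mulr_ge0 (damping_ge0 n) (ltW (Z_gt0 n)); have := ltW (Z_gt0 n).
by move: (y n) (Z n) => z t; lra.
Qed.

Let XZ n : (expR (y n) - 1) * Z n <= y n.
Proof.
rewrite mulrBl mul1r mulrC ZX; have := expR_ge1Dx (- y n); rewrite -/(Z n).
by move: (y n) (Z n) => z t; lra.
Qed.

Lemma damping_expR_le1 n : 0 <= n -> tau * n * expR (- y n) * (nu * n) <= 1.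
Proof.
by move=> n0; rewrite [leLHS](_ : _ = y n * Z n) ?yZ//; rewrite /Z /y; ring.
Qed.

(** The exponential absorbs [1 + y], and what is left is a perfect square: [(1 + y) (a^2 + (tau /
    nu) g^2) - (a - tau n g)^2 = (tau / nu) (nu n a + g)^2]. The coefficient 1 of [a^2] is what
    allows iteration. *)
Lemma scalar_step_contraction n a g :
  (1 + y n) * scalar_step n a g ^+ 2 <= a ^+ 2 + tau / nu * g ^+ 2.
Proof.
have y1 : 0 < 1 + y n by have := damping_ge0 n; lra.
rewrite -(ler_pM2l y1) /scalar_step -/(Z n).
apply: (@le_trans _ _ ((a - tau * n * g) ^+ 2)).
  rewrite [leLHS](_ : _ = ((1 + y n) * Z n) ^+ 2 * (a - tau * n * g) ^+ 2); last by ring.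
  rewrite ler_piMl ?sqr_ge0// exprn_ile1//.
  by rewrite mulr_ge0 ?ltW.
rewrite -subr_ge0 (_ : _ - _ = tau / nu * (nu * n * a + g) ^+ 2).
  by rewrite mulr_ge0 ?sqr_ge0// divr_ge0 ?ltW.
by rewrite /y; field; rewrite gt_eqF.
Qed.

Let sqrB_le a b : (a - b) ^+ 2 <= 2 * a ^+ 2 + 2 * b ^+ 2 :> R.
Proof. by have := sqr_ge0 (a + b); lra. Qed.

(** The counterpart for a single use: the factor 2 on [a^2] forbids iteration, but the source gains
    [n^(-2)] with a constant free of [tau], from [y^2 exp (- y) <= 4]. *)
Lemma scalar_step_smoothing n a g : 0 < n ->
  (1 + y n) * scalar_step n a g ^+ 2 <=
  2 * a ^+ 2 + 8 / (nu ^+ 2 * n ^+ 2) * g ^+ 2.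
Proof.
move=> n0; rewrite /scalar_step -/(Z n); have Z0 := ltW (Z_gt0 n).
apply: (@le_trans _ _ (Z n * (2 * a ^+ 2 + 2 * (tau * n * g) ^+ 2))).
  apply: (@le_trans _ _ (Z n * (a - tau * n * g) ^+ 2)); last by rewrite ler_wpM2l.
  rewrite [leLHS](_ : _ = ((1 + y n) * Z n) * (Z n * (a - tau * n * g) ^+ 2)); last by ring.
  by rewrite ler_piMl// mulr_ge0 ?sqr_ge0.
rewrite mulrDr; apply: lerD.
  by rewrite ler_piMl// mulr_ge0 ?sqr_ge0.
rewrite [leLHS](_ : _ = 2 / (nu ^+ 2 * n ^+ 2) * g ^+ 2 * (y n ^+ 2 * Z n)); last first.
  by rewrite /y; field; rewrite !gt_eqF.
rewrite [leRHS](_ : _ = 2 / (nu ^+ 2 * n ^+ 2) * g ^+ 2 * 4); last first.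
  by field; rewrite !gt_eqF.
rewrite ler_wpM2l//; apply: mulr_ge0 (sqr_ge0 _).
by rewrite divr_ge0// mulr_ge0 ?sqr_ge0.
Qed.

(** The weight grows like [exp y], but the square of the step carries [exp (- 2 y)]. One exponential
    lowers the weight to [y / (tau n) = nu n]; the other bounds [y^2 exp (- y)] by 4 in the source
    term. Finally [1 <= n] removes a factor [1 / n]. *)
Lemma scalar_step_energy_smoothing n a g : 1 <= n ->
  energy_weight n * scalar_step n a g ^+ 2 <=
  2 * nu * (n * a ^+ 2) + 8 / nu * g ^+ 2.
Proof.
move=> n1; have n0 : 0 < n by lra.
have tn : 0 < tau * n by rewrite mulr_gt0.
have Z0 := ltW (Z_gt0 n); have y0 := damping_ge0 n.
rewrite /energy_weight mulrAC ler_pdivrMr// /scalar_step -/(Z n).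
apply: (@le_trans _ _ (y n * Z n * (2 * a ^+ 2 + 2 * (tau * n * g) ^+ 2))).
  apply: (@le_trans _ _ (y n * Z n * (a - tau * n * g) ^+ 2)); last first.
    exact: (ler_wpM2l (mulr_ge0 y0 Z0) (sqrB_le _ _)).
  rewrite [leLHS](_ : _ = ((expR (y n) - 1) * Z n) * (Z n * (a - tau * n * g) ^+ 2)); last first.
    by ring.
  rewrite -[leRHS]mulrA; apply: ler_wpM2r (XZ n).
  exact: mulr_ge0 Z0 (sqr_ge0 _).
rewrite mulrDr [leRHS]mulrDl; apply: lerD.
  rewrite [leRHS](_ : _ = y n * (2 * a ^+ 2)); last by rewrite /y; ring.
  apply: ler_wpM2r; first by rewrite mulr_ge0 ?sqr_ge0.
  by rewrite ler_piMr.
apply: (@le_trans _ _ (8 * tau / nu * g ^+ 2)).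
  rewrite [leLHS](_ : _ = 2 * tau / nu * g ^+ 2 * (y n ^+ 2 * Z n)); last first.
    by rewrite /y; field; rewrite gt_eqF.
  rewrite [leRHS](_ : _ = 2 * tau / nu * g ^+ 2 * 4); last first.
    by field; rewrite gt_eqF.
  rewrite ler_wpM2l//; apply: mulr_ge0 (sqr_ge0 _).
  by rewrite divr_ge0 ?mulr_ge0 ?ltW.
rewrite [leRHS](_ : _ = 8 * tau / nu * g ^+ 2 * n); last by ring.
rewrite ler_peMr//; apply: mulr_ge0 (sqr_ge0 _).
by rewrite divr_ge0 ?mulr_ge0 ?ltW.
Qed.

Variable lam : R.
Hypotheses (lam0 : 0 < lam) (lam4 : lam ^+ 4 = tau * nu).

Lemma scalar_step_energy n a g : 0 <= n ->
  let d := scalar_step n a g in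
  (n = 0 -> d = a) /\
  (0 < n -> energy_weight n / 2 * d ^+ 2 <= energy_weight n / 2 * a ^+ 2 -
    g * (d - a) - nu / lam ^+ 2 * (d - a) ^+ 2).
Proof.
move=> n0 /=; split=> [->|{}n0].
  by rewrite /scalar_step /y expr0n /= !mulr0 mul0r subr0 oppr0 expR0 mul1r.
set d := scalar_step n a g; set m := energy_weight n.
have Xd : expR (y n) * d = a - tau * n * g.
  by rewrite /d /scalar_step -/(Z n) mulrA [_ * Z n]mulrC ZX mul1r.
have tn : tau * n != 0 by rewrite gt_eqF ?mulr_gt0.
have md : m * d = - g - (d - a) / (tau * n).
  rewrite /m /energy_weight mulrAC mulrBl mul1r Xd.
  by move: tn; rewrite mulf_eq0 negb_or => /andP[t0 nn0]; field; rewrite ?t0 ?nn0.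
have -> : m / 2 * d ^+ 2 = m / 2 * a ^+ 2 + (m * d) * (d - a) - m / 2 * (d - a) ^+ 2.
  by field.
(* With [t = lam^2 n] and [m >= nu n], the difference is at least a positive multiple of
   [1 - t + t^2 / 2]. The bound is uniform in [n]: low frequencies are served by [1 / (tau n)], high
   ones by the energy weight. *)
have key : nu / lam ^+ 2 <= (tau * n)^-1 + m / 2.
  have tE : (tau * n)^-1 = nu / (lam ^+ 4 * n).
    rewrite lam4; move: tn; rewrite mulf_eq0 negb_or => /andP[t0 nn0].
    by field; rewrite ?t0 ?nn0 ?(gt_eqF nu0).
  apply: (@le_trans _ _ ((tau * n)^-1 + nu * n / 2)); last first.
    by rewrite lerD2l ler_pM2r ?invr_gt0//; apply: energy_weight_ge; exact: ltW.
  rewrite tE -subr_ge0 (_ : _ - _ = nu / (lam ^+ 4 * n) *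
    ((lam ^+ 2 * n - 1) ^+ 2 / 2 + 1 / 2)); last by field; rewrite !gt_eqF.
  apply: mulr_ge0; first by rewrite ltW// divr_gt0// mulr_gt0// exprn_gt0.
  by have := sqr_ge0 (lam ^+ 2 * n - 1); lra.
rewrite md; have := ler_wpM2r (sqr_ge0 (d - a)) key.
rewrite (_ : (- g - (d - a) / (tau * n)) * (d - a) =
  - g * (d - a) - (tau * n)^-1 * (d - a) ^+ 2); last by ring.
move: ((tau * n)^-1) (nu / lam ^+ 2) => p1 p2; lra.
Qed.

(* Interpolation between [nu * n] and the damping part of the weight. *)
Lemma energy_weight_three_half n s : 0 < s -> s ^+ 2 = n ->
  nu * lam * s ^+ 3 <= energy_weight n.
Proof.
move=> s0 sn; have n0 : 0 < n by rewrite -sn exprn_gt0.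
rewrite /energy_weight ler_pdivlMr ?mulr_gt0//.
have X := expR_ge_quadratic (damping_ge0 n).
apply: (@le_trans _ _ (y n + y n ^+ 2 / 4)); last by lra.
have yE : y n = (lam * s) ^+ 4 by rewrite /y -sn -lam4; ring.
rewrite [leLHS](_ : _ = (lam * s) ^+ 5); last first.
  rewrite -sn (_ : _ * (tau * _) = (tau * nu) * (lam * s ^+ 5)); last by ring.
  by rewrite -lam4; ring.
rewrite yE; have : 0 < lam * s by rewrite mulr_gt0.
move: (lam * s) => r r0.
have r4 : 0 <= r ^+ 4 by rewrite exprn_ge0// ltW.
rewrite (_ : r ^+ 5 = r ^+ 4 * r); last by ring.
rewrite (_ : r ^+ 4 + _ = r ^+ 4 * (1 + r ^+ 4 / 4)); last by ring.
rewrite ler_wpM2l//; have := sqr_ge0 (r - 1); have := sqr_ge0 (r ^+ 2 - 1).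
by lra.
Qed.

End ScalarStep.

(** * Energy decay and the uniform H^1 bound *)

Section EnergyStability.
Variable R : realType.
Implicit Types (u v w : R * R -> R) (k : int * int).

Local Notation cell := (@torus_cell R).
Local Notation H := (@hartley_coef R).
Local Notation W := (@sobolev_weight R).
Local Notation nsq := (@wave_normsq R).

Variables (nu tau : R).
Hypotheses (nu0 : 0 < nu) (tau0 : 0 < tau).

Definition splitting_step w := S_L nu tau (S_N tau w).
Local Notation step := splitting_step.
Local Notation d := (step_coef nu tau).
Local Notation m := (energy_weight nu tau).

Lemma step_coef_scalar w k :
  d w k = scalar_step nu tau (nsq k) (H w k) (nonlinear_coef w k).
Proof. by []. Qed.

Lemma inv_weight_pow4 k : (W k)^-1 ^+ 2 <= inv_weight R k ^+ 3.
Proof.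
rewrite -inv_weight_sqr -exprM; apply: ler_wiXn2l => //; first exact: inv_weight_ge0.
exact: inv_weight_le1.
Qed.

Lemma sum_weight_inv2 N : \sum_(k <- box N) (W k)^-1 ^+ 2 <= 49.
Proof.
apply: le_trans (sum_inv_weight3 R N); apply: ler_sum => k _; exact: inv_weight_pow4.
Qed.

Lemma h1_sum_sqr u q N : h1_bounded u q -> \sum_(k <- box N) H u k ^+ 2 <= q.
Proof.
move=> [_ /(_ N)]; apply: le_trans; apply: ler_sum => k _.
by rewrite ler_peMl ?sqr_ge0 ?sobolev_weight_ge1.
Qed.

Lemma nonlinear_sum_sqr u q N : h1_bounded u q ->
  \sum_(k <- box N) nonlinear_coef u k ^+ 2 <= cubic_const 0 q * q.
Proof.
move=> hu; have [_ uq] := hu.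
have := nonlinear_coef_bound (n := 0) N hu (X := q).
under eq_bigr do rewrite expr0 mul1r; apply => M.
by under eq_bigr do rewrite expr1; exact: uq.
Qed.

Let E k := expR (- damping nu tau (nsq k)).

Let E_ge0 k : 0 <= E k. Proof. exact: expR_ge0. Qed.

Lemma norm_step_coef_le w k :
  `|d w k| <= E k * `|H w k| + tau * nsq k * E k * `|nonlinear_coef w k|.
Proof.
rewrite step_coef_scalar /scalar_step -/(E k) normrM (ger0_norm (E_ge0 k)).
apply: (@le_trans _ _ (E k * (`|H w k| + tau * nsq k * `|nonlinear_coef w k|))).
  apply: (ler_wpM2l (E_ge0 k)); apply: le_trans (ler_normB _ _) _.
  rewrite lerD2l normrM ger0_norm// mulr_ge0 ?wave_normsq_ge0//.
  exact: ltW.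
rewrite le_eqVlt; apply/orP; left; apply/eqP.
by move: (E k) `|_| `|_| (nsq k) => e a b c; ring.
Qed.

(** The smoothing [tau n exp (- y) <= 1 / (nu n) <= 2 / (nu W)] removes [tau]; Cauchy-Schwarz with
    the sum of [W^(-2)] then gives [196 = 4 . 49]. *)
Lemma sum_nonlinear_step w (g : R) N :
  (forall M, \sum_(k <- box M) nonlinear_coef w k ^+ 2 <= g) ->
  (\sum_(k <- box N) tau * nsq k * E k * `|nonlinear_coef w k|) ^+ 2 <=
  196 / nu ^+ 2 * g.
Proof.
move=> wg; set G := nonlinear_coef w.
have le1 k : tau * nsq k * E k <= 2 / nu * (W k)^-1.
  have Wk := sobolev_weight_gt0 R k.
  have [->|k0] := eqVneq k 0.
    rewrite /wave_normsq /= expr0n /= addr0 mulr0 mul0r.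
    apply: mulr_ge0; first by rewrite divr_ge0// ltW.
    by rewrite invr_ge0 ltW// sobolev_weight_gt0.
  have n0 : 0 < nsq k := lt_le_trans ltr01 (wave_normsq_ge1 R k0).
  have := damping_expR_le1 nu tau (ltW n0); rewrite -/(E k) => h.
  have h2 : tau * nsq k * E k <= (nu * nsq k)^-1.
    by rewrite -[leRHS]mul1r ler_pdivlMr ?mulr_gt0.
  apply: le_trans h2 _; rewrite invfM -mulrA mulrCA ler_pM2l ?invr_gt0//.
  rewrite -[leRHS]invrK lef_pV2 ?posrE ?invr_gt0 ?mulr_gt0 ?invr_gt0//.
  by rewrite invfM invrK; have := sobolev_weight_le2 R k0; lra.
have S0 : 0 <= \sum_(k <- box N) tau * nsq k * E k * `|G k|.
  apply: sumr_ge0 => k _; rewrite mulr_ge0// mulr_ge0// mulr_ge0 ?wave_normsq_ge0//.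
  exact: ltW.
have S_le : \sum_(k <- box N) tau * nsq k * E k * `|G k| <=
    2 / nu * \sum_(k <- box N) (1 * ((W k)^-1 * `|G k|)).
  rewrite mulr_sumr; apply: ler_sum => k _; rewrite mul1r mulrA.
  by apply: ler_wpM2r.
apply: (@le_trans _ _ ((2 / nu * \sum_(k <- box N) (1 * ((W k)^-1 * `|G k|))) ^+ 2)).
  by rewrite lerXn2r ?nnegrE//; exact: le_trans S_le.
rewrite exprMn.
have cs := @sum_CauchySchwarz R _ (box N) (fun=> 1) (fun k => (W k)^-1)
  (fun k => `|G k|) (fun=> ler01).
apply: (@le_trans _ _ ((2 / nu) ^+ 2 * (49 * g))).
  rewrite ler_wpM2l ?sqr_ge0//; apply: le_trans cs _; apply: ler_pM.
  - by apply: sumr_ge0 => k _; rewrite mul1r sqr_ge0.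
  - by apply: sumr_ge0 => k _; rewrite mul1r sqr_ge0.
  - by under eq_bigr do rewrite mul1r; exact: sum_weight_inv2.
  - by under eq_bigr do rewrite mul1r real_normK ?num_real//; exact: wg.
by rewrite le_eqVlt; apply/orP; left; apply/eqP; field; rewrite gt_eqF.
Qed.

Lemma sum_step_coef_le w N :
  \sum_(k <- box N) `|d w k| <= \sum_(k <- box N) E k * `|H w k| +
  \sum_(k <- box N) tau * nsq k * E k * `|nonlinear_coef w k|.
Proof. by rewrite -big_split; apply: ler_sum => k _; exact: norm_step_coef_le. Qed.

(** A qualitative statement whose bound depends on [tau]: after one step the Hartley series
    converges absolutely, even from data merely in H^1. The quantitative sup bound comes later from
    the energy. *)
Lemma step_summable w q : h1_bounded w q ->
  exists B, forall N, \sum_(k <- box N) `|d w k| <= B.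
Proof.
move=> hw; pose C := 2 * (1 + (tau * nu)^-1).
have tn : 0 < tau * nu by rewrite mulr_gt0.
have C0 : 0 <= C by rewrite mulr_ge0// addr_ge0// invr_ge0 ltW.
have EC k : E k <= C * (W k)^-1 ^+ 2.
  have n0 : 0 <= nsq k := wave_normsq_ge0 R k.
  have y1 : 0 < 1 + damping nu tau (nsq k).
    by have := damping_ge0 nu0 tau0 (nsq k); lra.
  have h1 : E k <= (1 + damping nu tau (nsq k))^-1.
    by rewrite /E expRN lef_pV2 ?posrE ?expR_gt0// expR_ge1Dx.
  apply: le_trans h1 _; have W0 := sobolev_weight_gt0 R k.
  rewrite exprVn -[leLHS]mul1r ler_pdivrMr// mulrAC ler_pdivlMr ?exprn_gt0// mul1r.
  rewrite /C /damping /sobolev_weight; set n := nsq k.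
  rewrite (_ : 2 * _ * _ =
    2 * (1 + n ^+ 2) + 2 * (tau * nu)^-1 + 2 * tau * nu * n ^+ 2); last first.
    by field; rewrite !gt_eqF.
  have : 0 <= 2 * (tau * nu)^-1 + 2 * tau * nu * n ^+ 2.
    apply: addr_ge0; first by rewrite mulr_ge0// invr_ge0 ltW.
    by rewrite -mulrA -mulrA mulrA mulr_ge0// mulr_ge0 ?sqr_ge0// ltW.
  by have := sqr_ge0 (n - 1); lra.
set g := cubic_const 0 q * q.
exists (C * (49 + q) + (1 + 196 / nu ^+ 2 * g)) => N.
apply: le_trans (sum_step_coef_le w N) _; apply: lerD.
  apply: (@le_trans _ _ (C * (\sum_(k <- box N) (W k)^-1 ^+ 2 + \sum_(k <- box N) H w k ^+ 2))).
    rewrite -big_split mulr_sumr; apply: ler_sum => k _ /=.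
    apply: (@le_trans _ _ (C * (W k)^-1 ^+ 2 * `|H w k|)); first by rewrite ler_wpM2r.
    rewrite -mulrA ler_wpM2l// -(real_normK (num_real (H w k))).
    have : (W k)^-1 ^+ 2 <= 1.
      apply: exprn_ile1; first by rewrite invr_ge0; apply/ltW/sobolev_weight_gt0.
      by rewrite invf_le1 ?sobolev_weight_gt0 ?sobolev_weight_ge1.
    have := sqr_ge0 ((W k)^-1); have := normr_ge0 (H w k).
    move: `|_| (_ ^+ 2) => a b a0 b0 b1.
    by have := sqr_ge0 (a - 1); have := mulr_ge0 b0 (sqr_ge0 (a - 1)); nra.
  by rewrite ler_wpM2l// lerD ?sum_weight_inv2 ?(h1_sum_sqr _ hw).
have := sum_nonlinear_step N (fun M => nonlinear_sum_sqr M hw); rewrite -/g.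
by move: (\sum_(k <- _) _) (196 / _ * _) => a b; have := sqr_ge0 (a - 1); nra.
Qed.

(** Equality with the series is required at every point, so that coefficient bounds control [w]
    everywhere and not just almost everywhere. *)
Definition absolutely_summable w :=
  (exists B, forall N, \sum_(k <- box N) `|H w k| <= B) /\ w = hartley_series (H w).

Lemma absolutely_summable_bounded w (B : R) : absolutely_summable w ->
  (forall N, \sum_(k <- box N) `|H w k| <= B) -> forall x, `|w x| <= B.
Proof. by move=> [_ wE] wB x; rewrite wE; exact: hartley_series_bounded. Qed.

Lemma step_spec w q : h1_bounded w q ->
  [/\ forall k, H (step w) k = d w k, absolutely_summable (step w),
      torus_periodic (step w) & torus_L2 (step w)].
Proof.
move=> hw; have [B dB] := step_summable hw.
rewrite /step (S_L_S_N nu tau hw).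
have Hd : H (hartley_series (d w)) = d w.
  by apply/funext => k; exact: (hartley_coef_series dB).
split; first by move=> k; rewrite Hd.
- by split; [exists B; rewrite Hd|rewrite Hd].
- exact: hartley_series_periodic.
- exact: (hartley_series_L2 dB).
Qed.

Lemma step_coef0 w : d w 0 = H w 0.
Proof.
have n0 : nsq 0 = 0 by rewrite /wave_normsq /= !expr0n /= addr0.
rewrite step_coef_scalar n0 /scalar_step /damping expr0n /=.
by rewrite !mulr0 mul0r oppr0 addr0 expR0 mul1r.
Qed.

Definition potential_energy w := torus_integral (fun x => (w x ^+ 2 - 1) ^+ 2 / 4).

Lemma potential_energy_ge0 w : 0 <= potential_energy w.
Proof. by apply: torus_integral_ge0 => x _; rewrite divr_ge0 ?sqr_ge0. Qed.

(** An exact Taylor expansion: for values [a] of [w] and [b] of [v], the remainder is [(b - a)^2]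
    times [(b^2 + 2 a b + 3 a^2) / 4 - 1 / 2], and this factor is at most [(3 / 2) B^2]. *)
Lemma potential_energy_step w v (B : R) :
  measurable_fun cell w -> measurable_fun cell v ->
  (forall x, `|w x| <= B) -> (forall x, `|v x| <= B) ->
  potential_energy v <= potential_energy w +
    torus_integral (fun x => (w x ^+ 3 - w x) * (v x - w x)) +
    3 / 2 * B ^+ 2 * torus_integral (fun x => (v x - w x) ^+ 2).
Proof.
move=> mw mv wB vB; have B0 : 0 <= B := le_trans (normr_ge0 _) (wB 0).
have Lw : torus_L2 w by apply: torus_L2_bounded mw _ => x _; exact: wB.
have Lv : torus_L2 v by apply: torus_L2_bounded mv _ => x _; exact: vB.
have [_ iwv] := torus_L2B Lv Lw.
have Lpow u n : measurable_fun cell u -> (forall x, `|u x| <= B) ->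
    torus_L2 (fun x => u x ^+ n).
  move=> mu_ uB; apply: (@torus_L2_bounded _ _ (B ^+ n)); first exact: measurable_funX.
  by move=> x _; rewrite normrX lerXn2r// nnegrE.
have iP u : measurable_fun cell u -> (forall x, `|u x| <= B) ->
    torus_integrable (fun x => (u x ^+ 2 - 1) ^+ 2 / 4).
  move=> mu_ uB.
  have [_ i2] := torus_L2B (Lpow u 2 mu_ uB) (@torus_L2_bounded R (fun=> 1) 1
    (measurable_cst _) (fun x _ => eq_ind_r (fun t => t <= 1) (lexx 1) (normr1 R))).
  by have := torus_integrableZ 4^-1 i2; under eq_fun do rewrite mulrC.
have iF : torus_integrable (fun x => (w x ^+ 3 - w x) * (v x - w x)).
  apply: torus_L2_integrable_mul; last exact: torus_L2B.
  by apply: torus_L2B => //; exact: Lpow.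
have iD := torus_integrableZ (3 / 2 * B ^+ 2) iwv.
have iPF := torus_integrableD (iP w mw wB) iF.
rewrite /potential_energy -(torus_integralZ _ iwv) -(torus_integralD (iP w mw wB) iF).
rewrite -(torus_integralD iPF iD).
apply: le_torus_integral; [exact: iP|exact: torus_integrableD|].
move=> x _; have := wB x; have := vB x; rewrite !ler_norml.
move: (w x) (v x) => a b /andP[b1 b2] /andP[a1 a2].
have ha : a ^+ 2 <= B ^+ 2 by nra.
have hb : b ^+ 2 <= B ^+ 2 by nra.
have hab : (b ^+ 2 + 2 * a * b + 3 * a ^+ 2) / 4 - 1 / 2 <= 3 / 2 * B ^+ 2.
  by have := sqr_ge0 (a - b); nra.
rewrite -subr_ge0 (_ : _ - _ = (3 / 2 * B ^+ 2 -
  ((b ^+ 2 + 2 * a * b + 3 * a ^+ 2) / 4 - 1 / 2)) * (b - a) ^+ 2); last by field.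
by rewrite mulr_ge0 ?sqr_ge0// subr_ge0.
Qed.

Variable lam : R.
Hypotheses (lam0 : 0 < lam) (lam4 : lam ^+ 4 = tau * nu).

(** Only the quadratic part is cut to a box; the potential part is always the full integral. *)
Definition energy_bounded w (K : R) :=
  forall N, \sum_(k <- box N) m (nsq k) * H w k ^+ 2 / 2 + potential_energy w <= K.

(** The first-order terms of the quadratic and the potential parts are opposite, once Parseval has
    turned the frequency sum into the integral of [(w^3 - w) dl]. What remains is the square of the
    increment, with coefficient [(3 / 2) B^2 - nu / lam^2 <= 0]. *)
Lemma energy_decrease w q (K B : R) : h1_bounded w q -> absolutely_summable w ->
  (forall N, \sum_(k <- box N) `|H w k| <= B) ->
  (forall N, \sum_(k <- box N) `|d w k| <= B) ->
  3 / 2 * B ^+ 2 <= nu / lam ^+ 2 ->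
  energy_bounded w K -> energy_bounded (step w) K.
Proof.
move=> hw sw wB dB Blam eK N0; have [Hs ss _ Ls] := step_spec hw.
have wb := absolutely_summable_bounded sw wB.
have sb : forall x, `|step w x| <= B.
  apply: absolutely_summable_bounded ss _ => N.
  by under eq_bigr do rewrite Hs; exact: dB.
have mw := h1_measurable hw; have ms : measurable_fun cell (step w) by case: Ls.
have [Lw _] := hw; have Ldl := torus_L2B Ls Lw.
have B0 : 0 <= B := le_trans (normr_ge0 _) (wb 0).
have Lf : torus_L2 (fun x => w x ^+ 3 - w x).
  apply: torus_L2B => //; apply: (@torus_L2_bounded _ _ (B ^+ 3)); first exact: measurable_funX.
  by move=> x _; rewrite normrX lerXn2r// nnegrE.
set dl := fun x => step w x - w x.
have Hdl k : H dl k = d w k - H w k by rewrite hartley_coefB// Hs.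
pose IG := torus_integral (fun x => (w x ^+ 3 - w x) * dl x).
pose ID := torus_integral (fun x => dl x * dl x).
have cvG : (fun N => \sum_(k <- box N) nonlinear_coef w k * H dl k) @ \oo --> IG.
  exact: (Parseval Lf Ldl).
have cvD : (fun N => \sum_(k <- box N) H dl k * H dl k) @ \oo --> ID.
  exact: (Parseval Ldl Ldl).
pose P := potential_energy w.
have m_ge0 k : 0 <= m (nsq k) by apply: energy_weight_ge0 => //; exact: wave_normsq_ge0.
have boxN N : \sum_(k <- box N) m (nsq k) * H (step w) k ^+ 2 / 2 <=
    K - P - \sum_(k <- box N) nonlinear_coef w k * H dl k -
    nu / lam ^+ 2 * \sum_(k <- box N) H dl k * H dl k.
  have := eK N; rewrite -/P => h.
  apply: (@le_trans _ _ (\sum_(k <- box N) m (nsq k) * H w k ^+ 2 / 2 -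
    \sum_(k <- box N) nonlinear_coef w k * H dl k -
    nu / lam ^+ 2 * \sum_(k <- box N) H dl k * H dl k)); last first.
    by rewrite !lerD2r lerBrDr.
  rewrite mulr_sumr -!sumrB; apply: ler_sum => k _; rewrite Hs Hdl.
  have := @scalar_step_energy R nu tau nu0 tau0 lam lam0 lam4 (nsq k) (H w k)
    (nonlinear_coef w k) (wave_normsq_ge0 R k).
  rewrite /= -step_coef_scalar.
  move: (d w k) (H w k) (nonlinear_coef w k) (nu / lam ^+ 2) => a b g p [z1 z2].
  have [n0|nn0] := eqVneq (nsq k) 0.
    by rewrite n0 energy_weight0 (z1 n0) subrr !mul0r !mulr0 !subr0.
  have np : 0 < nsq k by rewrite lt_def nn0 wave_normsq_ge0.
  by have := z2 np; move: (m _) => t; lra.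
(* The box on the left stays at [N0] while the one on the right grows, which is legitimate because
   the terms on the left are nonnegative. *)
have lim1 : \sum_(k <- box N0) m (nsq k) * H (step w) k ^+ 2 / 2 <=
    K - P - IG - nu / lam ^+ 2 * ID.
  have cv : (fun N => K - P - \sum_(k <- box N) nonlinear_coef w k * H dl k -
      nu / lam ^+ 2 * \sum_(k <- box N) H dl k * H dl k) @ \oo -->
      K - P - IG - nu / lam ^+ 2 * ID.
    apply: cvgB; first by apply: cvgB => //; exact: cvg_cst.
    by apply: cvgM => //; exact: cvg_cst.
  apply: (cvgr_to_ge cv); exists N0 => // N /= NN; apply: le_trans (boxN N).
  apply: le_sum_box => // k; by rewrite divr_ge0// mulr_ge0 ?sqr_ge0.
have := potential_energy_step mw ms wb sb; rewrite -/P.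
rewrite (_ : torus_integral (fun x => (step w x - w x) ^+ 2) = ID); last first.
  by apply: eq_torus_integral => x _; rewrite expr2.
rewrite -/IG.
have ID0 : 0 <= ID by apply: torus_integral_ge0 => x _; rewrite -expr2 sqr_ge0.
have := ler_wpM2r ID0 Blam; move: lim1; clear cvG cvD boxN ID0 eK.
move: (\sum_(k <- _) _) (potential_energy _) P IG ID (nu / _) (3 / 2 * _).
by move=> a1 a2 a3 a4 a5 a6 a7; lra.
Qed.

End EnergyStability.

(** * Explicit constants, energy along the iteration, and the H^1 bound *)

Section UniformH1.
Variable R : realType.
Implicit Types (u v w : R * R -> R) (k : int * int).

Local Notation cell := (@torus_cell R).
Local Notation H := (@hartley_coef R).
Local Notation W := (@sobolev_weight R).
Local Notation nsq := (@wave_normsq R).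

(** Bounds the sum of [m H^2] after one step from data of squared H^1 norm [q]. In [energy_const]
    half of it is joined by the potential energy of [u^1], estimated through L^4 at the squared H^1
    radius [2 * first_step_const nu q / nu]. *)
Definition first_step_const (nu q : R) := 2 * nu * q + 8 / nu * (cubic_const 0 q * q).

Definition energy_const (nu q : R) := first_step_const nu q / 2 +
  L4_const R / 2 * (2 * first_step_const nu q / nu) ^+ 2 + (2 * pi) ^+ 2 / 2.

Definition h1_radius (nu q : R) := 4 * energy_const nu q / nu.

(** At energy [K] and for [lam <= 1], this divided by [lam] bounds the squared coefficient sums of
    an iterate and its successor. Squaring a sum of two terms doubles [147 (2 K)] to 588 and 196 to
    392. *)
Definition sup_const (nu K : R) :=
  588 * K / nu + 392 / nu ^+ 2 * (cubic_const 0 (4 * K / nu) * (4 * K / nu)).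

(** The second entry solves [(3 / 2) sup_const / lam <= nu / lam^2] for [lam]. *)
Definition max_lam (nu q : R) := Num.min 1 (2 * nu / (3 * sup_const nu (energy_const nu q))).

Definition max_tau (nu q : R) := Num.min 1 (max_lam nu q ^+ 4 / nu).

Section Constants.
Variables (nu q : R).
Hypotheses (nu0 : 0 < nu) (q0 : 0 <= q).

Lemma cubic_const_ge0 n (p : R) : 0 <= cubic_const n p.
Proof. by apply: le_trans (cubic_const_ge2 n p). Qed.

Lemma first_step_const_ge : 2 * nu * q <= first_step_const nu q.
Proof.
rewrite lerDl; apply: mulr_ge0; first by rewrite divr_ge0// ltW.
by apply: mulr_ge0 => //; exact: cubic_const_ge0.
Qed.

Lemma first_step_const_ge0 : 0 <= first_step_const nu q.
Proof. by apply: le_trans first_step_const_ge; rewrite mulr_ge0// mulr_ge0// ltW. Qed.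

Lemma energy_const_gt0 : 0 < energy_const nu q.
Proof.
rewrite ltr_wpDl//; last by rewrite divr_gt0// exprn_gt0// mulr_gt0// pi_gt0.
apply: addr_ge0; first by rewrite divr_ge0// first_step_const_ge0.
by rewrite mulr_ge0 ?sqr_ge0// divr_ge0// (le_trans ler01)// L4_const_ge1.
Qed.

Lemma energy_const_ge : first_step_const nu q / 2 <= energy_const nu q.
Proof.
rewrite /energy_const -addrA lerDl; apply: addr_ge0; last by rewrite divr_ge0 ?sqr_ge0.
by rewrite mulr_ge0 ?sqr_ge0// divr_ge0// (le_trans ler01)// L4_const_ge1.
Qed.

Lemma h1_radius_ge : q <= h1_radius nu q.
Proof.
rewrite /h1_radius ler_pdivlMr//; have := energy_const_ge; have := first_step_const_ge.
have := mulr_ge0 (ltW nu0) q0.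
by move: (first_step_const _ _) (energy_const _ _) => a b; lra.
Qed.

Lemma sup_const_gt0 K : 0 < K -> 0 < sup_const nu K.
Proof.
move=> K0; have p0 : 0 < 4 * K / nu by rewrite divr_gt0// mulr_gt0.
have h588 : 0 < 588%:R :> R by rewrite ltr0n.
have c0 := divr_gt0 (mulr_gt0 h588 K0) nu0.
rewrite /sup_const; move: (588 * K / nu) c0 => c c0; apply: ltr_wpDr c0.
apply: mulr_ge0; first by apply: divr_ge0 (sqr_ge0 _); rewrite ler0n.
by apply: mulr_ge0 (ltW p0); exact: cubic_const_ge0.
Qed.

Lemma max_lam_gt0 : 0 < max_lam nu q.
Proof.
rewrite lt_min ltr01/= divr_gt0 ?mulr_gt0//.
exact/sup_const_gt0/energy_const_gt0.
Qed.

Lemma max_tau_gt0 : 0 < max_tau nu q.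
Proof. by rewrite lt_min ltr01/= divr_gt0// exprn_gt0// max_lam_gt0. Qed.

End Constants.

Variables (nu tau : R).
Hypotheses (nu0 : 0 < nu) (tau0 : 0 < tau).
Local Notation step := (splitting_step nu tau).
Local Notation d := (step_coef nu tau).
Local Notation m := (energy_weight nu tau).

(** The energy weight vanishes at frequency 0, so mean zero is what makes the energy control the H^1
    norm; elsewhere [W <= 2 n <= (2 / nu) m]. *)
Lemma energy_h1_bounded w (L : R) : torus_L2 w -> H w 0 = 0 ->
  (forall N, \sum_(k <- box N) m (nsq k) * H w k ^+ 2 <= L) ->
  h1_bounded w (2 * L / nu).
Proof.
move=> Lw w0 wL; split => // N.
apply: (@le_trans _ _ (2 / nu * \sum_(k <- box N) m (nsq k) * H w k ^+ 2)); last first.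
  by rewrite [leRHS]mulrAC; apply: ler_wpM2l (wL N); rewrite divr_ge0// ltW.
rewrite mulr_sumr; apply: ler_sum => k _.
have [->|k0] := eqVneq k 0; first by rewrite w0 expr0n /= !mulr0.
rewrite [leRHS]mulrA; apply: (ler_wpM2r (sqr_ge0 _)).
apply: le_trans (sobolev_weight_le2 R k0) _.
rewrite [leRHS]mulrAC ler_pdivlMr//.
have := energy_weight_ge nu tau0 (wave_normsq_ge0 R k).
by move: (nsq k) (m _) => n a; lra.
Qed.

Lemma energy_bounded_sum w K N : energy_bounded nu tau w K ->
  \sum_(k <- box N) m (nsq k) * H w k ^+ 2 <= 2 * K.
Proof.
move=> /(_ N); rewrite -mulr_suml; have := potential_energy_ge0 w.
by move: (\sum_(k <- _) _) (potential_energy w) => a b; lra.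
Qed.

Section SupBound.
Variable lam : R.
Hypotheses (lam0 : 0 < lam) (lam4 : lam ^+ 4 = tau * nu).

Lemma inv_weight_energy k : k != 0 ->
  (inv_weight R k)^-1 ^+ 3 <= 3 / (nu * lam) * m (nsq k).
Proof.
move=> k0; have n1 := wave_normsq_ge1 R k0.
set n := nsq k in n1 *; have n0 : 0 < n by lra.
set s := Num.sqrt n; have s0 : 0 < s by rewrite sqrtr_gt0.
have sn : s ^+ 2 = n by rewrite sqr_sqrtr// ltW.
have := energy_weight_three_half nu0 tau0 lam0 lam4 s0 sn.
set p := (inv_weight R k)^-1; have p0 : 0 < p by rewrite invr_gt0 inv_weight_gt0.
have pW : p ^+ 2 = W k by rewrite exprVn inv_weight_sqr invrK.
have p2 : p ^+ 2 <= 2 * s ^+ 2 by rewrite pW sn; exact: sobolev_weight_le2.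
have ps : p <= 3 / 2 * s by nra.
have p3 : p ^+ 3 <= 3 * s ^+ 3.
  rewrite (_ : p ^+ 3 = p ^+ 2 * p); last by ring.
  rewrite (_ : 3 * s ^+ 3 = 2 * s ^+ 2 * (3 / 2 * s)); last by field.
  by apply: ler_pM => //; [exact: sqr_ge0|exact: ltW].
move=> h; apply: le_trans p3 _; rewrite mulrAC ler_pdivlMr ?mulr_gt0//.
by rewrite -mulrA ler_pM2l// mulrC.
Qed.

(** Cauchy-Schwarz against [r ^+ 3]: the dual weight [W^(3/2)] is the power that the energy weight
    dominates with constant [3 / (nu lam)], and [147 = 3 . 49]. *)
Lemma sum_coef_energy w (L : R) N : H w 0 = 0 ->
  (forall M, \sum_(k <- box M) m (nsq k) * H w k ^+ 2 <= L) ->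
  (\sum_(k <- box N) `|H w k|) ^+ 2 <= 147 / (nu * lam) * L.
Proof.
move=> w0 wL; have r0 k := inv_weight_gt0 R k.
have nl : 0 < nu * lam by rewrite mulr_gt0.
have cs := @sum_CauchySchwarz R _ (box N) (fun k => inv_weight R k ^+ 3) (fun=> 1)
  (fun k => (inv_weight R k)^-1 ^+ 3 * `|H w k|) (fun k => exprn_ge0 3 (ltW (r0 k))).
have e1 : \sum_(k <- box N) `|H w k| =
    \sum_(k <- box N) inv_weight R k ^+ 3 * (1 * ((inv_weight R k)^-1 ^+ 3 * `|H w k|)).
  apply: eq_bigr => k _; rewrite mul1r mulrA -exprMn mulfV ?gt_eqF// expr1n mul1r.
  by [].
rewrite e1; apply: le_trans cs _.
rewrite (_ : 147 / (nu * lam) * L = 49 * (3 / (nu * lam) * L)); last by field; rewrite !gt_eqF.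
apply: ler_pM.
- by apply: sumr_ge0 => k _; rewrite expr1n mulr1 exprn_ge0// ltW.
- by apply: sumr_ge0 => k _; apply: mulr_ge0 (sqr_ge0 _); rewrite exprn_ge0// ltW.
- by under eq_bigr do rewrite expr1n mulr1; exact: sum_inv_weight3.
apply: (@le_trans _ _ (3 / (nu * lam) * \sum_(k <- box N) m (nsq k) * H w k ^+ 2)); last first.
  by apply: ler_wpM2l (wL N); rewrite divr_ge0// ltW.
rewrite mulr_sumr; apply: ler_sum => k _.
have [->|k0] := eqVneq k 0; first by rewrite w0 normr0 !mulr0 expr0n /= !mulr0.
rewrite [leRHS]mulrA exprMn real_normK ?num_real// [leLHS]mulrA.
apply: (ler_wpM2r (sqr_ge0 _)).
rewrite expr2 mulrA -exprMn mulfV ?gt_eqF// expr1n mul1r.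
exact: inv_weight_energy.
Qed.

(** To avoid circularity, the sup bound for [step w] comes from the energy of [w] and the smoothing
    of its nonlinear part, never from the energy of [step w]. The first contribution, [b1], has a
    square of order [1 / lam]; the second, [b2], is free of [tau]. *)
Lemma step_energy_bounded w K : 0 < K -> lam <= 1 -> lam <= 2 * nu / (3 * sup_const nu K) ->
  torus_L2 w -> H w 0 = 0 -> absolutely_summable w ->
  energy_bounded nu tau w K -> energy_bounded nu tau (step w) K.
Proof.
move=> K0 lam1 lamC Lw w0 sw wK.
have wL N := energy_bounded_sum N wK; have hw := energy_h1_bounded Lw w0 wL.
rewrite (_ : 2 * (2 * K) / nu = 4 * K / nu) in hw; last by field; rewrite gt_eqF.
pose p := 4 * K / nu; have p0 : 0 <= p by rewrite divr_ge0 ?mulr_ge0 ?ltW.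
pose g := cubic_const 0 p * p.
have g0 : 0 <= g by apply: mulr_ge0 => //; exact: cubic_const_ge0.
pose b1 := Num.sqrt (147 / (nu * lam) * (2 * K)).
pose b2 := Num.sqrt (196 / nu ^+ 2 * g).
have nl : 0 < nu * lam by rewrite mulr_gt0.
have b1sq : b1 ^+ 2 = 147 / (nu * lam) * (2 * K).
  apply: sqr_sqrtr; apply: mulr_ge0; last exact: mulr_ge0 (ler0n _ 2) (ltW K0).
  exact: divr_ge0 (ler0n _ 147) (ltW nl).
have b2sq : b2 ^+ 2 = 196 / nu ^+ 2 * g.
  by apply: sqr_sqrtr; exact: mulr_ge0 (divr_ge0 (ler0n _ 196) (sqr_ge0 _)) g0.
have b10 : 0 <= b1 := sqrtr_ge0 _; have b20 : 0 <= b2 := sqrtr_ge0 _.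
have s1 N : \sum_(k <- box N) `|H w k| <= b1.
  rewrite -(ler_pXn2r (n := 2))// ?nnegrE ?sumr_ge0//.
  by rewrite b1sq; exact: sum_coef_energy.
have dB N : \sum_(k <- box N) `|d w k| <= b1 + b2.
  apply: le_trans (sum_step_coef_le nu tau0 w N) _; apply: lerD.
    apply: le_trans (s1 N); apply: ler_sum => k _; rewrite ler_piMl//.
    by rewrite -expR0 ler_expR oppr_le0 damping_ge0.
  rewrite -(ler_pXn2r (n := 2))// ?nnegrE.
    rewrite b2sq; apply: sum_nonlinear_step => // M; exact: nonlinear_sum_sqr.
  apply: sumr_ge0 => k _; apply: mulr_ge0 => //; apply: mulr_ge0; last exact: expR_ge0.
  by apply: mulr_ge0 (wave_normsq_ge0 R k); exact: ltW.
apply: (energy_decrease nu0 tau0 lam0 lam4 hw sw _ dB) => //.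
  by move=> N; apply: le_trans (s1 N) _; rewrite lerDl.
have C0 := sup_const_gt0 nu0 K0.
apply: (@le_trans _ _ (3 / 2 * (sup_const nu K / lam))).
  rewrite ler_wpM2l//; apply: (@le_trans _ _ (2 * b1 ^+ 2 + 2 * b2 ^+ 2)).
    by have := sqr_ge0 (b1 - b2); lra.
  rewrite b1sq b2sq ler_pdivlMr// /sup_const -/p -/g mulrDl; apply: lerD.
    by rewrite le_eqVlt; apply/orP; left; apply/eqP; field; rewrite !gt_eqF.
  rewrite (_ : 2 * (196 / nu ^+ 2 * g) = 392 / nu ^+ 2 * g); last by field; rewrite gt_eqF.
  by apply: ler_piMr lam1; exact: mulr_ge0 (divr_ge0 (ler0n _ 392) (sqr_ge0 _)) g0.
rewrite ler_pdivlMr ?exprn_gt0//.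
rewrite (_ : 3 / 2 * _ * _ = lam * (3 * sup_const nu K) / 2); last by field; rewrite gt_eqF.
move: lamC; rewrite ler_pdivlMr ?mulr_gt0//.
by move: (sup_const nu K) => c; lra.
Qed.

End SupBound.

Lemma potential_energy_le w q : h1_bounded w q ->
  potential_energy w <= L4_const R / 2 * q ^+ 2 + (2 * pi) ^+ 2 / 2.
Proof.
move=> hw; have [i4 l4] := h1_L4 hw.
have i1 := torus_integrable_cst (2^-1 : R).
have i5 := torus_integrableZ 2^-1 i4.
apply: (@le_trans _ _ (torus_integral (fun x => 2^-1 * w x ^+ 4 + 2^-1))).
  apply: le_torus_integral; last first.
  - move=> x _; rewrite -subr_ge0 (_ : _ - _ = (w x ^+ 2 + 1) ^+ 2 / 4); last by field.
    by rewrite divr_ge0 ?sqr_ge0.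
  - exact: torus_integrableD.
  apply: (torus_integrable_le _ _ (torus_integrableD i5 i1)).
    apply: measurable_funM => //; apply: measurable_funX; apply: measurable_funB => //.
    by apply: measurable_funX; exact: h1_measurable hw.
  move=> x _; rewrite ger0_norm ?divr_ge0 ?sqr_ge0// -subr_ge0.
  rewrite (_ : _ - _ = (w x ^+ 2 + 1) ^+ 2 / 4); last by field.
  by rewrite divr_ge0 ?sqr_ge0.
rewrite torus_integralD// torus_integralZ// torus_integral_cst.
rewrite (mulrC 2^-1 ((2 * pi) ^+ 2)) lerD2r [leLHS]mulrC [leRHS]mulrAC.
by rewrite ler_pM2r ?invr_gt0.
Qed.

Lemma first_step_energy u q : h1_bounded u q -> H u 0 = 0 ->
  energy_bounded nu tau (step u) (energy_const nu q).
Proof.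
move=> hu u0; have q0 := h1_bounded_ge0 hu; have [Hs _ _ Ls] := step_spec nu0 tau0 hu.
have sL N : \sum_(k <- box N) m (nsq k) * H (step u) k ^+ 2 <= first_step_const nu q.
  have [_ /(_ N) uq] := hu; have ug := nonlinear_sum_sqr N hu.
  apply: (@le_trans _ _ (2 * nu * \sum_(k <- box N) W k * H u k ^+ 2 +
      8 / nu * \sum_(k <- box N) nonlinear_coef u k ^+ 2)); last first.
    by apply: lerD; apply: ler_wpM2l => //; rewrite ?divr_ge0 ?mulr_ge0 ?ltW.
  rewrite !mulr_sumr -big_split; apply: ler_sum => k _; rewrite Hs.
  have [->|k0] := eqVneq k 0.
    rewrite (_ : nsq 0 = 0); last by rewrite /wave_normsq /= !expr0n /= addr0.
    rewrite energy_weight0 mul0r; apply: addr_ge0; apply: mulr_ge0.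
    - by rewrite mulr_ge0 ?ltW.
    - by apply: mulr_ge0 (sqr_ge0 _); apply/ltW/sobolev_weight_gt0.
    - by rewrite divr_ge0// ltW.
    - exact: sqr_ge0.
  rewrite step_coef_scalar.
  apply: le_trans (scalar_step_energy_smoothing nu0 tau0 _ _ (wave_normsq_ge1 R k0)) _.
  rewrite lerD2r; apply: ler_wpM2l; first by rewrite mulr_ge0 ?ltW.
  by apply: (ler_wpM2r (sqr_ge0 _)); rewrite /sobolev_weight lerDr.
have s0 : H (step u) 0 = 0 by rewrite Hs step_coef0.
have := potential_energy_le (energy_h1_bounded Ls s0 sL).
move=> hP N; apply: (@le_trans _ _ (first_step_const nu q / 2 + potential_energy (step u))).
  by rewrite lerD2r -mulr_suml ler_pM2r ?invr_gt0.
by rewrite /energy_const -addrA lerD2l.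
Qed.

Lemma iterateS u n : iterate nu tau u n.+1 = step (iterate nu tau u n).
Proof. by []. Qed.

Lemma iterate_h1_bounded u q n : tau < max_tau nu q -> h1_bounded u q -> H u 0 = 0 ->
  h1_bounded (iterate nu tau u n) (h1_radius nu q) /\ H (iterate nu tau u n) 0 = 0.
Proof.
move=> tau_lt hu u0; have q0 := h1_bounded_ge0 hu.
have K0 := energy_const_gt0 nu0 q0.
pose lam := Num.sqrt (Num.sqrt (tau * nu)).
have tn : 0 < tau * nu by rewrite mulr_gt0.
have lam0 : 0 < lam by rewrite !sqrtr_gt0.
have lam4 : lam ^+ 4 = tau * nu.
  by rewrite (exprM _ 2 2) !sqr_sqrtr ?sqrtr_ge0// ltW.
have lam_le : lam <= max_lam nu q.
  have l0 := ltW (max_lam_gt0 nu0 q0).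
  rewrite -(ler_pXn2r (n := 4))// ?nnegrE ?(ltW lam0)// lam4 -ler_pdivlMr//.
  by move: tau_lt; rewrite lt_min => /andP[_ /ltW].
move: lam_le; rewrite le_min => /andP[lam1 lamC].
have radE : 2 * (2 * energy_const nu q) / nu = h1_radius nu q.
  by rewrite /h1_radius; field; rewrite gt_eqF.
(* The invariant begins at [u^1], since [u^0] need not be absolutely summable nor have finite
   energy; [u^0] itself lies within [h1_radius] by [h1_radius_ge]. *)
have main j : [/\ torus_L2 (iterate nu tau u j.+1), H (iterate nu tau u j.+1) 0 = 0,
    absolutely_summable (iterate nu tau u j.+1) &
    energy_bounded nu tau (iterate nu tau u j.+1) (energy_const nu q)].
  elim: j => [|j [Lw w0 sw ew]]; rewrite iterateS.
    have [Hs ss _ Ls] := step_spec nu0 tau0 hu.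
    by split; [exact: Ls|rewrite Hs step_coef0|exact: ss|exact: first_step_energy].
  have hw := energy_h1_bounded Lw w0 (fun N => energy_bounded_sum N ew).
  have [Hs ss _ Ls] := step_spec nu0 tau0 hw.
  split; [exact: Ls|by rewrite Hs step_coef0|exact: ss|].
  exact: step_energy_bounded lam0 lam4 _ _ K0 lam1 lamC Lw w0 sw ew.
case: n => [|n].
  split; last exact: u0.
  have [Lu uq] := hu; split; first exact: Lu.
  move=> N; apply: le_trans (uq N) _.
  exact: h1_radius_ge.
have [Lw w0 sw ew] := main n; split; last exact: w0.
by rewrite -radE; exact: energy_h1_bounded Lw w0 (fun N => energy_bounded_sum N ew).
Qed.

End UniformH1.

(** * Uniform Sobolev bounds *)

Section UniformSobolev.
Variable R : realType.
Implicit Types (u v w : R * R -> R) (k : int * int).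

Local Notation H := (@hartley_coef R).
Local Notation W := (@sobolev_weight R).
Local Notation nsq := (@wave_normsq R).

Lemma box_sum_lim (g : int * int -> R) (B : R) : (forall k, 0 <= g k) ->
  (forall N, \sum_(k <- box N) g k <= B) ->
  exists2 l, (fun N => \sum_(k <- box N) g k) @ \oo --> l &
    forall N, \sum_(k <- box N) g k <= l.
Proof.
move=> g0 gB; have cv := cvg_nonneg_box_sum g0 gB.
exists (limn (fun N => \sum_(k <- box N) g k)); first exact: cv.
move=> N; apply: (nondecreasing_cvgn_le _ cv) => M M' MM'; exact: le_sum_box.
Qed.

Lemma weight_interpolation k (eps : R) s : 0 < eps ->
  W k ^+ s.+1 <= eps * W k ^+ s.+2 + eps^-1 ^+ s * W k.
Proof.
move=> e0; have := sobolev_weight_gt0 R k; move: (W k) => x x0.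
have x_ge n : 0 <= x ^+ n by rewrite exprn_ge0// ltW.
have [h|h] := leP 1 (eps * x).
  apply: (@le_trans _ _ (eps * x ^+ s.+2)); last first.
    by rewrite lerDl; apply: mulr_ge0 (ltW x0); rewrite exprn_ge0// invr_ge0 ltW.
  by rewrite [x ^+ s.+2]exprS mulrA ler_peMl.
apply: (@le_trans _ _ (eps^-1 ^+ s * x)); last first.
  by rewrite lerDr; exact: mulr_ge0 (ltW e0) (x_ge _).
rewrite exprSr; apply: (ler_wpM2r (ltW x0)).
rewrite lerXn2r ?nnegrE ?invr_ge0 ?(ltW x0) ?(ltW e0)//.
by rewrite -[leRHS]mul1r ler_pdivlMr// mulrC ltW.
Qed.

Section Step.
Variables (nu tau : R).
Hypotheses (nu0 : 0 < nu) (tau0 : 0 < tau) (tau1 : tau <= 1).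
Local Notation step := (splitting_step nu tau).
Local Notation d := (step_coef nu tau).

(** The budget of the H^(s+2) term, in multiples of [nu tau]: the damping supplies 1/4, this
    functional carries 1/8 to the next step, and the cubic term there consumes 1/16. *)
Definition sobolev_energy_bounded s w (Y : R) := forall N,
  \sum_(k <- box N) W k ^+ s * H w k ^+ 2 +
  nu / 8 * tau * (\sum_(k <- box N) W k ^+ s.+2 * H w k ^+ 2) <= Y.

Lemma damping_ge_weight k : k != 0 ->
  nu / 4 * tau * W k ^+ 2 <= damping nu tau (nsq k).
Proof.
move=> k0; have := sobolev_weight_le2 R k0; have := sobolev_weight_gt0 R k.
rewrite /damping; move: (W k) (nsq k) => x n x0 xn.
have h : x ^+ 2 <= 4 * n ^+ 2 by nra.
rewrite (_ : tau * nu * n ^+ 2 = nu / 4 * tau * (4 * n ^+ 2)); last by field.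
by apply: ler_wpM2l h; rewrite mulr_ge0 ?divr_ge0 ?ltW.
Qed.

Lemma damped_weight_le k (x : R) : k != 0 ->
  (1 + nu / 4 * tau * W k ^+ 2) * x ^+ 2 <= (1 + damping nu tau (nsq k)) * x ^+ 2.
Proof.
by move=> k0; apply: (ler_wpM2r (sqr_ge0 x)); rewrite lerD2l damping_ge_weight.
Qed.

Lemma weighted_contraction s w k : H w 0 = 0 ->
  W k ^+ s * d w k ^+ 2 + nu / 4 * tau * (W k ^+ s.+2 * d w k ^+ 2) <=
  W k ^+ s * H w k ^+ 2 + tau / nu * (W k ^+ s * nonlinear_coef w k ^+ 2).
Proof.
move=> w0; have Ws : 0 <= W k ^+ s by apply/exprn_ge0/ltW/sobolev_weight_gt0.
have tn : 0 <= tau / nu by rewrite divr_ge0 ?ltW.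
have [->|k0] := eqVneq k 0.
  rewrite step_coef0 w0 expr0n /= !mulr0 addr0 add0r; apply: mulr_ge0 tn _.
  by apply: mulr_ge0 (sqr_ge0 _); apply/exprn_ge0/ltW/sobolev_weight_gt0.
have := scalar_step_contraction nu0 tau0 (nsq k) (H w k) (nonlinear_coef w k).
rewrite -step_coef_scalar => h.
have := ler_wpM2l Ws (le_trans (damped_weight_le (d w k) k0) h).
rewrite !exprSr; move: (W k ^+ s) (tau / nu) (W k) (d w k) (H w k) (nonlinear_coef w k).
by move=> a b c e f g; lra.
Qed.

(** Initial data in H^(s+1) have a cube controlled only in H^s; the smoothing factor [n^(-2)]
    restores the missing derivative through [W <= 4 n^2], whence [32 = 4 . 8]. *)
Lemma weighted_smoothing s w k : H w 0 = 0 ->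
  W k ^+ s.+1 * d w k ^+ 2 + nu / 4 * tau * (W k ^+ s.+3 * d w k ^+ 2) <=
  2 * (W k ^+ s.+1 * H w k ^+ 2) + 32 / nu ^+ 2 * (W k ^+ s * nonlinear_coef w k ^+ 2).
Proof.
move=> w0; have W0 := sobolev_weight_gt0 R k.
have Ws : 0 <= W k ^+ s.+1 by apply/exprn_ge0/ltW.
have c0 : 0 <= 32 / nu ^+ 2 by exact: divr_ge0 (ler0n _ 32) (sqr_ge0 _).
have [kE|k0] := eqVneq k 0.
  rewrite kE step_coef0 w0 expr0n /= !mulr0 addr0 add0r; apply: mulr_ge0 c0 _.
  by apply: mulr_ge0 (sqr_ge0 _); apply/exprn_ge0/ltW/sobolev_weight_gt0.
have n1 := wave_normsq_ge1 R k0; have n0 : 0 < nsq k by apply: lt_le_trans n1.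
have := scalar_step_smoothing nu0 tau0 (H w k) (nonlinear_coef w k) n0.
rewrite -step_coef_scalar => h.
have h1 := ler_wpM2l Ws (le_trans (damped_weight_le (d w k) k0) h).
have h2 : W k ^+ s.+1 * (8 / (nu ^+ 2 * nsq k ^+ 2)) <= 32 / nu ^+ 2 * W k ^+ s.
  rewrite mulrA ler_pdivrMr; last by rewrite mulr_gt0 ?exprn_gt0.
  rewrite (_ : 32 / nu ^+ 2 * _ * _ = W k ^+ s * (32 * nsq k ^+ 2)); last first.
    by field; rewrite gt_eqF.
  rewrite exprSr -mulrA; apply: ler_wpM2l; first by apply/exprn_ge0/ltW.
  have := sobolev_weight_le2 R k0; move: W0 n1; move: (W k) (nsq k) => x n x0 n1 xn.
  by nra.
have h3 := ler_wpM2r (sqr_ge0 (nonlinear_coef w k)) h2.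
apply: (@le_trans _ _ (W k ^+ s.+1 * ((1 + nu / 4 * tau * W k ^+ 2) * d w k ^+ 2))).
  rewrite (exprSr _ s.+2) (exprSr _ s.+1); move: (W k ^+ s.+1) (W k) (d w k) => a b c.
  by rewrite le_eqVlt; apply/orP; left; apply/eqP; ring.
apply: le_trans h1 _; rewrite mulrDr; apply: lerD; last by rewrite mulrA [leRHS]mulrA.
by rewrite mulrCA.
Qed.

(** The interpolation parameter for which [(tau / nu) D eps] equals [nu tau / 16], half of the
    weight carried by the functional. [growth] is the remaining source per unit of time. *)
Definition absorption (D : R) := nu ^+ 2 / (16 * D).
Definition growth s (q : R) :=
  cubic_const s q / nu * ((absorption (cubic_const s q))^-1 ^+ s * q).
(** For [tau <= 1] one step divides the functional by at least [1 + decay_rate tau], after a source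
    [tau growth] has been added. Any level above [growth / decay_rate] is therefore invariant. *)
Definition decay_rate := nu / 8 / (1 + nu / 8).

Lemma decay_rate_gt0 : 0 < decay_rate.
Proof.
have h : 0 < nu / 8 by rewrite divr_gt0.
by rewrite divr_gt0// addr_gt0.
Qed.

Lemma sobolev_energy_step s w (q Y : R) : h1_bounded w q -> H w 0 = 0 ->
  growth s q <= decay_rate * Y ->
  sobolev_energy_bounded s w Y -> sobolev_energy_bounded s (step w) Y.
Proof.
move=> hw w0 gY wY N; have [Hs _ _ _] := step_spec nu0 tau0 hw.
have t0 := ltW tau0; have nt0 : 0 < nu / 8 * tau by rewrite mulr_gt0 ?divr_gt0.
have Wge n k : 0 <= W k ^+ n by apply/exprn_ge0/ltW/sobolev_weight_gt0.
have term0 n (f : int * int -> R) k : 0 <= W k ^+ n * f k ^+ 2.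
  exact: mulr_ge0 (Wge n k) (sqr_ge0 _).
have sum0 n (f : int * int -> R) M : 0 <= \sum_(k <- box M) W k ^+ n * f k ^+ 2.
  by apply: sumr_ge0 => k _; exact: term0.
have q0 := h1_bounded_ge0 hw.
(* Full sums are needed because the cubic estimate on one box sees all frequencies of [w]; passing
   to the limit in the two parts jointly keeps [A + nu / 8 tau B <= Y]. *)
have [A cA Ale] : exists2 l,
    (fun M => \sum_(k <- box M) W k ^+ s * H w k ^+ 2) @ \oo --> l &
    forall M, \sum_(k <- box M) W k ^+ s * H w k ^+ 2 <= l.
  apply: (@box_sum_lim _ Y) => [k|M]; first exact: term0.
  by apply: le_trans (wY M); rewrite lerDl; exact: mulr_ge0 (ltW nt0) (sum0 _ _ _).
have [B cB Ble] : exists2 l,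
    (fun M => \sum_(k <- box M) W k ^+ s.+2 * H w k ^+ 2) @ \oo --> l &
    forall M, \sum_(k <- box M) W k ^+ s.+2 * H w k ^+ 2 <= l.
  apply: (@box_sum_lim _ (Y / (nu / 8 * tau))) => [k|M]; first exact: term0.
  by rewrite ler_pdivlMr// mulrC; apply: le_trans (wY M); rewrite lerDr; exact: sum0.
have AB : A + nu / 8 * tau * B <= Y.
  apply: (cvgr_to_le (cvgD cA (cvgM (cvg_cst (nu / 8 * tau)) cB))).
  by apply: nearW => M; exact: wY.
pose D := cubic_const s q; have D0 : 0 < D.
  by apply: lt_le_trans (cubic_const_ge2 s q).
pose eps := absorption D.
have e0 : 0 < eps by rewrite divr_gt0 ?exprn_gt0 ?mulr_gt0.
have XB M : \sum_(k <- box M) W k ^+ s.+1 * H w k ^+ 2 <= eps * B + eps^-1 ^+ s * q.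
  apply: (@le_trans _ _ (eps * (\sum_(k <- box M) W k ^+ s.+2 * H w k ^+ 2) +
      eps^-1 ^+ s * (\sum_(k <- box M) W k * H w k ^+ 2))); last first.
    apply: lerD; apply: ler_wpM2l; [exact: ltW|exact: Ble| |by have [_ /(_ M)] := hw].
    by rewrite exprn_ge0// invr_ge0 ltW.
  rewrite !mulr_sumr -big_split; apply: ler_sum => k _ /=.
  rewrite [X in X + _]mulrA [X in _ + X]mulrA -mulrDl.
  by apply: (ler_wpM2r (sqr_ge0 _)); exact: weight_interpolation.
have GB := nonlinear_coef_bound N hw XB.
have main : \sum_(k <- box N) W k ^+ s * d w k ^+ 2 +
    nu / 4 * tau * (\sum_(k <- box N) W k ^+ s.+2 * d w k ^+ 2) <=
    A + tau / nu * (D * (eps * B + eps^-1 ^+ s * q)).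
  apply: (@le_trans _ _ (\sum_(k <- box N) W k ^+ s * H w k ^+ 2 +
    tau / nu * (\sum_(k <- box N) W k ^+ s * nonlinear_coef w k ^+ 2))).
    rewrite !mulr_sumr -!big_split; apply: ler_sum => k _; exact: weighted_contraction.
  by apply: lerD (Ale N) _; apply: ler_wpM2l GB; rewrite divr_ge0 ?ltW.
have De : D * eps = nu ^+ 2 / 16 by rewrite /eps /absorption; field; rewrite gt_eqF.
have srcE : tau / nu * (D * (eps * B + eps^-1 ^+ s * q)) =
    nu / 16 * tau * B + tau * growth s q.
  rewrite /growth -/D -/eps mulrDr [D * (eps * B)]mulrA De.
  by move: (eps^-1 ^+ s) => e; field; rewrite gt_eqF.
rewrite srcE in main.
have B0 : 0 <= B := le_trans (sum0 _ _ 0%N) (Ble 0%N).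
have A'B' : \sum_(k <- box N) W k ^+ s * d w k ^+ 2 <=
    \sum_(k <- box N) W k ^+ s.+2 * d w k ^+ 2.
  apply: ler_sum => k _; apply: (ler_wpM2r (sqr_ge0 _)).
  by apply: ler_weXn2l; [exact: sobolev_weight_ge1|rewrite -addn2 leq_addr].
rewrite (eq_bigr (fun k => W k ^+ s * d w k ^+ 2)); last by move=> k _; rewrite Hs.
rewrite [X in _ * X](eq_bigr (fun k => W k ^+ s.+2 * d w k ^+ 2)); last first.
  by move=> k _; rewrite Hs.
move: gY main A'B'; have := sum0 s (d w) N.
move: (\sum_(k <- _) _) (\sum_(k <- _) W k ^+ s * _) (growth s q) => b a c a0.
rewrite /decay_rate; set r := nu / 8 in nt0 AB *; have r0 : 0 < r by rewrite divr_gt0.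
rewrite (_ : nu / 4 = 2 * r); last by rewrite /r; field.
rewrite (_ : nu / 16 = r / 2); last by rewrite /r; field.
move=> gY main ab; have r1 : 0 < 1 + r by lra.
have trB : 0 <= r * tau * B by rewrite mulr_ge0 ?(ltW nt0).
have cY : (1 + r) * c <= r * Y.
  by move: gY; rewrite mulrAC ler_pdivlMr// mulrC.
have b1 : r * a <= r * b by rewrite ler_pM2l.
have rt : 0 <= r * tau * a by rewrite mulr_ge0// ltW.
have F1 : a + 2 * r * tau * b <= Y + tau * c by move: main AB trB; clear; lra.
pose F := a + r * tau * b.
(* Half of the dissipation [2 r tau b] is already in [F]; the other half dominates [r tau a] because
   [a <= b], and the leftover has the sign of [1 - tau]. *)
have F2 : (1 + r + r * tau) * F <= (1 + r) * (a + 2 * r * tau * b).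
  have h1 : r * tau * a <= r * tau * b by rewrite ler_pM2l.
  have h2 : 0 <= r * tau * b * (r * (1 - tau)).
    apply: mulr_ge0; first exact: le_trans h1.
    by rewrite mulr_ge0 ?(ltW r0)// subr_ge0.
  rewrite -subr_ge0 (_ : _ - _ = r * tau * b * (r * (1 - tau)) + (r * tau * b - r * tau * a)).
    by rewrite addr_ge0// subr_ge0.
  by rewrite /F; ring.
have F3 : (1 + r + r * tau) * F <= (1 + r + r * tau) * Y.
  apply: le_trans F2 _; apply: (@le_trans _ _ ((1 + r) * (Y + tau * c))).
    by rewrite ler_pM2l.
  have := ler_wpM2l t0 cY; clear; lra.
rewrite ler_pM2l in F3; first exact: F3.
by rewrite addr_gt0// mulr_gt0.
Qed.

Lemma sobolev_energy_first_step s u (q p : R) : h1_bounded u q -> H u 0 = 0 ->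
  (forall N, \sum_(k <- box N) W k ^+ s.+1 * H u k ^+ 2 <= p) ->
  sobolev_energy_bounded s.+1 (step u) (2 * p + 32 / nu ^+ 2 * (cubic_const s q * p)).
Proof.
move=> hu u0 up N; have [Hs _ _ _] := step_spec nu0 tau0 hu.
have GB := nonlinear_coef_bound N hu up.
have c0 : 0 <= 32 / nu ^+ 2 by exact: divr_ge0 (ler0n _ 32) (sqr_ge0 _).
apply: (@le_trans _ _ (2 * (\sum_(k <- box N) W k ^+ s.+1 * H u k ^+ 2) +
  32 / nu ^+ 2 * (\sum_(k <- box N) W k ^+ s * nonlinear_coef u k ^+ 2))); last first.
  by apply: lerD; [exact: ler_wpM2l (up N)|exact: ler_wpM2l GB].
rewrite !mulr_sumr -!big_split; apply: ler_sum => k _.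
rewrite Hs; apply: le_trans (weighted_smoothing s k u0); rewrite lerD2l.
apply: ler_wpM2r.
  by apply: mulr_ge0 (sqr_ge0 _); apply/exprn_ge0/ltW/sobolev_weight_gt0.
by apply: ler_wpM2r; [exact: ltW|move: nu0; lra].
Qed.

End Step.

(** The bound after the first step plus the invariant level of the recursion. Adding the two, both
    nonnegative, yields a level that dominates each and also covers [p] itself. *)
Definition sobolev_const (nu p : R) s : R :=
  2 * p + 32 / nu ^+ 2 * (cubic_const s p * p) +
  growth nu s.+1 (h1_radius nu p) / decay_rate nu.

End UniformSobolev.

(** * From box sums to Sobolev norms, and the final bound *)

Section SobolevNorm.
Variable R : realType.
Implicit Types (u v w : R * R -> R) (k : int * int).

Local Notation H := (@hartley_coef R).
Local Notation W := (@sobolev_weight R).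

Lemma sobolev_weightN k : W (- k) = W k.
Proof. by rewrite /sobolev_weight wave_normsqN. Qed.

Let fourier_term s u k := W k ^+ s * Normc.normc (fourier u k) ^+ 2.

Let fourier_term_ge0 s u k : 0 <= fourier_term s u k.
Proof. by apply: mulr_ge0 (sqr_ge0 _); apply/exprn_ge0/ltW/sobolev_weight_gt0. Qed.

(** The complex and real coefficients agree only after averaging over [k] and [- k]; boxes are
    symmetric and the weight is even. *)
Lemma sobolev_box_sum s u N : torus_L2 u ->
  \sum_(k <- box N) W k ^+ s * Normc.normc (fourier u k) ^+ 2 =
  \sum_(k <- box N) W k ^+ s * H u k ^+ 2.
Proof.
move=> Lu; have iu := torus_L2_integrable Lu.
pose b := \sum_(k <- box N) W k ^+ s * H u k ^+ 2.
pose a := \sum_(k <- box N) W k ^+ s * H u (- k) ^+ 2.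
have ab : a = b.
  rewrite /b -(sum_box_opp N (fun k => W k ^+ s * H u k ^+ 2)).
  by apply: eq_bigr => k _; rewrite sobolev_weightN.
transitivity ((b + a) / 2); last first.
  by rewrite ab -/b; move: b {ab} => b; field.
rewrite /a /b -big_split /= mulr_suml; apply: eq_bigr => k _.
by rewrite (normc_fourier k iu) mulrA mulrDr.
Qed.

Let esumE s u : (\esum_(k in [set: int * int])
    ((1 + @wave_normsq R k) ^+ s * Normc.normc (fourier u k) ^+ 2)%:E)%E =
  (\esum_(k in [set: int * int]) (fourier_term s u k)%:E)%E.
Proof. by []. Qed.

Let esum_ge0 s u : (0 <= \esum_(k in [set: int * int]) (fourier_term s u k)%:E)%E.
Proof. by apply: esum_ge0 => k _; rewrite lee_fin fourier_term_ge0. Qed.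

Lemma sobolev_norm_le s u (C : R) : torus_L2 u ->
  (forall N, \sum_(k <- box N) W k ^+ s * H u k ^+ 2 <= C) ->
  (sobolev_norm s u <= (Num.sqrt C)%:E)%E.
Proof.
move=> Lu uC; have C0 : 0 <= C.
  apply: le_trans (uC 0%N); apply: sumr_ge0 => k _.
  by apply: mulr_ge0 (sqr_ge0 _); apply/exprn_ge0/ltW/sobolev_weight_gt0.
rewrite /sobolev_norm esumE -[leRHS]/(sqrte C%:E) lee_sqrt ?lee_fin//.
apply: ub_ereal_sup => _ [A [finA _] <-].
have [t tA] : exists t : seq (int * int), A = [set` t] by exact/finite_seqP.
have {}tA : A = [set` undup t] by rewrite tA; apply/seteqP; split=> k /=; rewrite mem_undup.
rewrite tA -fsbig_seq ?undup_uniq// sumEFin lee_fin.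
have [N tN] := subset_box (undup t).
apply: (@le_trans _ _ (\sum_(k <- box N) fourier_term s u k)).
  by apply: le_sum_subset; rewrite ?undup_uniq ?uniq_box.
by rewrite sobolev_box_sum.
Qed.

Lemma box_sum_le_sobolev_norm s u N : torus_L2 u -> (sobolev_norm s u < +oo)%E ->
  \sum_(k <- box N) W k ^+ s * H u k ^+ 2 <= fine (sobolev_norm s u) ^+ 2.
Proof.
move=> Lu; rewrite -sobolev_box_sum// /sobolev_norm esumE.
have := esum_ge0 s u.
have : ((\sum_(k <- box N) fourier_term s u k)%:E <=
    \esum_(k in [set: int * int]) (fourier_term s u k)%:E)%E.
  apply: esum_ge; exists [set` box N]; last by rewrite -fsbig_seq ?uniq_box// sumEFin.
  by split => //; exact: finite_seq.
case: (\esum_(k in _) _)%E => [r| |]//=; rewrite !lee_fin => rN r0 _.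
by rewrite sqr_sqrtr.
Qed.

Lemma sobolev_norm_ge0 s u : (0 <= sobolev_norm s u)%E.
Proof. exact: sqrte_ge0. Qed.

Lemma sobolev_norm_mono s t u : (s <= t)%N -> (sobolev_norm s u <= sobolev_norm t u)%E.
Proof.
move=> st; rewrite /sobolev_norm !esumE lee_sqrt ?esum_ge0//; apply: le_esum => k _.
rewrite lee_fin; apply: (ler_wpM2r (sqr_ge0 _)).
by apply: ler_weXn2l => //; exact: sobolev_weight_ge1.
Qed.

Lemma hartley_coef0 u : torus_L2 u -> mean_zero u -> H u 0 = 0.
Proof.
move=> Lu u0; rewrite /hartley_coef.
have iu := torus_L2_integrable Lu.
transitivity ((2 * pi)^-1 * torus_integral u); last by rewrite u0 mulr0.
rewrite -torus_integralZ//; apply: eq_torus_integral => x _.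
rewrite /hartley /wave_dot /= !mul0r addr0 cos0 sin0 addr0 mulr1; exact: mulrC.
Qed.

Section Monotonicity.
Variable nu : R.
Hypothesis nu0 : 0 < nu.

(** The time-step threshold and the H^1 radius of the iterates are expressed by the H^1 norm, but
    the final constant may refer only to the H^(k0) norm. Monotonicity exchanges one for the
    other. *)
Lemma h1_radius_mono (p q : R) : 0 <= p -> p <= q -> h1_radius nu p <= h1_radius nu q.
Proof.
move=> p0 pq; have q0 := le_trans p0 pq; rewrite /h1_radius.
have fst : first_step_const nu p <= first_step_const nu q.
  apply: lerD; first by apply: ler_wpM2l pq; rewrite mulr_ge0// ltW.
  apply: ler_wpM2l; first by rewrite divr_ge0// ltW.
  apply: ler_pM => //; first exact: cubic_const_ge0.
  rewrite lerD2r; apply: ler_wpM2l; last by rewrite lerXn2r ?nnegrE.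
  exact: mulr_ge0 (ler0n _ 32) (ltW (trilinear_const_gt0 R 0)).
rewrite ler_pM2r ?invr_gt0//; apply: ler_wpM2l; first exact: ler0n.
rewrite /energy_const lerD2r; apply: lerD; first by rewrite ler_pM2r ?invr_gt0.
apply: ler_wpM2l; first by rewrite divr_ge0// (le_trans ler01)// L4_const_ge1.
have f0 := first_step_const_ge0 nu0 p0.
have h (x y : R) : 0 <= x -> x <= y -> (2 * x / nu) ^+ 2 <= (2 * y / nu) ^+ 2.
  move=> x0 xy; have y0 := le_trans x0 xy.
  rewrite lerXn2r ?nnegrE ?divr_ge0 ?mulr_ge0 ?(ltW nu0)//.
  by rewrite ler_pM2r ?invr_gt0// ler_pM2l.
exact: h f0 fst.
Qed.

Lemma h1_bounded_le w (p q : R) : p <= q -> h1_bounded w p -> h1_bounded w q.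
Proof. by move=> pq [Lw wp]; split=> // N; apply: le_trans pq. Qed.

End Monotonicity.

Lemma iterate_periodic nu tau u q n : 0 < nu -> 0 < tau -> tau < max_tau nu q ->
  h1_bounded u q -> H u 0 = 0 -> torus_periodic u ->
  torus_periodic (iterate nu tau u n).
Proof.
move=> nu0 tau0 tau_lt hu u0 pu; case: n => [|n]; first exact: pu.
have [hw _] := iterate_h1_bounded nu0 tau0 n tau_lt hu u0.
by have [_ _ pw _] := step_spec nu0 tau0 hw.
Qed.

Lemma iterate_sobolev_bounded nu tau u (q p : R) s n : 0 < nu -> 0 < tau ->
  tau < max_tau nu q -> h1_bounded u q -> H u 0 = 0 -> q <= p ->
  (forall N, \sum_(k <- box N) W k ^+ s.+1 * H u k ^+ 2 <= p) ->
  forall N, \sum_(k <- box N) W k ^+ s.+1 * H (iterate nu tau u n) k ^+ 2 <=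
    sobolev_const nu p s.
Proof.
move=> nu0 tau0 tau_lt hu u0 qp up; have q0 := h1_bounded_ge0 hu.
have p0 := le_trans q0 qp.
have tau1 : tau <= 1 by move: tau_lt; rewrite lt_min => /andP[/ltW].
have rad0 : 0 <= h1_radius nu p by apply: le_trans (h1_radius_ge nu0 p0).
have g0 : 0 <= growth nu s.+1 (h1_radius nu p).
  have c0 := cubic_const_ge0 s.+1 (h1_radius nu p).
  apply: mulr_ge0; first by rewrite divr_ge0// ltW.
  apply: mulr_ge0 rad0; rewrite exprn_ge0// invr_ge0 divr_ge0 ?sqr_ge0//.
  exact: mulr_ge0 (ler0n _ 16) c0.
have rate0 := decay_rate_gt0 nu0.
have gr0 : 0 <= growth nu s.+1 (h1_radius nu p) / decay_rate nu.
  by rewrite divr_ge0// ltW.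
have c0 : 0 <= 32 / nu ^+ 2 * (cubic_const s p * p).
  apply: mulr_ge0; first exact: divr_ge0 (ler0n _ 32) (sqr_ge0 _).
  by apply: mulr_ge0 p0; exact: cubic_const_ge0.
case: n => [|n] N.
  apply: le_trans (up N) _; rewrite /sobolev_const.
  by move: (32 / nu ^+ 2 * _) (growth _ _ _ / _) c0 gr0 => a b a0 b0; lra.
have nxt j := iterate_h1_bounded nu0 tau0 j tau_lt hu u0.
have main j : sobolev_energy_bounded nu tau s.+1 (iterate nu tau u j.+1)
    (sobolev_const nu p s).
  elim: j => [|j IH]; rewrite iterateS.
    have hp := h1_bounded_le qp hu.
    move=> M; apply: le_trans (sobolev_energy_first_step nu0 tau0 hp u0 up M) _.
    by rewrite /sobolev_const lerDl.
  have [hw w0] := nxt j.+1.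
  have hw' := h1_bounded_le (h1_radius_mono nu0 q0 qp) hw.
  apply: (sobolev_energy_step nu0 tau0 tau1 hw' w0 _ IH).
  rewrite /sobolev_const mulrDr [X in _ + X]mulrCA mulfV ?gt_eqF// mulr1 lerDr.
  apply: mulr_ge0 (ltW rate0) _; apply: addr_ge0 c0.
  by rewrite mulr_ge0.
apply: le_trans (main n N); rewrite lerDl; apply: mulr_ge0.
  by rewrite mulr_ge0 ?divr_ge0 ?ltW.
apply: sumr_ge0 => k _.
by apply: mulr_ge0 (sqr_ge0 _); apply/exprn_ge0/ltW/sobolev_weight_gt0.
Qed.

End SobolevNorm.

Theorem theorem1p1 (R : realType) :
  exists (tau_star : R -> R -> R) (A1 : R -> R -> nat -> R),
    [/\ forall h1 nu : R, 0 < nu -> 0 < tau_star h1 nu,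
        forall (hk nu : R) (k0 : nat), 0 < nu -> 0 < A1 hk nu k0 &
        forall (nu : R) (k0 : nat) (u0 : R * R -> R),
          0 < nu -> (1 <= k0)%N -> sobolev k0 u0 -> mean_zero u0 ->
          forall tau : R,
            0 < tau -> tau < tau_star (fine (sobolev_norm 1 u0)) nu ->
            (forall n : nat, sobolev k0 (iterate nu tau u0 n)) /\
            (ereal_sup
               [set sobolev_norm k0 (iterate nu tau u0 n) | n in [set: nat]]
             <= (A1 (fine (sobolev_norm k0 u0)) nu k0)%:E)%E].
Proof.
exists (fun h1 nu => max_tau nu (h1 ^+ 2)).
(* The summand 1 makes the constant positive for every value of [hk]. The index is shifted because
   [sobolev_const] at [s] concerns the order [s.+1]. *)
exists (fun hk nu k0 => 1 + Num.sqrt (sobolev_const nu (hk ^+ 2) k0.-1)).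
split=> [h1 nu nu0|hk nu k0 nu0|nu [//|s] u0 nu0 _ [pu Lu su] mu tau tau0 tau_lt].
- by apply: max_tau_gt0 (sqr_ge0 _).
- by rewrite ltr_pwDl ?sqrtr_ge0.
have s1_le := sobolev_norm_mono u0 (ltn0Sn s).
have s1_lt : (sobolev_norm 1 u0 < +oo)%E by exact: le_lt_trans su.
have hu : h1_bounded u0 (fine (sobolev_norm 1 u0) ^+ 2).
  split=> // N; have := box_sum_le_sobolev_norm N Lu s1_lt.
  by under eq_bigr do rewrite expr1.
have norm_le : fine (sobolev_norm 1 u0) ^+ 2 <= fine (sobolev_norm s.+1 u0) ^+ 2.
  rewrite lerXn2r ?nnegrE ?fine_ge0 ?sobolev_norm_ge0//.
  by rewrite fine_le// ge0_fin_numE ?sobolev_norm_ge0.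
have u00 := hartley_coef0 Lu mu.
have L2 n : torus_L2 (iterate nu tau u0 n).
  by have [[]] := iterate_h1_bounded nu0 tau0 n tau_lt hu u00.
have norm_iter n := sobolev_norm_le (L2 n) (iterate_sobolev_bounded n nu0 tau0 tau_lt
  hu u00 norm_le (fun N => box_sum_le_sobolev_norm N Lu su)).
split=> [n|].
  split; first exact: iterate_periodic nu0 tau0 tau_lt hu u00 pu.
    exact: L2.
  exact: le_lt_trans (norm_iter n) (ltry _).
apply: ub_ereal_sup => _ [n _ <-]; apply: le_trans (norm_iter n) _.
by rewrite lee_fin lerDr.
Qed.
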